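(* Let $\Gamma\subset\mathbb{C}$ be a lattice, let $(e_1,e_2,e_3)$ be a properly ordered triple of the distinct roots of $4x^3-g_2(\Gamma)x-g_3(\Gamma)$, and let $e^{(n)}=(e_1^{(n)},\{e_2^{(n)},e_3^{(n)}\})$, $n\ge1$, be the sequence defined by $$e^{(1)}=\mathscr L(e_1,\{e_2,e_3\}),\qquad e^{(n)}=\widetilde{\mathscr L}(\mathscr F(e^{(n-1)}))\quad(n\ge2).$$ Put $\omega_N=i\pi/\sqrt{3e_1^{(N)}}$, $$\phi_n(x)=x+\frac{(e_2^{(n)}-e_1^{(n)})(e_3^{(n)}-e_1^{(n)})}{x-e_1^{(n)}},\qquad \Phi_N=\phi_1\circ\dots\circ\phi_N.$$ Assume that $z\in\mathbb{C}$, $z\notin\Gamma$, and let $$x_N=\frac{\pi^2}{\omega_N^2}\left(\frac1{\sin\left(\frac{\pi z}{\omega_N}\right)^2}-\frac13\right).$$ Then $\Phi_N(x_N)$ converges to $\wp(z;\Gamma)$ quadratically fast as $N\to\infty$.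
   Context: A lattice is a discrete additive subgroup of $\mathbb{C}$ of rank $2$; $\wp(z;\Gamma)=\frac1{z^2}+\sum_{u\in\Gamma\setminus\{0\}}\left(\frac1{(z-u)^2}-\frac1{u^2}\right)$, $g_2(\Gamma)=\sum_{u\in\Gamma\setminus\{0\}}60u^{-4}$, $g_3(\Gamma)=\sum_{u\in\Gamma\setminus\{0\}}140u^{-6}$. A triple of complex numbers $(e_1,e_2,e_3)$ is properly ordered if $|e_2-e_3|\le|e_1-e_3|\le|e_1-e_2|$. Let $\mathbb{C}^{(n)}$ be the set of unordered $n$-tuples of complex numbers. The map $\mathscr L:\mathbb{C}\times\mathbb{C}^{(2)}\to\mathbb{C}\times\mathbb{C}^{(2)}$ is defined by: $(f_1,\{f_2,f_3\})=\mathscr L(e_1,\{e_2,e_3\})$ if $$f_1=-\frac{e_1}2,\quad f_1+f_2+f_3=0,\quad 16(f_2-f_1)(f_3-f_1)=(e_2-e_3)^2.$$ The map $\mathscr F:\mathbb{C}\times\mathbb{C}^{(2)}\to\mathbb{C}^{(3)}$ is $\mathscr F(e_1,\{e_2,e_3\})=\{e_1,e_2,e_3\}$. Let $\mathfrak G\subset\mathbb{C}^{(3)}$ be the set of unordered triples $\{e_1,e_2,e_3\}$ with $e_1+e_2+e_3=0$ for which there is a permutation $(j,k,l)$ of $(1,2,3)$ with $|e_j-e_k|>|e_k-e_l|$ and $|e_j-e_l|>|e_k-e_l|$; on $\mathfrak G$ define $\mathscr S(\{e_1,e_2,e_3\})=(e_j,\{e_k,e_l\})$ for this choice of $j$, and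 $\widetilde{\mathscr L}:\mathfrak G\to\mathbb{C}\times\mathbb{C}^{(2)}$, $\widetilde{\mathscr L}(e)=\mathscr L(\mathscr S(e))$. (In the setting of the claim, all the triples $\mathscr F(e^{(n)})$, $n\ge 1$, lie in $\mathfrak G$, so the sequence $e^{(n)}$ is well defined.) The choice of the square root in $\omega_N$ is immaterial, since $x_N$ does not change when $\omega_N$ is replaced by $-\omega_N$. A sequence of complex numbers $a_n$ converges to $a$ quadratically fast if there exist $C,q>0$ such that $|a_n-a|\le C\exp(-q2^n)$ for all $n$; for the sequence here, whose terms are guaranteed to be finite only for large $N$, this is understood for all sufficiently large $N$. *)

(* Defs.v *)
From HB Require Import structures.
From mathcomp Require Import all_boot all_order all_algebra.
From mathcomp Require Import finmap multiset complex.
From mathcomp Require Import all_classical all_reals all_analysis.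
From mathcomp.analysis.showcase Require summability.

Set Implicit Arguments.
Unset Strict Implicit.
Unset Printing Implicit Defensive.

Import Order.TTheory GRing.Theory Num.Theory.
Import numFieldNormedType.Exports.
Local Open Scope classical_set_scope.
Local Open Scope ring_scope.
Local Open Scope complex_scope.

Section UnorderedTuples.
Variable T : choiceType.

Record unordered (n : nat) := Unordered {
  umset :> {mset T}%mset;
  _ : size umset == n
}.
HB.instance Definition _ n := [isSub for @umset n].
HB.instance Definition _ n := [Choice of unordered n by <:].

Lemma size_seq_mset n (t : n.-tuple T) : size (seq_mset t) == n.
Proof. by rewrite (perm_size (perm_eq_seq_mset _)) size_tuple. Qed.

Definition forget_order n (t : n.-tuple T) : unordered n :=
  Unordered (size_seq_mset t).

Lemma size_ucons n (a : T) (s : unordered n) :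
  size (seq_mset (a :: umset s)) == n.+1.
Proof. by case: s => m /= hm; rewrite (perm_size (perm_eq_seq_mset _)). Qed.

Definition ucons n (a : T) (s : unordered n) : unordered n.+1 :=
  Unordered (size_ucons a s).

Definition upair (a b : T) : unordered 2 := forget_order [tuple a; b].
Definition utriple (a b c : T) : unordered 3 := forget_order [tuple a; b; c].

End UnorderedTuples.

Section Weierstrass.
Variable R : realType.
Local Notation C := R[i].

(* The rank condition asks for a basis of [G] as a free abelian group. *)
Definition is_lattice (G : set C) : Prop :=
  [/\ G 0 /\ (forall u v, G u -> G v -> G (u - v)),
      exists2 r : R, 0 < r & forall u, G u -> u != 0 -> r%:C <= `|u| &
      exists w1 w2 : C,
        G = [set u | exists m n : int, u = w1 *~ m + w2 *~ n] /\
        forall m n : int, w1 *~ m + w2 *~ n = 0 -> m = 0 /\ n = 0].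

(* The limit of the finite partial sums along inclusion; [(R[i])^o] carries
   the normed topology of the complex numbers. *)
Definition lattice_sum (G : set C) (f : C -> C) : C :=
  summability.sum (fun u : (G `\ 0 : set C) => f (\val u) : C^o).

Definition wp (G : set C) (z : C) : C :=
  1 / z ^+ 2 + lattice_sum G (fun u => 1 / (z - u) ^+ 2 - 1 / u ^+ 2).

Definition g2 (G : set C) : C := lattice_sum G (fun u => 60 * u ^- 4).
Definition g3 (G : set C) : C := lattice_sum G (fun u => 140 * u ^- 6).

Definition weierstrass_cubic (G : set C) : {poly C} :=
  4 *: 'X^3 - g2 G *: 'X - (g3 G)%:P.

Definition properly_ordered (e1 e2 e3 : C) : bool :=
  `|e2 - e3| <= `|e1 - e3| <= `|e1 - e2|.

End Weierstrass.

Section Landen.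
Variable R : realType.
Local Notation C := R[i].
Local Notation marked := (C * unordered C 2)%type.

Definition landen_rel (e f : marked) : Prop :=
  exists e2 e3 f2 f3 : C,
    [/\ e.2 = upair e2 e3, f.2 = upair f2 f3,
        f.1 = - e.1 / 2, f.1 + f2 + f3 = 0 &
        16 * (f2 - f.1) * (f3 - f.1) = (e2 - e3) ^+ 2].

(* [landen_rel e] holds for exactly one [f], so the default is never used. *)
Definition landen (e : marked) : marked := xget e [set f | landen_rel e f].

Definition forget_mark (e : marked) : unordered C 3 := ucons e.1 e.2.

Definition mark_rel (t : unordered C 3) (e : marked) : Prop :=
  exists ej ek el : C,
    [/\ t = utriple ej ek el, ej + ek + el = 0,
        `|ej - ek| > `|ek - el|, `|ej - el| > `|ek - el| &
        e = (ej, upair ek el)].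

Definition markable : set (unordered C 3) :=
  [set t | exists e, mark_rel t e].

(* The mark is unique on [markable]; the default is used outside of it. *)
Definition mark (t : unordered C 3) : marked :=
  xget (0, upair 0 0) [set e | mark_rel t e].

Definition landen_tilde (t : unordered C 3) : marked := landen (mark t).

(* [None] is the point at infinity of the Riemann sphere. The numerator is
   nonzero in the intended use, so the pole at [e.1] is genuine. *)
Definition phi (e : marked) (x : option C) : option C :=
  if x is Some w then
    if w == e.1 then None
    else Some (w + (\prod_(a <- e.2) (a - e.1)) / (w - e.1))
  else None.

Definition Phi (e : nat -> marked) (N : nat) : option C -> option C :=
  \big[@comp _ _ _ / id]_(1 <= n < N.+1) phi (e n).

Definition cexp (z : C) : C :=
  (expR (complex.Re z))%:C * (cos (complex.Im z) +i* sin (complex.Im z)).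

Definition csin (z : C) : C :=
  (cexp ('i%C * z) - cexp (- ('i%C * z))) / (2 * 'i%C).

Definition omega (e : nat -> marked) (N : nat) : C :=
  'i%C * pi%:C / sqrtC (3 * (e N).1).

Definition start (z : C) (e : nat -> marked) (N : nat) : option C :=
  let w := omega e N in
  let s := csin (pi%:C * z / w) in
  if s == 0 then None
  else Some (pi%:C ^+ 2 / w ^+ 2 * (1 / s ^+ 2 - 1 / 3)).

End Landen.

(* Only the tail is constrained: finitely many terms may be infinite or far
   from [l]. *)
Definition cvg_quadratically (R : realType) (a : nat -> option R[i])
    (l : R[i]) : Prop :=
  exists c q : R, [/\ 0 < c, 0 < q &
    \forall N \near \oo, exists2 w, a N = Some w &
      `|w - l| <= (c * expR (- (q * 2 ^+ N)))%:C].

(* Main.v *)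
Require Import Defs.
From HB Require Import structures.
From mathcomp Require Import all_boot all_order all_algebra.
From mathcomp Require Import finmap multiset complex.
From mathcomp Require Import all_classical all_reals all_analysis.
From mathcomp Require Import ring lra zify.
From mathcomp.analysis.showcase Require summability.

(** One step of the recursion for the triples is a change of lattice.  Let [P]
be the Weierstrass function of the lattice with half periods [a] and [b], and
[Q] that of the sublattice of index two with half periods [2a] and [b].
Splitting the sum that defines [P] into two cosets gives
[P z = Q z + Q (z - 2a) - Q (2a)], and by Liouville's theorem the product
[(Q z - Q (2a)) (Q (z - 2a) - Q (2a))] is a constant, namely
[(Q b - Q (2a)) (Q (2a + b) - Q (2a))].  Hence [P = phi Q], where [phi] is the
map of the statement for the values of [Q] at its half periods with [Q (2a)]
marked (landen_phi), and evaluation at the half periods of the larger lattice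
shows that these values arise from [P b, {P a, P (a + b)}] by the three
equations that define the Landen map (landen_value1, landen_value23).  So the
triples are the values at the half periods of the members of a decreasing
chain of lattices that starts at [G], and [wp G z] is the image under [Phi] of
the value at [z] of the function of the [N]th lattice.

Marking the root that is farther from the two others makes the recursion
an arithmetic-geometric mean: the difference of the two unmarked values is
squared at each step, up to a bounded factor, while their distance to the
marked one stays bounded below (agm_step, chain_limits).  So the marked values
converge quadratically to a number [eps <> 0].  The
intersection of the chain is a cyclic group generated by some [g], and by
dominated convergence the functions of the chain converge to the sum over this
group (chain_wp_tends), which is
[(pi / g) ^ 2 (1 / sin (pi z / g) ^ 2 - 1 / 3)] (wps_multiples).  Passing to the
limit in the duplication formula forces [eps = - (pi / g) ^ 2 / 3]
(limit_value); so [omega ^ 2] converges to [g ^ 2], the starting value [x_N]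
converges quadratically to the limit function at [z], and so do the values at
[z] of the functions of the chain, whose increments are of the order of the
squared gaps.  Near these values the maps [phi] are eventually
Lipschitz with constant two, so [Phi] enlarges the error by at most a constant
times [2 ^ N], which a quadratically small error absorbs (pull_back).

The classical facts about the Weierstrass function are derived without its
derivative.  Periodicity is a telescoping sum over boxes.  Holomorphy is
replaced by the existence of a polynomial approximation at every point, which
suffices for the maximum principle and for Liouville's theorem.  Splitting the
sum over the half lattice into four cosets gives a duplication formula
(hwp_dup); evaluated at quarter periods it shows that the three values at half
periods add up to zero, and expanded at the origin it expresses [g2] and [g3]
by their symmetric functions (half_invariants), so that the roots of the cubic
are these values.  The sum over the integers is identified with the
inverse square of the sine by the bound-halving argument of Herglotz. *)

Set Implicit Arguments.
Unset Strict Implicit.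
Unset Printing Implicit Defensive.

Import Order.TTheory GRing.Theory Num.Theory.
Import numFieldNormedType.Exports.
Local Open Scope classical_set_scope.
Local Open Scope ring_scope.
Local Open Scope complex_scope.

Local Notation nm := Normc.normc.

(** * The modulus of a complex number *)

Section Modulus.
Variable R : realType.
Local Notation C := R[i].
Implicit Types x y z : C.

Lemma nm_ge0 x : 0 <= nm x.
Proof. by case: x => a b; rewrite sqrtr_ge0. Qed.

Lemma nm0 : nm (0 : C) = 0.
Proof. exact: Normc.normc0. Qed.

Lemma nm1 : nm (1 : C) = 1.
Proof. exact: Normc.normc1. Qed.

Lemma nm_eq0 x : (nm x == 0) = (x == 0).
Proof.
apply/eqP/eqP; first exact: Normc.eq0_normc.
by move=> ->; rewrite nm0.
Qed.

Lemma nm_gt0 x : (0 < nm x) = (x != 0).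
Proof. by rewrite lt_def nm_ge0 andbT nm_eq0. Qed.

Lemma nmM x y : nm (x * y) = nm x * nm y.
Proof. exact: Normc.normcM. Qed.

Lemma nmV x : nm x^-1 = (nm x)^-1.
Proof. exact: Normc.normcV. Qed.

Lemma nmN x : nm (- x) = nm x.
Proof. exact: normcN. Qed.

Lemma nmX x n : nm (x ^+ n) = nm x ^+ n.
Proof. by elim: n => [|n IH]; rewrite ?expr0 ?nm1// !exprS nmM IH. Qed.

Lemma nmD x y : nm (x + y) <= nm x + nm y.
Proof. exact: le_normcD. Qed.

Lemma nmB x y : nm (x - y) <= nm x + nm y.
Proof. by rewrite -(nmN y) nmD. Qed.

Lemma nmC x y : nm (x - y) = nm (y - x).
Proof. by rewrite -nmN opprB. Qed.

Lemma nm_sub x y : nm x - nm y <= nm (x - y).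
Proof. by rewrite lerBlDr -{1}(subrK y x) nmD. Qed.

Lemma nm_tri z x y : nm (x - y) <= nm (x - z) + nm (z - y).
Proof. by rewrite (_ : x - y = (x - z) + (z - y)) ?nmD// addrA subrK. Qed.

Lemma normE x : `|x| = (nm x)%:C.
Proof. by rewrite normc_def; case: x. Qed.

Lemma nm_real (a : R) : nm a%:C = `|a|.
Proof. by rewrite /= expr0n /= addr0 sqrtr_sqr. Qed.

Lemma nm_nat n : nm (n%:R : C) = n%:R.
Proof. by rewrite -(rmorph_nat (real_complex R)) nm_real ger0_norm. Qed.

Lemma nm_i : nm ('i%C : C) = 1.
Proof. by rewrite /= expr0n /= add0r expr1n sqrtr1. Qed.

Lemma nm_sum (I : Type) (r : seq I) (P : pred I) (F : I -> C) :
  nm (\sum_(i <- r | P i) F i) <= \sum_(i <- r | P i) nm (F i).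
Proof.
elim/big_rec2: _ => [|i y1 y2 _ H]; first by rewrite nm0.
by apply: le_trans (nmD _ _) _; rewrite lerD2l.
Qed.

Lemma sqr_nm x : nm x ^+ 2 = complex.Re x ^+ 2 + complex.Im x ^+ 2.
Proof. by case: x => a b; rewrite sqr_sqrtr// addr_ge0 ?sqr_ge0. Qed.

Lemma normr_Re_nm x : `|complex.Re x| <= nm x.
Proof.
by rewrite -(@ler_pXn2r _ 2)// ?nnegrE ?nm_ge0// sqr_nm real_normK ?num_real//
  lerDl sqr_ge0.
Qed.

Lemma normr_Im_nm x : `|complex.Im x| <= nm x.
Proof.
by rewrite -(@ler_pXn2r _ 2)// ?nnegrE ?nm_ge0// sqr_nm real_normK ?num_real//
  lerDr sqr_ge0.
Qed.

Lemma nm_le_ReIm x : nm x <= `|complex.Re x| + `|complex.Im x|.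
Proof.
rewrite [X in nm X]complexE (le_trans (nmD _ _))// nmM nm_i mul1r.
by rewrite !nm_real.
Qed.

Lemma nm_small_eq x y : (forall eps : R, 0 < eps -> nm (x - y) <= eps) -> x = y.
Proof.
move=> H; apply/eqP; rewrite -subr_eq0 -nm_eq0; apply/eqP/le_anti.
rewrite nm_ge0 andbT; apply/ler_addgt0Pr => e e0; rewrite add0r; exact: H.
Qed.

End Modulus.

(** * Limits of complex sequences *)

Section Limits.
Variable R : realType.
Local Notation C := R[i].

(** A self-contained form of convergence, phrased with the real-valued modulus so that
estimates stay in the real field. *)
Definition tends (u : nat -> C) (l : C) := forall eps : R, 0 < eps ->
  exists N, forall n, (N <= n)%N -> nm (u n - l) < eps.

Lemma tends_cst l : tends (fun=> l) l.
Proof. by move=> e e0; exists 0%N => n _; rewrite subrr nm0. Qed.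

Lemma tendsD u v l m : tends u l -> tends v m -> tends (fun n => u n + v n) (l + m).
Proof.
move=> hu hv e e0; have e2 : 0 < e / 2 by rewrite divr_gt0.
have [N1 H1] := hu _ e2; have [N2 H2] := hv _ e2.
exists (maxn N1 N2) => n; rewrite geq_max => /andP[/H1 h1 /H2 h2].
rewrite (_ : _ - _ = (u n - l) + (v n - m)); last by ring.
by apply: le_lt_trans (nmD _ _) _; rewrite [e]splitr ltrD.
Qed.

Lemma tends_bounded u l : tends u l ->
  exists B, exists N, forall n, (N <= n)%N -> nm (u n) <= B.
Proof.
move=> /(_ 1 ltr01)[N H]; exists (nm l + 1), N => n /H h.
rewrite -[u n](subrK l) addrC (le_trans (nmD _ _))// lerD2l; exact: ltW.
Qed.

Lemma tendsM u v l m : tends u l -> tends v m -> tends (fun n => u n * v n) (l * m).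
Proof.
move=> hu hv e e0; have [B [N0 HB]] := tends_bounded hu.
pose K := `|B| + nm m + 1.
have K0 : 0 < K by rewrite ltr_wpDl// addr_ge0 ?nm_ge0.
have e2 : 0 < e / (2 * K) by rewrite divr_gt0// mulr_gt0.
have [N1 H1] := hu _ e2; have [N2 H2] := hv _ e2.
exists (maxn N0 (maxn N1 N2)) => n; rewrite !geq_max => /and3P[/HB h0 /H1 h1 /H2 h2].
rewrite (_ : _ - _ = u n * (v n - m) + (u n - l) * m); last by ring.
apply: le_lt_trans (nmD _ _) _; rewrite !nmM.
have hK : e = K * (e / (2 * K)) + K * (e / (2 * K)) by field; rewrite gt_eqF.
rewrite hK; set d := e / _ in h1 h2 e2 *.
have uK : nm (u n) <= K.
  by rewrite (le_trans h0)// (le_trans (ler_norm _))// /K -addrA lerDl addr_ge0 ?nm_ge0.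
have mK : nm m <= K by rewrite /K -addrA addrCA lerDl addr_ge0.
apply: ltr_leD.
  rewrite (@le_lt_trans _ _ (K * nm (v n - m)))// ?ler_wpM2r ?nm_ge0//.
  by rewrite ltr_pM2l.
by rewrite mulrC ler_pM ?nm_ge0// ltW.
Qed.

Lemma tendsN u l : tends u l -> tends (fun n => - u n) (- l).
Proof.
by move=> hu e e0; have [N H] := hu _ e0; exists N => n /H; rewrite -opprD nmN.
Qed.

Lemma tendsB u v l m : tends u l -> tends v m -> tends (fun n => u n - v n) (l - m).
Proof. by move=> hu /tendsN; exact: tendsD. Qed.

Lemma tends_eq u v l : (exists N, forall n, (N <= n)%N -> u n = v n) ->
  tends u l -> tends v l.
Proof.
move=> [N1 h] hu e e0; have [N H] := hu _ e0; exists (maxn N1 N) => n.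
by rewrite geq_max => /andP[/h <- /H].
Qed.

Lemma tends_uniq u l m : tends u l -> tends u m -> l = m.
Proof.
move=> hu hv; apply: nm_small_eq => e e0.
have e2 : 0 < e / 2 by rewrite divr_gt0.
have [N1 H1] := hu _ e2; have [N2 H2] := hv _ e2.
pose n := maxn N1 N2.
rewrite (le_trans (nm_tri (u n) _ _))// [e]splitr nmC.
by rewrite ltW// ltrD// ?H1 ?H2 ?leq_maxl ?leq_maxr.
Qed.

Lemma tends_bound u l B : tends u l ->
  (exists N, forall n, (N <= n)%N -> nm (u n) <= B) -> nm l <= B.
Proof.
move=> hu [N1 h]; apply/ler_addgt0Pr => e e0.
have [N H] := hu _ e0; pose n := maxn N1 N.
rewrite -(subrK (u n) l) (le_trans (nmD _ _))// addrC nmC.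
by rewrite lerD ?h ?leq_maxl// ltW// H// leq_maxr.
Qed.

End Limits.

(** * Unordered sums of complex numbers *)

Section Sums.
Variables (R : realType) (I : choiceType).
Local Notation C := R[i].
Implicit Types (A : set I) (B : R) (f g : I -> C) (K J : {fset I}).

(** Convergence along the finite subsets of [A], ordered by inclusion. *)
Definition has_sum A f (l : C) := forall eps : R, 0 < eps ->
  exists J, [set` J] `<=` A /\
    forall K, (J `<=` K)%fset -> [set` K] `<=` A ->
      nm (\sum_(i <- K) f i - l) < eps.

Definition abs_bounded A f B :=
  forall K, [set` K] `<=` A -> \sum_(i <- K) nm (f i) <= B.

Lemma has_sum_uniq A f l m : has_sum A f l -> has_sum A f m -> l = m.
Proof.
move=> hl hm; apply: nm_small_eq => e e0.
have e2 : 0 < e / 2 by rewrite divr_gt0.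
have [J1 [J1A H1]] := hl _ e2; have [J2 [J2A H2]] := hm _ e2.
have JA : [set` (J1 `|` J2)%fset] `<=` A.
  by move=> i /=; rewrite inE => /orP[/J1A|/J2A].
have := H1 _ (fsubsetUl _ _) JA; have := H2 _ (fsubsetUr _ _) JA.
set s := \sum_(i <- _) _ => h2 h1.
by rewrite (le_trans (nm_tri s _ _))// [e]splitr nmC ltW// ltrD.
Qed.

Lemma eq_has_sum A f g l : (forall i, A i -> f i = g i) ->
  has_sum A f l -> has_sum A g l.
Proof.
move=> fg hl e e0; have [J [JA H]] := hl _ e0; exists J; split=> // K JK KA.
by rewrite (eq_big_seq f) ?H// => i /KA/fg.
Qed.

Lemma has_sum0 A : has_sum A (fun=> 0) 0.
Proof.
move=> e e0; exists fset0; split=> [i /=|K _ _]; first by rewrite inE.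
by rewrite big1// subrr nm0.
Qed.

Lemma has_sum_set0 f : has_sum set0 f 0.
Proof. exact: (eq_has_sum (f := fun=> 0)) (has_sum0 _). Qed.

Lemma has_sumD A f g l m : has_sum A f l -> has_sum A g m ->
  has_sum A (fun i => f i + g i) (l + m).
Proof.
move=> hl hm e e0; have e2 : 0 < e / 2 by rewrite divr_gt0.
have [J1 [J1A H1]] := hl _ e2; have [J2 [J2A H2]] := hm _ e2.
exists (J1 `|` J2)%fset; split.
  by move=> i /=; rewrite inE => /orP[/J1A|/J2A].
move=> K; rewrite fsubUset => /andP[/H1 h1 /H2 h2] KA.
rewrite big_split /= opprD addrACA (le_lt_trans (nmD _ _))// [e]splitr.
by rewrite ltrD// ?h1 ?h2.
Qed.

Lemma has_sumZ A f l c : has_sum A f l -> has_sum A (fun i => c * f i) (c * l).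
Proof.
move=> hl e e0; have c0 : 0 < nm c + 1 by rewrite ltr_wpDl ?nm_ge0.
have e2 : 0 < e / (nm c + 1) by rewrite divr_gt0.
have [J [JA H]] := hl _ e2; exists J; split=> // K JK KA.
rewrite -big_distrr /= -mulrBr nmM.
have := H _ JK KA; rewrite ltr_pdivlMr// mulrC; apply: le_lt_trans.
by rewrite ler_wpM2r ?nm_ge0// lerDl.
Qed.

Lemma has_sumN A f l : has_sum A f l -> has_sum A (fun i => - f i) (- l).
Proof.
move=> /(has_sumZ (-1)); rewrite mulN1r; apply: eq_has_sum => i _.
by rewrite mulN1r.
Qed.

Lemma has_sumB A f g l m : has_sum A f l -> has_sum A g m ->
  has_sum A (fun i => f i - g i) (l - m).
Proof. by move=> hl /has_sumN; exact: has_sumD. Qed.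

Lemma has_sum1 a f : has_sum [set a] f (f a).
Proof.
move=> e e0; exists [fset a]%fset; split=> [i /=|K aK Ka].
  by rewrite inE => /eqP.
suff -> : K = [fset a]%fset by rewrite big_seq_fset1 subrr nm0.
apply/eqP; rewrite eqEfsubset aK andbT; apply/fsubsetP => i /Ka /= ->.
by rewrite inE.
Qed.

Lemma has_sumU A (B : set I) f l m : A `&` B = set0 ->
  has_sum A f l -> has_sum B f m -> has_sum (A `|` B) f (l + m).
Proof.
move=> AB hl hm e e0; have e2 : 0 < e / 2 by rewrite divr_gt0.
have [J1 [J1A H1]] := hl _ e2; have [J2 [J2A H2]] := hm _ e2.
exists (J1 `|` J2)%fset; split.
  by move=> i /=; rewrite inE => /orP[/J1A|/J2A]; [left|right].
move=> K; rewrite fsubUset => /andP[/fsubsetP JK1 /fsubsetP JK2] KAB.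
rewrite (big_fsetID _ (mem A)) /= opprD addrACA (le_lt_trans (nmD _ _))//.
rewrite [e]splitr ltrD//; [apply: H1|apply: H2].
- by apply/fsubsetP => i iJ; rewrite !inE /= JK1//=; apply/mem_set/J1A.
- by move=> i /=; rewrite !inE /= => /andP[_ /set_mem].
- apply/fsubsetP => i iJ; rewrite !inE /= JK2//=; apply/negP => /set_mem Ai.
  have : (A `&` B) i by split=> //; apply: J2A.
  by rewrite AB.
- move=> i /=; rewrite !inE /= => /andP[iK /negP iA].
  by case: (KAB i iK) => // Ai; case: iA; apply/mem_set.
Qed.

Lemma has_sum_bij (h h' : I -> I) A f l : cancel h h' -> cancel h' h ->
  has_sum A (fun i => f (h i)) l -> has_sum [set j | A (h' j)] f l.
Proof.
move=> hK h'K hl e e0; have [J [JA H]] := hl _ e0.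
exists [fset h i | i in J]%fset; split.
  by move=> _ /imfsetP[i /= iJ ->]; rewrite /= hK; apply: JA.
move=> K JK KA.
have -> : \sum_(j <- K) f j = \sum_(i <- [fset h' j | j in K]%fset) f (h i).
  rewrite big_imfset /=; last by move=> x y _ _; apply: can_inj.
  by apply: eq_bigr => j _; rewrite h'K.
apply: H.
  apply/fsubsetP => i iJ; apply/imfsetP; exists (h i); rewrite ?hK//=.
  by apply: (fsubsetP JK); apply/imfsetP; exists i.
by move=> _ /imfsetP[j /= jK ->]; apply: KA.
Qed.

Lemma abs_bounded_sub A A' f B : A' `<=` A -> abs_bounded A f B ->
  abs_bounded A' f B.
Proof. by move=> AA h K KA; apply: h; apply: subset_trans AA. Qed.

Lemma abs_bounded_le A f g B c : 0 <= c ->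
  (forall i, A i -> nm (g i) <= c * nm (f i)) ->
  abs_bounded A f B -> abs_bounded A g (c * B).
Proof.
move=> c0 fg h K KA; apply: (@le_trans _ _ (c * \sum_(i <- K) nm (f i))).
  by rewrite big_distrr /= big_seq [leRHS]big_seq; apply: ler_sum => i /KA/fg.
by rewrite ler_wpM2l// h.
Qed.

Lemma has_sum_le A f l B : abs_bounded A f B -> has_sum A f l -> nm l <= B.
Proof.
move=> h hl; apply/ler_addgt0Pr => e e0; have [J [JA H]] := hl _ e0.
rewrite -(subrK (\sum_(i <- J) f i) l) (le_trans (nmD _ _))// addrC lerD//.
  by rewrite (le_trans (nm_sum _ _ _))// h.
by rewrite nmC ltW// H.
Qed.

(** The finite partial sums of the absolute values come arbitrarily close to
their supremum, so what lies outside a suitable finite set is small. *)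
Lemma abs_bounded_tail A f B : abs_bounded A f B -> forall eps : R, 0 < eps ->
  exists J, [set` J] `<=` A /\
    forall K, [disjoint J & K]%fset -> [set` K] `<=` A ->
      \sum_(i <- K) nm (f i) < eps.
Proof.
move=> h e e0.
pose S := [set s : R | exists2 K : {fset I}, [set` K] `<=` A & s = \sum_(i <- K) nm (f i)].
have hS : has_sup S.
  split; last by exists B => s [K KA ->]; apply: h.
  by exists (\sum_(i <- fset0) nm (f i)), fset0 => // i /=; rewrite inE.
have [_ [J JA ->] ltJ] := sup_adherent e0 hS.
exists J; split=> // K dJK KA.
have /(sup_upper_bound hS) : S (\sum_(i <- (J `|` K)%fset) nm (f i)).
  by exists (J `|` K)%fset => // i /=; rewrite inE => /orP[/JA|/KA].
rewrite (big_fsetID _ (mem J)) /=.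
rewrite (_ : [fset x in _ | x \in J]%fset = J); last first.
  by apply/fsetP => i; rewrite !inE /=; case: (i \in J); rewrite ?andbF.
rewrite (_ : [fset x in _ | x \notin J]%fset = K); last first.
  apply/fsetP => i; rewrite !inE /=; case: (boolP (i \in J)) => iJ //=.
    by rewrite ?andbF; apply/esym/negbTE; apply: (fdisjointP dJK).
  by rewrite andbT.
by move=> hle; rewrite -(ltrD2l (\sum_(i <- J) nm (f i))) (le_lt_trans hle)// -ltrBlDr.
Qed.

(** The supremum of the finite partial sums is the sum. *)
Lemma has_sum_ge0 A (g : I -> R) B : (forall i, A i -> 0 <= g i) ->
  (forall K, [set` K] `<=` A -> \sum_(i <- K) g i <= B) ->
  exists s : R, has_sum A (fun i => (g i)%:C) s%:C.
Proof.
move=> g0 h.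
pose S := [set s : R | exists2 K : {fset I}, [set` K] `<=` A & s = \sum_(i <- K) g i].
have hS : has_sup S.
  split; last by exists B => s [K KA ->]; exact: (h K KA).
  by exists (\sum_(i <- fset0) g i), fset0 => // i /=; rewrite inE.
exists (sup S) => e e0; have [_ [J JA ->] ltJ] := sup_adherent e0 hS.
exists J; split=> // K JK KA.
rewrite -(rmorph_sum (real_complex R)) -rmorphB nm_real ler0_norm; last first.
  by rewrite subr_le0 (sup_upper_bound hS)//; exists K.
rewrite opprB ltrBlDr -ltrBlDl (lt_le_trans ltJ)// [leRHS](big_fsetID _ (mem J)) /=.
rewrite (_ : [fset x in _ | x \in J]%fset = J); last first.
  apply/fsetP => i; rewrite !inE /=; case: (boolP (i \in J)) => iJ //=.
    by rewrite (fsubsetP JK).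
  by rewrite andbF.
by rewrite lerDl big_seq; apply: sumr_ge0 => i; rewrite !inE /= => /andP[/KA/g0].
Qed.

(** Real and imaginary parts are differences of nonnegative families, whose sums are
suprema. *)
Lemma abs_bounded_has_sum A f B : abs_bounded A f B -> exists l, has_sum A f l.
Proof.
move=> h.
have aux (g : I -> R) : (forall i, `|g i| <= nm (f i)) ->
    exists l, has_sum A (fun i => (g i)%:C) l.
  move=> gf.
  have [||s1 H1] := @has_sum_ge0 A (fun i => nm (f i)) B.
  - by move=> i _; exact: nm_ge0.
  - exact: h.
  have [||s2 H2] := @has_sum_ge0 A (fun i => nm (f i) - g i) (2 * B).
  - by move=> i _; rewrite subr_ge0 (le_trans (ler_norm _)).
  - move=> K KA; rewrite (@le_trans _ _ (2 * \sum_(i <- K) nm (f i)))//.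
      rewrite big_distrr /=; apply: ler_sum => i _.
      by have := gf i; rewrite ler_norml => /andP[]; lra.
    by rewrite ler_pM2l// h.
  exists (s1%:C - s2%:C); apply: eq_has_sum (has_sumB H1 H2) => i _.
  by rewrite -rmorphB opprB addrC subrK.
have [l1 h1] := aux _ (fun i => normr_Re_nm (f i)).
have [l2 h2] := aux _ (fun i => normr_Im_nm (f i)).
exists (l1 + 'i%C * l2); apply: eq_has_sum (has_sumD h1 (has_sumZ 'i%C h2)).
by move=> i _; rewrite [RHS]complexE.
Qed.

Lemma has_sum_along A f l (J : nat -> {fset I}) :
  (forall n, [set` J n] `<=` A) ->
  (forall i, A i -> exists N, forall n, (N <= n)%N -> i \in J n) ->
  has_sum A f l -> tends (fun n => \sum_(i <- J n) f i) l.
Proof.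
move=> JA hJ hl e e0; have [K [KA H]] := hl _ e0.
suff [N hN] : exists N, forall n, (N <= n)%N -> (K `<=` J n)%fset.
  by exists N => n /hN KJ; apply: H.
have [N hN] : exists N, forall i, i \in (K : seq I) -> forall n, (N <= n)%N -> i \in J n.
  have : forall i, i \in (K : seq I) -> A i by move=> i; exact: KA.
  elim: {KA H} (K : seq I) => [|a s IH] hs; first by exists 0%N.
  have [N1 h1] := hJ a (hs _ (mem_head _ _)).
  have [|N2 h2] := IH; first by move=> i si; apply: hs; rewrite inE si orbT.
  exists (maxn N1 N2) => i; rewrite inE => /orP[/eqP ->|/h2 {}h2] n.
    by rewrite geq_max => /andP[/h1].
  by rewrite geq_max => /andP[_ /h2].
by exists N => n nN; apply/fsubsetP => i /hN; apply.
Qed.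

(** Dominated convergence for sums over a decreasing sequence of index sets:
a finite set carries all but [eps] of the total, and each of its finitely many
points outside the intersection eventually drops out. *)
Lemma has_sum_decreasing A f B (D : nat -> set I) (l : nat -> C) (m : C) :
  abs_bounded A f B -> (forall n, D n `<=` A) ->
  (forall n, D n.+1 `<=` D n) ->
  (forall n, has_sum (D n) f (l n)) ->
  has_sum [set i | forall n, D n i] f m -> tends l m.
Proof.
move=> h DA dD hl hm e e0; have e2 : 0 < e / 2 by rewrite divr_gt0.
pose E := [set i | forall n, D n i].
have dDle n k i : (n <= k)%N -> D k i -> D n i.
  move=> /subnK <-; elim: (k - n)%N => [|j IH]//; rewrite addSn => /dD.
  exact: IH.
have [J [JA HJ]] := abs_bounded_tail h e2.
have [N hN] : exists N, forall i, i \in (J : seq I) ->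
    E i \/ forall n, (N <= n)%N -> ~ D n i.
  elim: {JA HJ} (J : seq I) => [|a s [N1 h1]]; first by exists 0%N.
  have [Ea|/existsNP[N2 h2]] := pselect (E a).
    exists N1 => i; rewrite inE => /orP[/eqP ->|/h1 //]; by left.
  exists (maxn N1 N2) => i; rewrite inE => /orP[/eqP ->|/h1 [|{}h1]]; [|by left|].
    by right=> n; rewrite geq_max => /andP[_ nN] /(dDle _ _ _ nN).
  by right=> n; rewrite geq_max => /andP[/h1].
exists N => n nN.
have ED : E `<=` D n by move=> i; apply.
have hDE : abs_bounded (D n `\` E) f B.
  by apply: abs_bounded_sub h => i [/DA].
have [r hr] := abs_bounded_has_sum hDE.
have -> : l n = m + r.
  apply: (has_sum_uniq (hl n)).
  rewrite (_ : D n = E `|` (D n `\` E)).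
    by apply: has_sumU hm hr; rewrite setDE setICA setICr setI0.
  by rewrite setUDr setUC setDv setD0; apply/esym/setUidPl.
rewrite addrC addKr; apply: le_lt_trans (_ : e / 2 < e); last by rewrite [ltRHS]splitr ltrDl.
apply: (has_sum_le _ hr) => K KD; apply/ltW/HJ; last by move=> i /KD [/DA].
apply/fdisjointP => i iJ; apply/negP => iK.
have [Di nEi] := KD _ iK.
by case: (hN _ iJ) => // /(_ _ nN).
Qed.

Definition hsum A f : C := xget 0 [set l | has_sum A f l].

Lemma hsumE A f l : has_sum A f l -> hsum A f = l.
Proof.
move=> h; rewrite /hsum; case: xgetP => [l' _ /= h'|/(_ l)//].
exact: has_sum_uniq h' h.
Qed.

Lemma hsumP A f B : abs_bounded A f B -> has_sum A f (hsum A f).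
Proof. by move=> /abs_bounded_has_sum[l h]; rewrite (hsumE h). Qed.

End Sums.

(** * A summable weight on pairs of integers *)

Section SeqSums.
Variable R : realType.

Lemma big_fset_seq (V : nmodType) (I : choiceType) (s : seq I) (F : I -> V) :
  uniq s -> \sum_(i <- [fset x in s]%fset) F i = \sum_(i <- s) F i.
Proof.
move=> us; apply: perm_big; apply: uniq_perm => //.
by move=> x; rewrite !inE.
Qed.

Lemma ler_sum_subset (I : eqType) (s t : seq I) (F : I -> R) :
  uniq s -> {subset s <= t} -> (forall i, 0 <= F i) ->
  \sum_(i <- s) F i <= \sum_(i <- t) F i.
Proof.
move=> + + F0; elim: s t => [|x s IH] t; first by rewrite big_nil sumr_ge0.
move=> /= /andP[xs us] st; have xt := st _ (mem_head _ _).
rewrite (perm_big _ (perm_to_rem xt)) !big_cons lerD2l; apply: IH => // y ys.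
have : y \in t by apply: st; rewrite inE ys orbT.
rewrite (perm_mem (perm_to_rem xt)) inE => /orP[/eqP yx|//].
by move: xs; rewrite -yx ys.
Qed.

(** [(1 + |k|)^(-3/2)]: summable, and yet the product of two of them dominates
the inverse cubes on a plane lattice. *)
Definition weight (k : int) : R := (Num.sqrt (1 + `|k|%:~R)) ^- 3.

Lemma weight_ge0 k : 0 <= weight k.
Proof. by rewrite invr_ge0 exprn_ge0 ?sqrtr_ge0. Qed.

(** The bound telescopes: [(n + 1) ^ (-3/2) <= 2 / sqrt n - 2 / sqrt (n + 1)]. *)
Lemma sum_weight_nat N :
  \sum_(0 <= k < N.+1) weight k%:Z <= 3 - 2 / Num.sqrt (N.+1%:R).
Proof.
have E n : weight n%:Z = (Num.sqrt (n.+1%:R)) ^- 3.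
  by rewrite /weight ger0_norm// -natr1 addrC.
elim: N => [|N IH]; first by rewrite big_nat1 E !sqrtr1; lra.
rewrite big_nat_recr//= E; apply: le_trans (lerD IH (lexx _)) _.
set x := Num.sqrt N.+1%:R; set y := Num.sqrt N.+2%:R.
have x0 : 0 < x by rewrite sqrtr_gt0 ltr0Sn.
have y0 : 0 < y by rewrite sqrtr_gt0 ltr0Sn.
have hy : y ^+ 2 = x ^+ 2 + 1 by rewrite !sqr_sqrtr ?ler0n// natr1.
have xy : x <= y by rewrite ler_sqrt ?ler0n// ler_nat.
have hd : y - x = (x + y)^-1.
  have xy0 : x + y != 0 by rewrite gt_eqF// addr_gt0.
  apply: (mulIf xy0); rewrite mulVf//.
  have -> : (y - x) * (x + y) = y ^+ 2 - x ^+ 2 by ring.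
  by rewrite hy; ring.
suff : y ^- 3 <= 2 / x - 2 / y by lra.
have -> : 2 / x - 2 / y = 2 / (x * y * (x + y)).
  have -> : 2 / (x * y * (x + y)) = 2 / (x * y) * (y - x).
    by rewrite hd; field; rewrite !gt_eqF ?addr_gt0.
  by field; rewrite !gt_eqF.
rewrite ler_pdivlMr; last by rewrite !mulr_gt0// addr_gt0.
rewrite mulrC ler_pdivrMr ?exprn_gt0//.
have : x * y * (x + y) <= y * y * (y + y).
  by rewrite ler_pM ?mulr_ge0 ?addr_ge0 ?ler_wpM2r ?lerD2r// ltW.
by rewrite !exprS expr0; lra.
Qed.

Definition int_range (N : nat) : seq int :=
  [seq k%:Z | k <- iota 0 N.+1] ++ [seq Negz k | k <- iota 0 N.+1].

Lemma mem_int_range N (k : int) : (`|k| <= N)%N -> k \in int_range N.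
Proof.
case: k => k kN; rewrite mem_cat; apply/orP; [left|right];
  apply/mapP; exists k => //; rewrite mem_iota add0n; lia.
Qed.

Lemma sum_weight_range N : \sum_(k <- int_range N) weight k <= 6.
Proof.
have H : \sum_(k <- iota 0 N.+1) weight k%:Z <= 3.
  have := sum_weight_nat N; rewrite /index_iota subn0 => h; apply: le_trans h _.
  by rewrite lerBlDr lerDl divr_ge0// sqrtr_ge0.
rewrite /int_range big_cat !big_map (_ : 6 = 3 + 3 :> R); last by ring.
apply: lerD => //; apply: le_trans H; apply: ler_sum => k _.
rewrite /weight lef_pV2 ?posrE ?exprn_gt0 ?sqrtr_gt0 ?ltr_pwDl ?ler0z//.
rewrite ler_pXn2r ?nnegrE ?sqrtr_ge0// ler_wsqrtr// lerD2l ler_int; lia.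
Qed.

(** Distinct pairs of integers lie in a square, over which the double sum factors. *)
Lemma sum_weight2 (I : choiceType) (K : seq I) (c : I -> int * int) :
  uniq K -> {in K &, injective c} ->
  \sum_(i <- K) weight (c i).1 * weight (c i).2 <= 36.
Proof.
move=> uK injc; pose s := map c K.
have us : uniq s by rewrite map_inj_in_uniq.
have [N hN] : exists N, forall i, i \in K -> (`|(c i).1| <= N)%N /\ (`|(c i).2| <= N)%N.
  elim: (K) => [|a l [N IH]]; first by exists 0%N.
  exists (maxn N (maxn `|(c a).1|%N `|(c a).2|%N)) => i.
  by rewrite inE => /orP[/eqP ->|/IH[]]; rewrite !leq_max => *; split; lia.
pose F (p : int * int) := weight p.1 * weight p.2.
have -> : \sum_(i <- K) weight (c i).1 * weight (c i).2 = \sum_(p <- s) F p.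
  by rewrite big_map.
apply: (@le_trans _ _ (\sum_(p <- [seq (x, y) | x <- int_range N, y <- int_range N]) F p)).
  apply: ler_sum_subset => //; last first.
    by move=> p; rewrite mulr_ge0 ?weight_ge0.
  move=> p /mapP[i /hN[h1 h2] ->]; rewrite [c i]surjective_pairing.
  by apply/allpairsP; exists (c i); rewrite !mem_int_range.
rewrite big_allpairs /F /=; under eq_bigr do rewrite -big_distrr /=.
rewrite -big_distrl /= (_ : 36 = 6 * 6 :> R); last by ring.
by rewrite ler_pM ?sum_weight_range ?sumr_ge0// => k _; exact: weight_ge0.
Qed.

End SeqSums.

(** * Plane lattices *)

Section Lattices.
Variable R : realType.
Local Notation C := R[i].
Implicit Types (A : set C) (a b u v w z : C).

Definition lat a b : set C := [set u | exists m n : int, u = a *~ m + b *~ n].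

(** The signed area spanned by [a] and [b]: nonzero exactly when they form a basis of
the plane over the reals. *)
Definition cross a b : R :=
  complex.Re a * complex.Im b - complex.Im a * complex.Re b.

Lemma crossD a u v : cross a (u + v) = cross a u + cross a v.
Proof. by case: a u v => [a1 a2] [u1 u2] [v1 v2]; rewrite /cross /=; ring. Qed.

Lemma crossC a b : cross a b = - cross b a.
Proof. by rewrite /cross; ring. Qed.

Lemma crossaa a : cross a a = 0.
Proof. by rewrite /cross; ring. Qed.

Lemma crossN a b : cross a (- b) = - cross a b.
Proof. by case: a b => [a1 a2] [b1 b2]; rewrite /cross /=; ring. Qed.

Lemma crossMz a b (n : int) : cross a (b *~ n) = n%:~R * cross a b.
Proof.
have N (k : nat) : cross a (b *+ k) = k%:R * cross a b.
  elim: k => [|k IH]; first by rewrite !mulr0n /cross /=; ring.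
  by rewrite mulrS crossD IH -natr1; ring.
by case: n => k; rewrite ?NegzE ?mulrNz ?crossN ?rmorphN -?pmulrn ?N ?mulNr ?pmulrn.
Qed.

Lemma cross_le a b : `|cross a b| <= nm a * nm b.
Proof.
rewrite -(@ler_pXn2r _ 2)// ?nnegrE ?mulr_ge0 ?nm_ge0//.
rewrite real_normK ?num_real// exprMn !sqr_nm /cross -subr_ge0.
set p := complex.Re a; set q := complex.Im a; set r := complex.Re b; set s := complex.Im b.
rewrite [leRHS](_ : _ = (p * r + q * s) ^+ 2) ?sqr_ge0//; ring.
Qed.

Definition lat_low a b : R := `|cross a b| / (nm a + nm b).

Lemma lat_low_gt0 a b : cross a b != 0 -> 0 < lat_low a b.
Proof.
move=> h; rewrite divr_gt0 ?normr_gt0// ltr_wpDr ?nm_ge0// nm_gt0.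
by apply: contra_neq h => ->; rewrite /cross /=; ring.
Qed.

(** The coordinates of [u] in the basis [a], [b] are [cross u b / cross a b] and
[cross a u / cross a b], and [cross] is bounded by the product of the moduli. *)
Lemma lat_lowP a b (m n : int) : cross a b != 0 ->
  lat_low a b * (`|m|%:~R + `|n|%:~R) <= nm (a *~ m + b *~ n).
Proof.
move=> h; set u := a *~ m + b *~ n.
have hn : cross a u = n%:~R * cross a b.
  by rewrite crossD !crossMz crossaa; ring.
have hm : cross b u = - m%:~R * cross a b.
  by rewrite crossD !crossMz crossaa (crossC b a); ring.
have s0 : 0 < nm a + nm b.
  rewrite ltr_wpDr ?nm_ge0// nm_gt0.
  by apply: contra_neq h => ->; rewrite /cross /=; ring.
have := cross_le a u; have := cross_le b u; rewrite hn hm !normrM normrN => h1 h2.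
rewrite /lat_low mulrAC ler_pdivrMr// mulrC !intr_norm mulrDl [leRHS]mulrDr addrC.
by rewrite lerD// [leRHS]mulrC.
Qed.

Lemma lat_coord a b (m n m' n' : int) : cross a b != 0 ->
  a *~ m + b *~ n = a *~ m' + b *~ n' -> m = m' /\ n = n'.
Proof.
move=> h e.
have := lat_lowP (m - m') (n - n') h.
have -> : a *~ (m - m') + b *~ (n - n') = 0.
  by rewrite !mulrzBr addrACA -opprD e subrr.
rewrite nm0 pmulr_rle0 ?lat_low_gt0// -intrD lerz0; lia.
Qed.

Lemma lat0 a b : lat a b 0.
Proof. by exists 0, 0; rewrite !mulr0z addr0. Qed.

Lemma latB a b u v : lat a b u -> lat a b v -> lat a b (u - v).
Proof.
move=> [m [n ->]] [m' [n' ->]]; exists (m - m'), (n - n').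
by rewrite !mulrzBr; ring.
Qed.

Lemma latN a b u : lat a b u -> lat a b (- u).
Proof. by move=> h; rewrite -sub0r; apply: latB (lat0 _ _) h. Qed.

Lemma latD a b u v : lat a b u -> lat a b v -> lat a b (u + v).
Proof. by move=> hu hv; rewrite -[v]opprK; apply: latB hu (latN hv). Qed.

Lemma latDr a b u v : lat a b v -> lat a b (u + v) <-> lat a b u.
Proof.
move=> hv; split => [h|h]; last exact: latD.
by rewrite -(addrK v u); apply: latB.
Qed.

Lemma latl a b : lat a b a.
Proof. by exists 1, 0; rewrite mulr1z mulr0z addr0. Qed.

Lemma latr a b : lat a b b.
Proof. by exists 0, 1; rewrite mulr1z mulr0z add0r. Qed.

Lemma sub_lat a b c d : lat c d a -> lat c d b -> lat a b `<=` lat c d.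
Proof.
have Z u (n : int) : lat c d u -> lat c d (u *~ n).
  move=> [p [q ->]]; exists (p * n), (q * n).
  by rewrite !mulrzA mulrzDl_tmp.
by move=> ha hb _ [m [n ->]]; apply: latD; apply: Z.
Qed.

Lemma latC a b : lat a b = lat b a.
Proof. by apply/seteqP; split; apply: sub_lat; (exact: latl || exact: latr). Qed.

Lemma lat_addl a b : lat (a + b) b = lat a b.
Proof.
apply/seteqP; split; apply: sub_lat; try exact: latr.
  by apply: latD; [exact: latl|exact: latr].
by rewrite -[X in lat _ _ X](addrK b); apply: latB; [exact: latl|exact: latr].
Qed.

(** Separation of the points, and summability of the inverse cubes: what the
convergence of the Weierstrass sum requires. *)
Definition sparse A :=
  (exists2 r : R, 0 < r & forall u v, A u -> A v -> u != v -> r <= nm (u - v)) /\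
  exists B : R, abs_bounded (A `\ 0) (fun u => u ^- 3) B.

Lemma sparse_sub A A' : A' `<=` A -> sparse A -> sparse A'.
Proof.
move=> AA [[r r0 h] [B hB]]; split; last first.
  by exists B; apply: abs_bounded_sub hB => u [/AA].
by exists r => // u v /AA hu /AA hv; apply: h.
Qed.

(** By [lat_lowP] the inverse cube of [a m + b n] is bounded by a multiple of
[(|m| + |n|) ^ (-3)], and [(1 + |m|) (1 + |n|) <= 4 (|m| + |n|) ^ 2] off the origin. *)
Lemma sparse_lat a b : cross a b != 0 -> sparse (lat a b).
Proof.
move=> h; have k0 := lat_low_gt0 h; set k := lat_low a b in k0; split.
  exists k => // u v hu hv uv; have [m [n E]] := latB hu hv; rewrite E.
  have mn0 : ~ (m = 0 /\ n = 0).
    move=> [m0 n0]; move: E; rewrite m0 n0 !mulr0z addr0 => /eqP.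
    by rewrite subr_eq0 (negbTE uv).
  apply: le_trans (lat_lowP _ _ h); rewrite ler_peMr ?(ltW k0)//.
  have : (1 : int) <= `|m| + `|n| by lia.
  by rewrite -(ler_int R) intrD.
(* The quotients are the integer coordinates of [u]; the floors only serve to
type them as integers. *)
pose c u : int * int := (Num.floor (cross u b / cross a b), Num.floor (cross a u / cross a b)).
have cE u : lat a b u -> u = a *~ (c u).1 + b *~ (c u).2.
  move=> [m [n ->]]; rewrite /c /=.
  have -> : cross (a *~ m + b *~ n) b / cross a b = m%:~R.
    rewrite crossC crossD !crossMz crossaa (crossC b a) mulr0 addr0 mulrN opprK.
    by rewrite mulfK.
  have -> : cross a (a *~ m + b *~ n) / cross a b = n%:~R.
    by rewrite crossD !crossMz crossaa mulr0 add0r mulfK.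
  by rewrite !intrKfloor.
have dk0 : 0 < 2 / k by rewrite divr_gt0.
exists ((2 / k) ^+ 3 * 36) => K KA.
apply: (@le_trans _ _ (\sum_(u <- K) (2 / k) ^+ 3 * (weight R (c u).1 * weight R (c u).2))).
  rewrite big_seq [leRHS]big_seq; apply: ler_sum => u /KA [hu /eqP u0].
  have E := cE u hu; have := lat_lowP (c u).1 (c u).2 h; rewrite -E -/k.
  move: E u0; set m := (c u).1; set n := (c u).2 => E u0 hk.
  rewrite nmV nmX /weight; set p := Num.sqrt _; set q := Num.sqrt _.
  set S := _ + _ in hk.
  have p0 : 0 < p by rewrite sqrtr_gt0 ltr_pwDl// ler0z.
  have q0 : 0 < q by rewrite sqrtr_gt0 ltr_pwDl// ler0z.
  have S1 : 1 <= S.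
    have mn : ~ (m = 0 /\ n = 0).
      by move=> [m0 n0]; move: u0; rewrite E m0 n0 !mulr0z addr0 eqxx.
    have : (1 : int) <= `|m| + `|n| by lia.
    by rewrite -(ler_int R) intrD.
  have pq : p * q <= 2 * S.
    rewrite -(@ler_pXn2r _ 2)// ?nnegrE ?mulr_ge0 ?(ltW p0) ?(ltW q0) ?(le_trans ler01 S1)//.
    rewrite !exprMn !sqr_sqrtr ?addr_ge0 ?ler0z// /S.
    have := S1; rewrite /S; set x := `|m|%:~R; set y := `|n|%:~R.
    have x0 : 0 <= x by rewrite ler0z.
    have y0 : 0 <= y by rewrite ler0z.
    by move=> *; nra.
  have u1 : 0 < nm u by rewrite nm_gt0.
  have hu2 : p * q <= 2 / k * nm u.
    apply: le_trans pq _; rewrite mulrAC ler_pdivlMr// -mulrA ler_pM2l//.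
    by rewrite mulrC.
  rewrite -invfM -exprMn -!exprVn -exprMn.
  have pq0 : 0 < p * q by rewrite mulr_gt0.
  rewrite ler_pXn2r ?nnegrE ?invr_ge0 ?nm_ge0 ?(ltW (divr_gt0 dk0 pq0))//.
  rewrite -[leLHS]mul1r ler_pdivrMr// mulrAC ler_pdivlMr// mul1r.
  exact: hu2.
rewrite -mulr_sumr ler_pM2l ?exprn_gt0//.
apply: sum_weight2; first exact: fset_uniq.
move=> u v /KA[hu _] /KA[hv _] e.
by rewrite (cE u hu) (cE v hv) e.
Qed.

End Lattices.

(** * The Weierstrass sum of a sparse set *)

Section WeierstrassSums.
Variable R : realType.
Local Notation C := R[i].
Implicit Types (A : set C) (a b u v w z : C).

(** The term of the Weierstrass sum at the lattice point [u]. *)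
Definition wpt z u : C := 1 / (z - u) ^+ 2 - 1 / u ^+ 2.

(** The Weierstrass function of an arbitrary set of periods; besides lattices it is
used for their sublattices and for the cyclic group at the end of a chain. *)
Definition wps A z : C := 1 / z ^+ 2 + hsum (A `\ 0) (wpt z).

(** At most one point of the set is within half the separation of [z], so the distances
from [z] to the set have a positive minimum; the proportional bound follows. *)
Lemma sparse_far A z : sparse A -> ~ A z ->
  exists c d : R, [/\ 0 < c, 0 < d &
    forall u, A u -> c * nm u <= nm (u - z) /\ d <= nm (u - z)].
Proof.
move=> [[r r0 hr] _] Az.
have [d d0 hd] : exists2 d : R, 0 < d & forall u, A u -> d <= nm (u - z).
  have [[u0 [Au0 hu0]]|none] := pselect (exists u0, A u0 /\ nm (u0 - z) < r / 2).
    have u0z : 0 < nm (u0 - z).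
      by rewrite nm_gt0 subr_eq0; apply/eqP => e; apply: Az; rewrite -e.
    exists (nm (u0 - z)) => // u Au; have [->//|uu0] := eqVneq u u0.
    have := hr _ _ Au Au0 uu0; have := nm_tri z u u0; rewrite (nmC z u0); lra.
  exists (r / 2); first by rewrite divr_gt0.
  by move=> u Au; rewrite leNgt; apply/negP => h; apply: none; exists u.
have dz : 0 < d + nm z by rewrite ltr_pwDl// nm_ge0.
exists (d / (d + nm z)), d; split => //; first by rewrite divr_gt0.
move=> u Au; split; last exact: hd.
rewrite mulrAC ler_pdivrMr// mulrDr.
have h1 := hd u Au; have h2 := nm_ge0 z; have := nmD (u - z) z; rewrite subrK => h3.
have : d * nm u <= d * (nm (u - z) + nm z) by rewrite ler_pM2l.
have : d * nm z <= nm (u - z) * nm z by rewrite ler_wpM2r.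
lra.
Qed.

Lemma setD1_in A u : (A `\ 0) u -> A u /\ u != 0.
Proof. by move=> [? /eqP]. Qed.

Lemma sparseD1 A : sparse A -> sparse (A `\ 0).
Proof. by apply: sparse_sub => u []. Qed.

Lemma invXn_bounded A z (k : nat) : sparse A -> ~ (A `\ 0) z ->
  exists B : R, abs_bounded (A `\ 0) (fun u => (u - z) ^- k.+3) B.
Proof.
move=> hA Az; have [c [d [c0 d0 hcd]]] := sparse_far (sparseD1 hA) Az.
have [_ [B hB]] := hA.
exists ((d ^- k * c ^- 3) * B); apply: abs_bounded_le hB.
  by rewrite mulr_ge0 ?invr_ge0 ?exprn_ge0 ?ltW.
move=> u hu; have [h1 h2] := hcd u hu; have [_ u0] := setD1_in hu.
have w0 : 0 < nm (u - z) by apply: lt_le_trans d0 h2.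
have u1 : 0 < nm u by rewrite nm_gt0.
rewrite !nmV !nmX -mulrA -invfM -exprMn -invfM lef_pV2 ?posrE; last first.
- by rewrite mulr_gt0 ?exprn_gt0 ?mulr_gt0.
- by rewrite exprn_gt0.
rewrite -[k.+3]addn3 exprD; apply: ler_pM.
- by rewrite exprn_ge0 ?(ltW d0).
- by rewrite exprn_ge0// mulr_ge0 ?nm_ge0 ?(ltW c0).
- by apply: lerXn2r; rewrite ?nnegrE ?(ltW d0) ?nm_ge0.
- by apply: lerXn2r; rewrite ?nnegrE ?mulr_ge0 ?nm_ge0 ?(ltW c0).
Qed.

(** [1 / (z - u) ^ 2 - 1 / u ^ 2 = z (2 u - z) / ((z - u) ^ 2 u ^ 2)] is of the order of
the inverse cube of [u]. *)
Lemma wpt_bounded A z : sparse A -> A 0 -> ~ (A `\ 0) z ->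
  exists B, abs_bounded (A `\ 0) (wpt z) B.
Proof.
move=> hA A0 Az; have [c [d [c0 d0 hcd]]] := sparse_far (sparseD1 hA) Az.
have [[r r0 hr] [B hB]] := hA.
exists ((nm z * (2 + nm z / r) / c ^+ 2) * B); apply: abs_bounded_le hB.
  rewrite divr_ge0 ?exprn_ge0 ?(ltW c0)// mulr_ge0 ?nm_ge0// addr_ge0//.
  by rewrite divr_ge0 ?nm_ge0 ?(ltW r0).
move=> u hu; have [h1 h2] := hcd u hu; have [Au u0] := setD1_in hu.
have ru : r <= nm u by rewrite -[u]subr0; apply: hr.
have w0 : 0 < nm (u - z) by apply: lt_le_trans d0 h2.
have wz : z - u != 0 by rewrite -nm_gt0 nmC.
have u1 : 0 < nm u by rewrite nm_gt0.
have -> : wpt z u = z * (2 * u - z) * ((z - u) ^- 2 * u ^- 2).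
  by rewrite /wpt; field; rewrite wz u0.
rewrite !nmM !nmV !nmX (nmC z u).
rewrite -!mulrA ler_wpM2l ?nm_ge0//.
have -> : (2 + nm z / r) * (c ^- 2 * nm u ^- 3) =
   ((2 + nm z / r) * nm u) * ((c * nm u) ^- 2 * nm u ^- 2).
  by field; rewrite !gt_eqF.
apply: ler_pM; rewrite ?nm_ge0 ?mulr_ge0 ?invr_ge0 ?exprn_ge0 ?nm_ge0//.
  apply: le_trans (nmB _ _) _; rewrite nmM nm_nat [leRHS]mulrDl lerD2l mulrAC.
  by rewrite ler_pdivlMr// ler_wpM2l ?nm_ge0.
rewrite ler_wpM2r ?invr_ge0 ?exprn_ge0 ?nm_ge0//.
rewrite lef_pV2 ?posrE ?exprn_gt0 ?mulr_gt0//.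
by apply: lerXn2r; rewrite ?nnegrE ?mulr_ge0 ?nm_ge0 ?(ltW c0).
Qed.

Lemma wpt_sum A z : sparse A -> A 0 -> ~ (A `\ 0) z ->
  has_sum (A `\ 0) (wpt z) (hsum (A `\ 0) (wpt z)).
Proof. by move=> h h0 hz; have [B /hsumP] := wpt_bounded h h0 hz. Qed.

Lemma wps_even A z : sparse A -> A 0 -> (forall u, A u -> A (- u)) -> ~ A z ->
  wps A (- z) = wps A z.
Proof.
move=> hA A0 AN Az; have hz : ~ (A `\ 0) z by move=> [].
rewrite /wps sqrrN; congr (_ + _); apply: hsumE.
have E : A `\ 0 = [set j | (A `\ 0) (- j)].
  have NA u : A (- u) -> A u by move=> /AN; rewrite opprK.
  apply/seteqP; split=> [u [h1 h2]|u [/NA h1 h2]]; split=> //.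
  - exact: AN.
  - by move=> /= /eqP; rewrite oppr_eq0 => /eqP.
  - by move=> /= u0; apply: h2; rewrite /= u0 oppr0.
rewrite {1}E; apply: (has_sum_bij (h := -%R) (h' := -%R)); try exact: opprK.
apply: eq_has_sum (wpt_sum hA A0 hz) => u _.
by rewrite /wpt -opprD !sqrrN.
Qed.

Lemma wps_scale A c z : sparse A -> A 0 -> c != 0 -> ~ A z ->
  wps [set u | A (c^-1 * u)] (c * z) = c ^- 2 * wps A z.
Proof.
move=> hA A0 c0 Az; have hz : ~ (A `\ 0) z by move=> [].
rewrite /wps mulrDr; congr (_ + _).
  by rewrite exprMn !div1r invfM.
apply: hsumE.
have -> : [set u | A (c^-1 * u)] `\ 0 = [set j | (A `\ 0) (c^-1 * j)].
  apply/seteqP; split=> [u [h1 h2]|u [h1 h2]]; split=> //.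
    by move=> /= /eqP; rewrite mulf_eq0 invr_eq0 (negbTE c0) => /eqP.
  by move=> /= u0; apply: h2; rewrite /= u0 mulr0.
apply: (has_sum_bij (h := *%R c) (h' := *%R c^-1)).
- by move=> x; rewrite mulKf.
- by move=> x; rewrite mulVKf.
apply: eq_has_sum (has_sumZ (c ^- 2) (wpt_sum hA A0 hz)) => u [Au /eqP u0].
have zu : z - u != 0 by apply/eqP => /subr0_eq e; apply: Az; rewrite e.
have E : c * z - c * u = c * (z - u) by rewrite mulrBr.
by rewrite /wpt E; field; rewrite u0 c0 zu.
Qed.

(** The sum over [A] is the sum over [A'] plus that over the coset [a + A'].  The latter
is a sum over [A'] at [z - a], except that its terms are normalized differently;
the difference adds up to [wps A' a]. *)
Lemma wps_split A A' a z : sparse A -> A' 0 ->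
  (forall u v, A' u -> A' v -> A' (u - v)) ->
  A = A' `|` [set u | A' (u - a)] -> ~ A' a -> ~ A z ->
  wps A z = wps A' z + wps A' (z - a) - wps A' a.
Proof.
move=> hA A'0 A'B AE A'a Az.
have A'N u : A' u -> A' (- u) by move=> h; rewrite -sub0r; apply: A'B.
have A'A : A' `<=` A by rewrite AE; left.
have hA' := sparse_sub A'A hA.
have A0 : A 0 by apply: A'A.
have a0 : a != 0 by apply/eqP => e; apply: A'a; rewrite e.
have z0 : z != 0 by apply/eqP => e; apply: Az; rewrite e.
have z1 : ~ A' z by move=> /A'A.
have z2 : ~ A' (z - a) by move=> h; apply: Az; rewrite AE; right.
have za : z - a != 0 by apply/eqP => e; apply: z2; rewrite e.
have Na : ~ A' (- a) by move=> /A'N; rewrite opprK.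
rewrite -(wps_even hA' A'0 A'N A'a).
have D u : ~ A' u -> ~ (A' `\ 0) u by move=> h [].
have s1 := wpt_sum hA' A'0 (D _ z1).
have s2 := has_sumB (wpt_sum hA' A'0 (D _ z2)) (wpt_sum hA' A'0 (D _ Na)).
have s3 : has_sum A' (fun u => wpt z (a + u)) (wpt z a +
    (hsum (A' `\ 0) (wpt (z - a)) - hsum (A' `\ 0) (wpt (- a)))).
  have E : A' = [set 0] `|` (A' `\ 0).
    by rewrite setUDr setUC setDv setD0; apply/esym/setUidPl => ? ->.
  rewrite {1}E; apply: has_sumU; first by rewrite setDE setICA setICr setI0.
    by rewrite -{2}[a]addr0; exact: has_sum1.
  apply: eq_has_sum s2 => u [A'u /eqP u0]; rewrite /wpt.
  have -> : - a - u = - (a + u) by rewrite opprD.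
  have -> : z - (a + u) = z - a - u by rewrite opprD addrA.
  by rewrite sqrrN; ring.
have s5 : has_sum [set u | A' (u - a)] (wpt z) (wpt z a +
    (hsum (A' `\ 0) (wpt (z - a)) - hsum (A' `\ 0) (wpt (- a)))).
  apply: (has_sum_bij (h := fun u => a + u) (h' := fun u => u - a)) s3.
  - by move=> u; rewrite addrC addKr.
  - by move=> u; rewrite addrC subrK.
rewrite /wps; have -> : hsum (A `\ 0) (wpt z) = hsum (A' `\ 0) (wpt z) + (wpt z a +
    (hsum (A' `\ 0) (wpt (z - a)) - hsum (A' `\ 0) (wpt (- a)))).
  apply: hsumE.
  have -> : A `\ 0 = (A' `\ 0) `|` [set u | A' (u - a)].
    rewrite AE; apply/seteqP; split=> u.
      by move=> [[h|h] u0]; [left|right].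
    move=> [[h u0]|h]; first by split=> //; left.
    by split; [right|move=> /= u0; move: h; rewrite /= u0 sub0r].
  apply: has_sumU s1 s5; apply/seteqP; split=> // u [[h1 _] h2].
  by apply: A'a; rewrite -[a](subKr u); apply: A'B.
have Ea : wpt z a = 1 / (z - a) ^+ 2 - 1 / a ^+ 2 by [].
by rewrite Ea sqrrN; ring.
Qed.

End WeierstrassSums.

(** * Periodicity, and halving a lattice *)

Section LatticeFunctions.
Variable R : realType.
Local Notation C := R[i].
Implicit Types (a b u v w z : C).

Definition box a b (N : nat) : seq C :=
  [seq a *~ (i%:Z - N%:Z) + b *~ (j%:Z - N%:Z) | j <- iota 0 (2 * N).+1, i <- iota 0 (2 * N).+1].

Lemma box_uniq a b N : cross a b != 0 -> uniq (box a b N).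
Proof.
move=> h; apply: allpairs_uniq; try exact: iota_uniq.
by move=> [j i] [j' i'] _ _ /= /(lat_coord h)[e1 e2]; congr (_, _); lia.
Qed.

Lemma box_lat a b N u : u \in box a b N -> lat a b u.
Proof. by move=> /allpairsP[[j i] [_ _ ->]] /=; eexists; eexists. Qed.

Lemma mem_box a b u : lat a b u ->
  exists N, forall n, (N <= n)%N -> u \in box a b n.
Proof.
move=> [m [n ->]]; exists (maxn `|m|%N `|n|%N) => N; rewrite geq_max => /andP[h1 h2].
apply/allpairsP; exists (absz (n + N%:Z), absz (m + N%:Z)); rewrite !mem_iota /=.
by split; try lia; congr (_ *~ _ + _ *~ _); lia.
Qed.

(** The box sums of [1 / (z + a - u) ^ 2 - 1 / (z - u) ^ 2] telescope along
[a] and leave two sides, which have few points, all of them far away. *)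
Lemma tends_box_telescope a b z : cross a b != 0 ->
  tends (fun N => \sum_(u <- box a b N) (1 / (z + a - u) ^+ 2 - 1 / (z - u) ^+ 2)) 0.
Proof.
move=> h.
have [k k0 kP] : exists2 k : R, 0 < k & forall m n : int,
    k * (`|m|%:~R + `|n|%:~R) <= nm (a *~ m + b *~ n).
  by exists (lat_low a b); [exact: lat_low_gt0|move=> m n; exact: lat_lowP].
move=> e e0.
pose p := nm z / k; pose q := 24 / (k ^+ 2 * e); pose M := 2 * p + q + 1.
exists (Num.trunc M).+1 => N hN; rewrite subr0.
have MN : M < N%:R by apply: lt_le_trans (truncnS_gt M) _; rewrite ler_nat.
have p0 : 0 <= p by rewrite divr_ge0 ?nm_ge0 ?(ltW k0).
have q0 : 0 < q by rewrite divr_gt0// mulr_gt0// exprn_gt0.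
have N1 : 1 < N%:R :> R by move: MN; rewrite /M; lra.
have N0 : 0 < N%:R :> R by lra.
have Nz : 2 * nm z <= k * N%:R.
  have : p <= N%:R / 2 by move: MN; rewrite /M; lra.
  by rewrite ler_pdivrMr//; lra.
have Ne : 24 / (k ^+ 2 * N%:R) < e.
  have : q < N%:R by move: MN; rewrite /M; lra.
  by rewrite /q !ltr_pdivrMr ?mulr_gt0 ?exprn_gt0//; lra.
pose g (j i : nat) := 1 / (z - a *~ (i%:Z - 1 - N%:Z) - b *~ (j%:Z - N%:Z)) ^+ 2.
have -> : \sum_(u <- box a b N) (1 / (z + a - u) ^+ 2 - 1 / (z - u) ^+ 2) =
    \sum_(j <- iota 0 (2 * N).+1) (g j 0%N - g j (2 * N).+1).
  rewrite /box big_allpairs_dep; apply: eq_bigr => j _.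
  rewrite -[LHS]opprK -[RHS]opprK; congr (- _).
  rewrite -sumrN opprB -(GRing.telescope_sumr (g j)) // /index_iota subn0.
  apply: eq_bigr => i _; rewrite opprB /g; congr (1 / _ ^+ 2 - 1 / _ ^+ 2).
    by rewrite (_ : i.+1%:Z - 1 - N%:Z = i%:Z - N%:Z) ?opprD ?addrA//; clear; lia.
  rewrite (_ : i%:Z - 1 - N%:Z = (i%:Z - N%:Z) - 1); last by clear; lia.
  by rewrite (mulrzBr a _ 1) mulr1z; ring.
have gB (j i : nat) : (N <= absz (i%:Z - 1 - N%:Z)%R)%N -> nm (g j i) <= 4 / (k * N%:R) ^+ 2.
  move=> hi; have kN : 0 < k * N%:R by rewrite mulr_gt0//; lra.
  have : k * N%:R / 2 <= nm (z - a *~ (i%:Z - 1 - N%:Z) - b *~ (j%:Z - N%:Z)).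
    have := kP (i%:Z - 1 - N%:Z) (j%:Z - N%:Z); set u := (X in nm X) => hu.
    have -> : z - a *~ (i%:Z - 1 - N%:Z) - b *~ (j%:Z - N%:Z) = z - u.
      by rewrite /u opprD addrA.
    have : k * N%:R <= nm u.
      apply: le_trans hu; rewrite ler_pM2l// -[N%:R]addr0 lerD ?ler0z//.
      by clear -hi; rewrite -[N%:R]/(N%:Z%:~R) ler_int; lia.
    have := nm_sub u z; rewrite nmC; lra.
  set w := nm _ => hw; have w0 : 0 < w by lra.
  rewrite /g div1r nmV nmX -/w (_ : 4 / _ = (k * N%:R / 2) ^- 2).
    rewrite lef_pV2 ?posrE ?exprn_gt0 ?divr_gt0//.
    by apply: lerXn2r; rewrite ?nnegrE ?divr_ge0 ?(ltW w0) ?(ltW kN).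
  by field; rewrite !gt_eqF//; lra.
apply: le_lt_trans (nm_sum _ _ _) _.
apply: (@le_lt_trans _ _ (\sum_(j <- iota 0 (2 * N).+1) (8 / (k * N%:R) ^+ 2))).
  apply: ler_sum => j _; apply: le_trans (nmB _ _) _.
  rewrite (_ : 8 = 4 + 4); last by ring.
  by rewrite mulrDl; apply: lerD; apply: gB; clear; lia.
rewrite big_const_seq count_predT size_iota iter_addr_0.
apply: le_lt_trans Ne; rewrite -[leLHS]mulr_natr -[(2 * N).+1%:R]natr1 natrM.
rewrite (_ : 24 / _ = 8 / (k * N%:R) ^+ 2 * (3 * N%:R)).
  rewrite ler_wpM2l//; last lra.
  by rewrite divr_ge0// exprn_ge0// mulr_ge0// ?(ltW k0)//; lra.
by field; rewrite !gt_eqF//; lra.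
Qed.

(** The difference of the two sides is a convergent sum, which may be evaluated along
boxes, where it telescopes. *)
Lemma wps_addl a b z : cross a b != 0 -> ~ lat a b z ->
  wps (lat a b) (z + a) = wps (lat a b) z.
Proof.
move=> h hz; have hA := sparse_lat h; have A0 := lat0 a b.
have hza : ~ lat a b (z + a) by move/(latDr _ (latl a b)).
have D u : ~ lat a b u -> ~ (lat a b `\ 0) u by move=> h' [].
pose f u : C := 1 / (z + a - u) ^+ 2 - 1 / (z - u) ^+ 2.
apply/eqP; rewrite -subr_eq0; apply/eqP.
have hf : has_sum (lat a b) f (wps (lat a b) (z + a) - wps (lat a b) z).
  have -> : wps (lat a b) (z + a) - wps (lat a b) z = f 0 +
      (hsum (lat a b `\ 0) (wpt (z + a)) - hsum (lat a b `\ 0) (wpt z)).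
    by rewrite /wps /f !subr0; ring.
  have {1}-> : lat a b = [set 0] `|` (lat a b `\ 0).
    by rewrite setUDr setUC setDv setD0; apply/esym/setUidPl => ? ->.
  apply: has_sumU; first by rewrite setDE setICA setICr setI0.
    exact: has_sum1.
  apply: eq_has_sum (has_sumB (wpt_sum hA A0 (D _ hza)) (wpt_sum hA A0 (D _ hz))).
  by move=> u _; rewrite /wpt /f; ring.
apply: (@tends_uniq _ (fun N => \sum_(u <- [fset x in box a b N]%fset) f u)).
  apply: has_sum_along hf.
    move=> N u; suff : u \in [fset x in box a b N]%fset -> lat a b u by [].
    by rewrite in_fset => /box_lat.
  move=> u /mem_box [N hN]; by exists N => n /hN; rewrite in_fset.
apply: tends_eq (tends_box_telescope z h); exists 0%N => N _.
by rewrite big_fset_seq// box_uniq.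
Qed.

Lemma wps_periodic a b u z : cross a b != 0 -> ~ lat a b z -> lat a b u ->
  wps (lat a b) (z + u) = wps (lat a b) z.
Proof.
move=> h hz [m [n ->]].
have gen c : lat a b c -> (forall x, ~ lat a b x -> wps (lat a b) (x + c) = wps (lat a b) x) ->
    forall (k : int) x, ~ lat a b x -> wps (lat a b) (x + c *~ k) = wps (lat a b) x.
  move=> hc H.
  have cn (k : nat) x : ~ lat a b x -> ~ lat a b (x + c *+ k).
    elim: k => [|k IH] hx; first by rewrite mulr0n addr0.
    by rewrite mulrSr addrA => /(latDr _ hc); exact: IH.
  have pos (k : nat) x : ~ lat a b x -> wps (lat a b) (x + c *+ k) = wps (lat a b) x.
    elim: k => [|k IH] hx; first by rewrite mulr0n addr0.
    rewrite mulrSr addrA H ?IH//; exact: cn.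
  case=> k x hx; first by rewrite -pmulrn pos.
  rewrite NegzE mulrNz -pmulrn; rewrite -[in RHS](subrK (c *+ k.+1) x) pos//.
  have ck : lat a b (c *+ k.+1).
    elim: k.+1 => [|j IH]; first by rewrite mulr0n; exact: lat0.
    by rewrite mulrSr; apply: latD.
  by move=> h1; apply: hx; apply/(latDr _ (latN ck)).
have hn : ~ lat a b (z + a *~ m).
  move=> h1; apply: hz; apply/(latDr z _)/h1.
  by exists m, 0; rewrite mulr0z addr0.
rewrite addrA (gen b); [|exact: latr| |exact: hn].
  by rewrite (gen a)//; [exact: latl|move=> x; exact: wps_addl].
move=> x; rewrite latC; apply: wps_addl.
by rewrite crossC oppr_eq0.
Qed.

Lemma latN_iff a b u : lat a b (- u) <-> lat a b u.
Proof. by split => /latN; rewrite ?opprK. Qed.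

Lemma wps_lat_even a b z : cross a b != 0 -> ~ lat a b z ->
  wps (lat a b) (- z) = wps (lat a b) z.
Proof.
move=> h; apply: wps_even; [exact: sparse_lat|exact: lat0|exact: latN].
Qed.

Lemma cross2l a b : (cross (2 * a) b != 0) = (cross a b != 0).
Proof.
have -> : cross (2 * a) b = 2 * cross a b.
  by rewrite mulr_natl crossC -[a *+ 2]/(a *~ 2%:Z) crossMz (crossC b); ring.
by rewrite mulf_eq0 pnatr_eq0.
Qed.

Lemma lat2l_notin a b : cross a b != 0 -> ~ lat (2 * a) b a.
Proof.
move=> h [m [n e]].
have [|] := lat_coord (m := 1) (n := 0) (m' := 2 * m) (n' := n) h.
  by rewrite mulr1z mulr0z addr0 [LHS]e mulrzA; congr (_ *~ _ + _); rewrite mulr_natl.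
lia.
Qed.

Lemma lat2l_sub a b : lat (2 * a) b `<=` lat a b.
Proof.
apply: sub_lat; last exact: latr.
by rewrite mulr_natl mulr2n; apply: latD; exact: latl.
Qed.

Lemma lat2l_split a b : lat a b = lat (2 * a) b `|` [set u | lat (2 * a) b (u - a)].
Proof.
apply/seteqP; split=> [_ [m [n ->]]|u [/lat2l_sub//|/lat2l_sub h]]; last first.
  by rewrite -(subrK a u); apply: latD h (latl _ _).
have D k : (2 * a) *~ k = a *~ (2 * k) by rewrite mulrzA mulr_natl.
have : m = 2 * (m %/ 2)%Z \/ m = 2 * (m %/ 2)%Z + 1 by lia.
set k := (m %/ 2)%Z => -[->|->]; [left|right]; exists k, n; rewrite D//.
by rewrite mulrzDr_tmp mulr1z; ring.
Qed.

Lemma wps_halve a b z : cross a b != 0 -> ~ lat a b z ->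
  wps (lat a b) z = wps (lat (2 * a) b) z + wps (lat (2 * a) b) (z - a)
                    - wps (lat (2 * a) b) a.
Proof.
move=> h hz; apply: wps_split => //; [exact: sparse_lat|exact: lat0|exact: latB|
  exact: lat2l_split|exact: lat2l_notin].
Qed.

End LatticeFunctions.

(** * Polynomial approximation, the maximum principle and Liouville's theorem *)

Section Jets.
Variable R : realType.
Local Notation C := R[i].
Implicit Types (f g h : C -> C) (p q : {poly C}) (a b c t u v w z : C).

(** This substitutes for holomorphy: a polynomial approximation at each point separately
is enough to exclude interior maxima. *)
Definition jet n f z := exists p, exists K d : R, 0 < d /\
  forall t, nm t < d -> nm (f (z + t) - p.[t]) <= K * nm t ^+ n.

Lemma poly_dec p : exists q c, p = q * 'X + c%:P.
Proof.
by elim/poly_ind: p => [|p c _]; [exists 0, 0; rewrite mul0r addr0|exists p, c].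
Qed.

Lemma poly_bounded p : exists2 B : R, 0 <= B &
  forall t, nm t <= 1 -> nm p.[t] <= B.
Proof.
elim/poly_ind: p => [|p c [B B0 HB]]; first by exists 0 => // t _; rewrite horner0 nm0.
exists (B + nm c); first by rewrite addr_ge0 ?nm_ge0.
move=> t t1; rewrite !hornerE (le_trans (nmD _ _))// lerD2r nmM.
by rewrite -[B]mulr1 ler_pM ?nm_ge0// HB.
Qed.

Lemma poly_lip p : exists2 B : R, 0 <= B &
  forall t, nm t <= 1 -> nm (p.[t] - p.[0]) <= B * nm t.
Proof.
have [q [c ->]] := poly_dec p; have [B B0 HB] := poly_bounded q.
exists B => // t t1; rewrite !hornerE (_ : _ - _ = q.[t] * t); last by ring.
by rewrite nmM ler_wpM2r ?nm_ge0// HB.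
Qed.

Lemma jet_near n f g z : (exists2 d : R, 0 < d & forall t, nm t < d -> f (z + t) = g (z + t)) ->
  jet n f z -> jet n g z.
Proof.
move=> [d1 d10 h1] [p [K [d [d0 H]]]]; exists p, K, (Num.min d1 d).
split; first by rewrite lt_min d10.
by move=> t; rewrite lt_min => /andP[/h1 <- /H].
Qed.

Lemma jetP n f z : jet n f z -> exists p, exists K d : R, [/\ 0 < d, d <= 1, 0 <= K &
  forall t, nm t < d -> nm (f (z + t) - p.[t]) <= K * nm t ^+ n].
Proof.
move=> [p [K [d [d0 H]]]]; exists p, `|K|, (Num.min d 1); split => //.
- by rewrite lt_min d0 ltr01.
- by rewrite ge_min lexx orbT.
move=> t; rewrite lt_min => /andP[/H h _]; apply: le_trans h _.
by rewrite ler_wpM2r ?exprn_ge0 ?nm_ge0// ler_norm.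
Qed.

Lemma jet_cst n c z : jet n (fun=> c) z.
Proof.
exists c%:P, 0, 1; split=> // t _.
by rewrite hornerC subrr nm0 mul0r.
Qed.

Lemma jetD n f g z : jet n f z -> jet n g z -> jet n (fun w => f w + g w) z.
Proof.
move=> [p [K [d [d0 H]]]] [p' [K' [d' [d'0 H']]]].
exists (p + p'), (K + K'), (Num.min d d'); split; first by rewrite lt_min d0.
move=> t; rewrite lt_min => /andP[/H h /H' h'].
rewrite hornerD opprD addrACA (le_trans (nmD _ _))// mulrDl; exact: lerD.
Qed.

Lemma jetM n f g z : jet n f z -> jet n g z -> jet n (fun w => f w * g w) z.
Proof.
move=> /jetP[p [K [d [d0 d1 K0 H]]]] /jetP[p' [K' [d' [d'0 d'1 K'0 H']]]].
have [B B0 HB] := poly_bounded p; have [B' B'0 HB'] := poly_bounded p'.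
exists (p * p'), (K * (B' + K') + B * K'), (Num.min d d').
split; first by rewrite lt_min d0.
move=> t; rewrite lt_min => /andP[td td'].
have h := H _ td; have h' := H' _ td'.
have t1 : nm t <= 1 by rewrite ltW// (lt_le_trans td).
have tn1 : nm t ^+ n <= 1 by rewrite exprn_ile1// nm_ge0.
have hB := HB _ t1; have hB' := HB' _ t1.
set x := f _ in h *; set y := g _ in h' *; rewrite hornerM.
have -> : x * y - p.[t] * p'.[t] = (x - p.[t]) * y + p.[t] * (y - p'.[t]) by ring.
apply: le_trans (nmD _ _) _; rewrite !nmM [leRHS]mulrDl lerD//; last first.
  by rewrite -mulrA ler_pM ?nm_ge0.
rewrite mulrAC ler_pM ?nm_ge0//.
rewrite -(subrK p'.[t] y) addrC (le_trans (nmD _ _))// lerD//.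
by apply: le_trans h' _; rewrite ler_piMr.
Qed.

Lemma jet_leq m n f z : (m <= n)%N -> jet n f z -> jet m f z.
Proof.
move=> mn /jetP[p [K [d [d0 d1 K0 H]]]]; exists p, K, d; split => // t td.
apply: le_trans (H _ td) _; rewrite ler_wpM2l//.
by rewrite ler_wiXn2l ?nm_ge0// ltW// (lt_le_trans td).
Qed.

Lemma jet_value n f z p (K d : R) : 0 < d ->
  (forall t, nm t < d -> nm (f (z + t) - p.[t]) <= K * nm t ^+ n.+1) ->
  p.[0] = f z.
Proof.
move=> d0 /(_ 0); rewrite nm0 => /(_ d0); rewrite addr0 exprS mul0r mulr0 => h.
have : nm (f z - p.[0]) == 0 by rewrite eq_le h nm_ge0.
by rewrite nm_eq0 subr_eq0 => /eqP.
Qed.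

Lemma jet_lip n f z : jet n.+1 f z -> exists2 K : R, 0 <= K &
  exists2 d : R, 0 < d & forall t, nm t < d -> nm (f (z + t) - f z) <= K * nm t.
Proof.
move=> /(jet_leq (isT : (1 <= n.+1)%N)) /jetP[p [K [d [d0 d1 K0 H]]]].
have [B B0 HB] := poly_lip p.
exists (K + B); first by rewrite addr_ge0.
exists d => // t td; rewrite -(jet_value d0 H) (le_trans (nm_tri p.[t] _ _))// mulrDl.
by rewrite lerD ?H// HB// ltW// (lt_le_trans td).
Qed.

(** The finite geometric series. *)
Lemma jet_inv n w z : z != w -> jet n (fun x => (x - w)^-1) z.
Proof.
move=> zw; pose s := z - w; have s0 : s != 0 by rewrite subr_eq0.
have ns0 : 0 < nm s by rewrite nm_gt0.
pose p : nat -> {poly C} := fix p n := if n is n'.+1 then p n' + (s^-1 * ((-s^-1) ^+ n')) *: 'X^n' else 0.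
have E m t : s + t != 0 -> (s + t)^-1 - (p m).[t] = (- s^-1 * t) ^+ m * (s + t)^-1.
  move=> st; elim: m => [|m IH]; first by rewrite /= horner0 subr0 expr0 mul1r.
  rewrite [p _]/= hornerD opprD addrA IH !hornerE !exprMn !exprS.
  by field; rewrite st s0.
exists (p n), (nm s ^- n * (2 / nm s)), (nm s / 2); split; first by rewrite divr_gt0.
move=> t td; have hst : nm s / 2 <= nm (s + t).
  have := nm_sub s (- t); rewrite opprK nmN; lra.
have st0 : 0 < nm (s + t) by apply: lt_le_trans hst; rewrite divr_gt0.
have st : s + t != 0 by rewrite -nm_gt0.
rewrite (_ : z + t - w = s + t); last by rewrite /s; ring.
rewrite E// nmM nmX nmM nmN !nmV exprMn exprVn mulrAC ler_wpM2r ?exprn_ge0 ?nm_ge0//.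
rewrite ler_wpM2l ?invr_ge0 ?exprn_ge0 ?nm_ge0//.
by rewrite -[2 / _]invf_div lef_pV2 ?posrE// divr_gt0.
Qed.

(** Averaging over the four points [z + r, z + r i, z - r, z - r i] kills the
terms of degree 1, 2 and 3. *)
Lemma jet_mean4 f z : jet 3 f z -> exists2 K : R, 0 <= K & exists2 d : R, 0 < d &
  forall r : R, 0 < r -> r < d ->
  nm (f (z + r%:C) + f (z + 'i%C * r%:C) + f (z - r%:C) + f (z - 'i%C * r%:C) - 4 * f z)
    <= K * r ^+ 3.
Proof.
move=> /jetP[p [K [d [d0 d1 K0 H]]]]; have V := jet_value d0 H.
have [q1 [c0 e0]] := poly_dec p; have [q2 [c1 e1]] := poly_dec q1.
have [q3 [c2 e2]] := poly_dec q2; have [B B0 HB] := poly_bounded q3.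
exists (4 * K + 4 * B); first by rewrite addr_ge0 ?mulr_ge0.
exists d => // r r0 rd; set x := r%:C; set y := 'i%C * x.
have nx : nm x = r by rewrite nm_real gtr0_norm.
have ny : nm y = r by rewrite nmM nm_i nx mul1r.
have yx : y ^+ 2 = - x ^+ 2 by rewrite exprMn sqr_i mulN1r.
have r1 : r <= 1 by rewrite ltW// (lt_le_trans rd).
pose D t := f (z + t) - p.[t].
have pE t : p.[t] = q3.[t] * t ^+ 3 + c2 * t ^+ 2 + c1 * t + c0.
  by rewrite e0 e1 e2 !(hornerD, hornerM, hornerX, hornerC); ring.
have fE t : f (z + t) = D t + p.[t] by rewrite /D subrK.
have -> : f (z + x) + f (z + y) + f (z - x) + f (z - y) - 4 * f z =
   (D x + D y + D (- x) + D (- y)) +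
   (q3.[x] * x ^+ 3 + q3.[y] * y ^+ 3 + q3.[- x] * (- x) ^+ 3 + q3.[- y] * (- y) ^+ 3).
  rewrite !fE -V !pE !sqrrN yx; ring.
have four (u1 u2 u3 u4 : C) (M : R) : nm u1 <= M -> nm u2 <= M -> nm u3 <= M ->
    nm u4 <= M -> nm (u1 + u2 + u3 + u4) <= 4 * M.
  move=> h1 h2 h3 h4.
  have := nmD (u1 + u2 + u3) u4; have := nmD (u1 + u2) u3; have := nmD u1 u2; lra.
apply: le_trans (nmD _ _) _; rewrite mulrDl -!mulrA lerD//; apply: four.
- by rewrite (le_trans (H _ _)) ?nx.
- by rewrite (le_trans (H _ _)) ?ny.
- by rewrite (le_trans (H _ _)) ?nmN ?nx.
- by rewrite (le_trans (H _ _)) ?nmN ?ny.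
- by rewrite nmM nmX nx ler_wpM2r ?exprn_ge0 ?(ltW r0)// HB// nx.
- by rewrite nmM nmX ny ler_wpM2r ?exprn_ge0 ?(ltW r0)// HB// ny.
- by rewrite nmM nmX nmN nx ler_wpM2r ?exprn_ge0 ?(ltW r0)// HB// nmN nx.
- by rewrite nmM nmX nmN ny ler_wpM2r ?exprn_ge0 ?(ltW r0)// HB// nmN ny.
Qed.

(** Local Lipschitz bounds give continuity, and the square is compact. *)
Lemma square_max (u : R -> R -> R) (x1 x2 y1 y2 : R) : x1 <= x2 -> y1 <= y2 ->
  (forall x y, exists K d : R, 0 < d /\ forall x' y', `|x' - x| < d -> `|y' - y| < d ->
     `|u x' y' - u x y| <= K * (`|x' - x| + `|y' - y|)) ->
  exists x0 y0, [/\ x1 <= x0 <= x2, y1 <= y0 <= y2 &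
    forall x y, x1 <= x <= x2 -> y1 <= y <= y2 -> u x y <= u x0 y0].
Proof.
move=> hx hy hu; pose F (p : R * R) := u p.1 p.2.
pose A : set (R * R) := `[x1, x2]%classic `*` `[y1, y2]%classic.
have cA : compact A by apply: compact_setX; exact: segment_compact.
have A0 : A !=set0 by exists (x1, y1); split; rewrite /= in_itv /= ?lexx ?hx ?hy.
have cF : continuous F.
  move=> [x y]; apply/cvgrPdist_lt => e e0.
  have [K [d [d0 H]]] := hu x y.
  pose dd := Num.min d (e / (2 * `|K| + 1)).
  have K1 : 0 < 2 * `|K| + 1 by rewrite ltr_wpDl// mulr_ge0.
  have dd0 : 0 < dd by rewrite lt_min d0 divr_gt0.
  near_simpl; exists (ball x dd, ball y dd); first by split; exact: nbhsx_ballx.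
  move=> [x' y'] [/= b1 b2].
  have {}b1 : `|x' - x| < dd by rewrite distrC.
  have {}b2 : `|y' - y| < dd by rewrite distrC.
  rewrite /F /= distrC; apply: le_lt_trans (H _ _ _ _) _.
  - by move: b1; rewrite lt_min => /andP[].
  - by move: b2; rewrite lt_min => /andP[].
  apply: (@le_lt_trans _ _ (`|K| * (dd + dd))).
    apply: le_trans (ler_norm _) _; rewrite normrM ler_wpM2l// ger0_norm ?addr_ge0//.
    by rewrite lerD// ltW.
  have : dd <= e / (2 * `|K| + 1) by rewrite ge_min lexx orbT.
  rewrite ler_pdivlMr//; have := normr_ge0 K; nra.
have [[x0 y0] + Hm] := compact_EVT_max A0 cA (continuous_subspaceT cF).
rewrite inE => -[/= hx0 hy0]; exists x0, y0; split.
- by move: hx0; rewrite in_itv.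
- by move: hy0; rewrite in_itv.
move=> x y hx' hy'; apply: (Hm (x, y)); rewrite inE; split; rewrite /= in_itv //.
Qed.

(** Adding the small strictly subharmonic term [eps (x^2 + y^2)] to the real
part of a rotated [g] makes an interior maximum impossible, because the four
point mean then exceeds the value at the centre. *)
Lemma max_principle g z1 (L B : R) : 0 < L -> (forall z, jet 3 g z) ->
  (forall x y : R, `|x| <= L -> `|y| <= L -> `|x| = L \/ `|y| = L ->
     nm (g (z1 + (x +i* y))) <= B) ->
  forall x y : R, `|x| <= L -> `|y| <= L -> nm (g (z1 + (x +i* y))) <= B.
Proof.
move=> L0 gj gB xs ys hxs hys; rewrite leNgt; apply/negP => hlt.
set gs := g (z1 + (xs +i* ys)) in hlt.
have B0 : 0 <= B.
  apply: le_trans (nm_ge0 _) (gB L 0 _ _ _); rewrite ?normr0 ?(gtr0_norm L0) ?(ltW L0)//.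
  by left.
have gs0 : 0 < nm gs by apply: le_lt_trans hlt.
have [c nc cgs] : exists2 c : C, nm c = 1 & complex.Re (c * gs) = nm gs.
  exists ((gs^*)%C * ((nm gs)^-1)%:C).
    rewrite nmM nm_real ger0_norm ?invr_ge0 ?nm_ge0//.
    have -> : nm (gs^*)%C = nm gs by case: (gs) => p q; rewrite /= sqrrN.
    by rewrite mulfV ?gt_eqF.
  have := sqr_nm gs; move: gs0; set N := nm gs; case: (gs) => p q N0 /= hN.
  have -> : (p * N^-1 - - q * 0) * p - (p * 0 + - q * N^-1) * q = (p ^+ 2 + q ^+ 2) / N by ring.
  by rewrite -hN expr2 mulfK// gt_eqF.
have [eps eps0 hLL] : exists2 eps : R, 0 < eps &
    eps * (L ^+ 2 + L ^+ 2) = (nm gs - B) / 2.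
  exists ((nm gs - B) / (4 * L ^+ 2)); last by field; rewrite gt_eqF.
  by rewrite divr_gt0 ?subr_gt0// mulr_gt0// exprn_gt0.
pose u (x y : R) := complex.Re (c * g (z1 + (x +i* y))) + eps * (x ^+ 2 + y ^+ 2).
have Re_le (w : C) : `|complex.Re (c * w)| <= nm w.
  by rewrite (le_trans (normr_Re_nm _))// nmM nc mul1r.
have [||x y|x0 [y0 [hx0 hy0 hmax]]] := @square_max u (- L) L (- L) L; try lra.
  have [K K0 [d d0 H]] := jet_lip (gj (z1 + (x +i* y))).
  exists (K + eps * (2 * `|x| + 2 * `|y| + 1)), (Num.min (d / 2) 1).
  split; first by rewrite lt_min divr_gt0// ltr01.
  move=> x' y'; rewrite !lt_min => /andP[dx dx1] /andP[dy dy1].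
  pose t : C := (x' - x) +i* (y' - y).
  have nt : nm t <= `|x' - x| + `|y' - y| by exact: nm_le_ReIm.
  have E : z1 + (x' +i* y') = z1 + (x +i* y) + t.
    by rewrite -addrA; congr (_ + _); apply/eqP; rewrite eq_complex /=; apply/andP; split; apply/eqP; ring.
  have td : nm t < d by lra.
  have h1 := H _ td.
  have h2 := Re_le (g (z1 + (x +i* y) + t) - g (z1 + (x +i* y))).
  rewrite /u E; set g1 := g (_ + t) in h1 h2 *; set g0 := g _ in h1 h2 *.
  have -> : complex.Re (c * g1) + eps * (x' ^+ 2 + y' ^+ 2) -
      (complex.Re (c * g0) + eps * (x ^+ 2 + y ^+ 2)) =
      complex.Re (c * (g1 - g0)) + eps * ((x' - x) * (x' + x) + (y' - y) * (y' + y)).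
    rewrite mulrBr; case: (c * g1) (c * g0) => a1 a2 [b1 b2] /=; ring.
  apply: le_trans (ler_normD _ _) _; rewrite [leRHS]mulrDl lerD//.
    apply: le_trans h2 _; apply: le_trans h1 _; by rewrite ler_wpM2l.
  rewrite normrM gtr0_norm// -mulrA ler_pM2l// (le_trans (ler_normD _ _))// !normrM.
  have q1 : `|x' + x| <= 2 * `|x| + 1.
    have := ler_normD (x' - x) (x + x); rewrite addrA subrK.
    have := ler_normD x x; lra.
  have q2 : `|y' + y| <= 2 * `|y| + 1.
    have := ler_normD (y' - y) (y + y); rewrite addrA subrK.
    have := ler_normD y y; lra.
  rewrite mulrDr [leRHS]addrC mulrC [X in _ + X <= _]mulrC.
  move: (normr_ge0 (x' - x)) (normr_ge0 (y' - y)) (normr_ge0 x) (normr_ge0 y) q1 q2.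
  move: `|x' + x| `|y' + y| `|x' - x| `|y' - y| `|x| `|y| => *; nra.
have bnd (x : R) : - L <= x <= L -> `|x| <= L by rewrite ler_norml.
have us : nm gs <= u x0 y0.
  apply: le_trans (hmax xs ys _ _); [|by rewrite -ler_norml..].
  by rewrite /u -/gs cgs lerDl mulr_ge0 ?(ltW eps0)// addr_ge0 ?sqr_ge0.
have sq (x : R) : `|x| <= L -> x ^+ 2 <= L ^+ 2.
  by move=> h; rewrite -(real_normK (num_real x)) lerXn2r// ?nnegrE// ltW.
have int : `|x0| < L /\ `|y0| < L.
  have nb : ~ (`|x0| = L \/ `|y0| = L).
    move=> /(gB x0 y0 (bnd _ hx0) (bnd _ hy0)) hB.
    have := Re_le (g (z1 + (x0 +i* y0))); have := ler_norm (complex.Re (c * g (z1 + (x0 +i* y0)))).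
    have : eps * (x0 ^+ 2 + y0 ^+ 2) <= eps * (L ^+ 2 + L ^+ 2).
      by rewrite ler_pM2l// lerD// sq// bnd.
    move: us; rewrite /u hLL; lra.
  split; rewrite lt_neqAle bnd// andbT; apply/eqP => e; apply: nb; [left|right]; exact: e.
have [K K0 [d d0 H]] := jet_mean4 (gj (z1 + (x0 +i* y0))).
have [xL yL] := int.
pose r0 := Num.min (Num.min (L - `|x0|) (L - `|y0|)) (Num.min d (4 * eps / (K + 1))).
have K1 : 0 < K + 1 by lra.
have r00 : 0 < r0 by rewrite !lt_min !subr_gt0 xL yL d0 divr_gt0// mulr_gt0.
pose r := r0 / 2; have rp : 0 < r by rewrite divr_gt0.
have : r < r0 by rewrite /r; lra.
rewrite !lt_min => /andP[/andP[r1 r2] /andP[r3 r4]].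
have := H r rp r3.
have Ex : z1 + (x0 +i* y0) + r%:C = z1 + ((x0 + r) +i* y0).
  by rewrite -addrA; congr (_ + _); apply/eqP; rewrite eq_complex /=; apply/andP; split; apply/eqP; ring.
have Ey : z1 + (x0 +i* y0) + 'i%C * r%:C = z1 + (x0 +i* (y0 + r)).
  by rewrite -addrA; congr (_ + _); apply/eqP; rewrite eq_complex /=; apply/andP; split; apply/eqP; ring.
have Ex' : z1 + (x0 +i* y0) - r%:C = z1 + ((x0 - r) +i* y0).
  by rewrite -addrA; congr (_ + _); apply/eqP; rewrite eq_complex /=; apply/andP; split; apply/eqP; ring.
have Ey' : z1 + (x0 +i* y0) - 'i%C * r%:C = z1 + (x0 +i* (y0 - r)).
  by rewrite -addrA; congr (_ + _); apply/eqP; rewrite eq_complex /=; apply/andP; split; apply/eqP; ring.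
rewrite Ex Ey Ex' Ey'; set s := (X in nm X) => hs.
have := le_trans (Re_le s) hs.
have xr (x : R) : `|x| < L -> r < L - `|x| -> - L <= x + r <= L /\ - L <= x - r <= L.
  by clear -rp; move=> _; have := ler_norm x; have := ler_norm (- x); rewrite normrN => *; split; apply/andP; split; lra.
have [p1 p2] := xr _ xL r1; have [p3 p4] := xr _ yL r2.
have := hmax _ _ p1 hy0; have := hmax _ _ p2 hy0.
have := hmax _ _ hx0 p3; have := hmax _ _ hx0 p4.
have -> : complex.Re (c * s) = complex.Re (c * g (z1 + ((x0 + r) +i* y0)))
  + complex.Re (c * g (z1 + (x0 +i* (y0 + r)))) + complex.Re (c * g (z1 + ((x0 - r) +i* y0)))
  + complex.Re (c * g (z1 + (x0 +i* (y0 - r)))) - 4 * complex.Re (c * g (z1 + (x0 +i* y0))).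
  have ReD (v w : C) : complex.Re (v + w) = complex.Re v + complex.Re w by case: v w => ? ? [].
  have ReN (v : C) : complex.Re (- v) = - complex.Re v by case: v.
  have Re4 (v : C) : complex.Re (4 * v) = 4 * complex.Re v.
    by rewrite !mulr_natl !mulrS !mulr0n !addr0 !ReD.
  by rewrite /s !mulrDr !ReD mulrN ReN mulrCA Re4.
rewrite /u ler_norml => m1 m2 m3 m4 /andP[m5 _].
have m6 : r * (K + 1) < 4 * eps by rewrite -ltr_pdivlMr.
have r2p : 0 < r ^+ 2 by rewrite exprn_gt0.
have m7 : r ^+ 2 * (r * (K + 1)) < r ^+ 2 * (4 * eps) by rewrite ltr_pM2l.
have m8 : 0 < r ^+ 3 by rewrite exprn_gt0.
move: m5 m7 m1 m2 m3 m4; rewrite !sqrrD !sqrrN !mulrN.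
rewrite (_ : r ^+ 2 * (r * (K + 1)) = K * r ^+ 3 + r ^+ 3); last by ring.
lra.
Qed.

(** The maximum principle applies to [(h - h z1) / (z - z1)], which is bounded by
[2 M / L] on the boundary of a square of half side [L]. *)
Theorem liouville h (M : R) : (forall z, jet 4 h z) -> (forall z, nm (h z) <= M) ->
  forall z z1, h z = h z1.
Proof.
move=> hj hM z z1.
have M0 : 0 <= M by apply: le_trans (nm_ge0 _) (hM 0).
have [p [K [d [d0 d1 K0 H]]]] := jetP (hj z1).
have V := jet_value d0 H; have [q [c pE]] := poly_dec p.
have cE : c = h z1 by rewrite -V pE !hornerE.
pose g x := if x == z1 then q.[0] else (h x - h z1) / (x - z1).
have gj x : jet 3 g x.
  have [->|xz] := eqVneq x z1.
    exists q, K, d; split=> // t td; rewrite /g.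
    have [t0|t0] := eqVneq t 0.
      by rewrite t0 addr0 eqxx subrr nm0 mulr_ge0// exprn_ge0.
    rewrite -subr_eq0 addrAC subrr add0r (negbTE t0).
    have nt0 : 0 < nm t by rewrite nm_gt0.
    rewrite -(ler_pM2r nt0) -nmM -mulrA -exprSr (le_trans _ (H _ td))//.
    by rewrite pE !hornerE cE mulrBl mulfVK// opprD addrA [_ - q.[t] * t]addrAC.
  have J : jet 3 (fun x => (h x - h z1) * (x - z1)^-1) x.
    apply: jetM; last exact: jet_inv.
    by apply: jetD (jet_leq _ (hj x)) (jet_cst _ _ _).
  apply: jet_near J; exists (nm (x - z1)); first by rewrite nm_gt0 subr_eq0.
  move=> t td; rewrite /g; case: eqP => // e.
  by move: td; rewrite nmC -e addrAC subrr add0r ltxx.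
suff g0 : g z = 0.
  move: g0; rewrite /g; have [->//|zz1] := eqVneq z z1.
  move=> /eqP; rewrite mulf_eq0 invr_eq0 !subr_eq0 (negbTE zz1) orbF => /eqP //.
apply: nm_small_eq => e e0; rewrite subr0.
pose L := 2 * M / e + nm (z - z1) + 1.
have Me : 0 <= 2 * M / e by rewrite divr_ge0 ?mulr_ge0// ltW.
have L0 : 0 < L by have := nm_ge0 (z - z1); rewrite /L; lra.
have zE : z = z1 + (complex.Re (z - z1) +i* complex.Im (z - z1)).
  by case: (z - z1) (subrKC z1 z) => ? ? /= ->.
rewrite zE; apply: (@max_principle g z1 L e L0 gj); last 2 first.
- by have := normr_Re_nm (z - z1); rewrite /L; lra.
- by have := normr_Im_nm (z - z1); rewrite /L; lra.
move=> x y hx hy hb; set w := x +i* y.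
have Lw : L <= nm w.
  by case: hb => <-; [exact: (normr_Re_nm w)|exact: (normr_Im_nm w)].
have w0 : 0 < nm w by apply: lt_le_trans Lw.
have wz : z1 + w != z1 by rewrite -subr_eq0 addrAC subrr add0r -nm_gt0.
rewrite /g (negbTE wz) addrAC subrr add0r nmM nmV ler_pdivrMr//.
apply: le_trans (nmB _ _) _; have h1 := hM (z1 + w); have h2 := hM z1.
have : 2 * M <= e * L.
  rewrite -ler_pdivrMl// mulrC /L; have := nm_ge0 (z - z1); lra.
have : e * L <= e * nm w by rewrite ler_pM2l.
lra.
Qed.

(** A doubly periodic function takes all its values on a parallelogram, so it is bounded. *)
Theorem liouville_lat h a b : cross a b != 0 -> (forall z, jet 4 h z) ->
  (forall z u, lat a b u -> h (z + u) = h z) -> forall z z1, h z = h z1.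
Proof.
move=> hab hj hp.
pose P (s t : R) := s%:C * a + t%:C * b.
have [||s t|s0 [t0 [_ _ hmax]]] := @square_max (fun s t : R => nm (h (P s t))) 0 1 0 1; try lra.
  have [K K0 [d d0 H]] := jet_lip (hj (P s t)).
  pose N := nm a + nm b + 1.
  have N0 : 0 < N by rewrite /N; have := nm_ge0 a; have := nm_ge0 b; lra.
  exists (K * N), (d / (2 * N)); split; first by rewrite divr_gt0// mulr_gt0.
  move=> s' t' hs ht; pose v := (s' - s)%:C * a + (t' - t)%:C * b.
  have E : P s' t' = P s t + v by rewrite /P /v !rmorphB; ring.
  have nv : nm v <= N * (`|s' - s| + `|t' - t|).
    apply: le_trans (nmD _ _) _; rewrite !nmM !nm_real /N.
    have := nm_ge0 a; have := nm_ge0 b.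
    move: (normr_ge0 (s' - s)) (normr_ge0 (t' - t)); nra.
  have vd : nm v < d.
    apply: le_lt_trans nv _; move: hs ht; rewrite !ltr_pdivlMr ?mulr_gt0// => hs ht; nra.
  have hv := H _ vd; rewrite E -mulrA.
  apply: (@le_trans _ _ (K * nm v)); last by rewrite ler_wpM2l.
  apply: le_trans hv; have := nm_sub (h (P s t + v)) (h (P s t)).
  have := nm_sub (h (P s t)) (h (P s t + v)); rewrite nmC => h1 h2.
  by rewrite ler_norml; apply/andP; split; lra.
apply: (@liouville h (nm (h (P s0 t0))) hj) => z.
pose s := cross z b / cross a b; pose t := cross a z / cross a b.
have zE : z = P s t.
  rewrite /P {}/s {}/t; clear -hab; move: hab; rewrite /cross.
  case: a b z => [a1 a2] [b1 b2] [z1 z2] /= hab.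
  by apply/eqP; rewrite eq_complex /=; apply/andP; split; apply/eqP; field.
have fl (x : R) : 0 <= x - (Num.floor x)%:~R <= 1.
  have := floor_le x; have := lt_succ_floor x; rewrite intrD; lra.
have -> : h z = h (P (s - (Num.floor s)%:~R) (t - (Num.floor t)%:~R)).
  rewrite -[RHS](hp _ (a *~ Num.floor s + b *~ Num.floor t)); last by eexists; eexists.
  congr h; rewrite zE /P !rmorphB !rmorph_int -[a *~ _]mulrzl -[b *~ _]mulrzl; ring.
exact: hmax.
Qed.

End Jets.

(** * Taylor expansions of the Weierstrass sum *)

Section Taylor.
Variable R : realType.
Local Notation C := R[i].
Implicit Types (A : set C) (a b m n t u v w z : C).

Lemma sparse_near A z : sparse A -> ~ A z ->
  exists2 d : R, 0 < d & forall t, nm t < d -> ~ A (z + t).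
Proof.
move=> hA /(sparse_far hA)[c [d [_ d0 H]]]; exists d => // t td /H[_].
by rewrite addrAC subrr add0r leNgt td.
Qed.

Lemma wpt_taylor_term z t u : z + t - u != 0 -> u - z != 0 -> u != 0 ->
  wpt (z + t) u - (wpt z u + 2 * (u - z) ^- 3 * t + 3 * (u - z) ^- 4 * t ^+ 2
    + 4 * (u - z) ^- 5 * t ^+ 3 + 5 * (u - z) ^- 6 * t ^+ 4 + 6 * (u - z) ^- 7 * t ^+ 5)
  = t ^+ 6 * ((7 * (u - z) - 6 * t) / ((u - z) ^+ 7 * (t - (u - z)) ^+ 2)).
Proof.
rewrite /wpt; set w := u - z => h1 w0 u0.
have e1 : z + t - u = t - w by rewrite /w; ring.
have e2 : z - u = - w by rewrite /w; ring.
by rewrite e1 in h1 *; rewrite e2 sqrrN; field; rewrite u0 w0 h1.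
Qed.

(** The Taylor polynomials of the terms have coefficients proportional to
[(u - z) ^ (-k)], and the remainders are dominated by [(u - z) ^ (-8)]. *)
Lemma wpt_taylor A z : sparse A -> A 0 -> ~ (A `\ 0) z ->
  exists a : nat -> C, (forall k, has_sum (A `\ 0) (fun u => (u - z) ^- k.+3) (a k)) /\
  exists K d : R, 0 < d /\ forall t, nm t < d ->
    nm (hsum (A `\ 0) (wpt (z + t)) - (hsum (A `\ 0) (wpt z) + 2 * a 0%N * t
      + 3 * a 1%N * t ^+ 2 + 4 * a 2%N * t ^+ 3 + 5 * a 3%N * t ^+ 4 + 6 * a 4%N * t ^+ 5))
    <= K * nm t ^+ 6.
Proof.
move=> hA A0 hz; have [c [d [c0 d0 hcd]]] := sparse_far (sparseD1 hA) hz.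
have [a ha] : exists a : nat -> C, forall k,
    has_sum (A `\ 0) (fun u => (u - z) ^- k.+3) (a k).
  exists (fun k => hsum (A `\ 0) (fun u => (u - z) ^- k.+3)) => k.
  by have [B /hsumP] := invXn_bounded k hA hz.
exists a; split=> //.
have [B hB] := invXn_bounded 5 hA hz.
exists (40 * B), (d / 2); split; first by rewrite divr_gt0.
move=> t td.
have hzt : ~ (A `\ 0) (z + t).
  by move=> /hcd[_]; rewrite addrAC subrr add0r; lra.
have H := has_sumB (wpt_sum hA A0 hzt) (has_sumD (has_sumD (has_sumD (has_sumD (has_sumD
  (wpt_sum hA A0 hz) (has_sumZ (2 * t) (ha 0%N))) (has_sumZ (3 * t ^+ 2) (ha 1%N)))
  (has_sumZ (4 * t ^+ 3) (ha 2%N))) (has_sumZ (5 * t ^+ 4) (ha 3%N)))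
  (has_sumZ (6 * t ^+ 5) (ha 4%N))).
rewrite (_ : hsum _ (wpt (z + t)) - _ = hsum (A `\ 0) (wpt (z + t)) -
   (hsum (A `\ 0) (wpt z) + 2 * t * a 0%N + 3 * t ^+ 2 * a 1%N + 4 * t ^+ 3 * a 2%N
    + 5 * t ^+ 4 * a 3%N + 6 * t ^+ 5 * a 4%N)); last by ring.
apply: has_sum_le H; rewrite mulrAC; apply: (abs_bounded_le _ _ hB).
  by rewrite mulr_ge0// exprn_ge0// nm_ge0.
move=> u hu; have [_ u0] := setD1_in hu; have [_ h2] := hcd u hu.
have w0 : 0 < nm (u - z) by apply: lt_le_trans d0 h2.
have h3 : nm (u - z) / 2 <= nm (t - (u - z)).
  by have := nm_sub (u - z) t; rewrite (nmC (u - z) t); lra.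
have h4 : 0 < nm (t - (u - z)) by lra.
have h5 : z + t - u != 0 by rewrite -nm_gt0 (_ : z + t - u = t - (u - z))//; ring.
have := wpt_taylor_term h5 _ u0; rewrite -nm_gt0 => /(_ w0).
set X := wpt _ _ - _ => XE.
rewrite (_ : wpt _ _ - _ = X); last by rewrite /X; ring.
rewrite XE nmM (nmX t) (mulrC 40) -[leRHS]mulrA ler_wpM2l ?exprn_ge0 ?nm_ge0//.
set w := u - z in w0 h2 h3 h4 *.
rewrite nmM !nmV nmM !nmX ler_pdivrMr ?mulr_gt0 ?exprn_gt0//.
apply: (@le_trans _ _ (10 * nm w)).
  apply: le_trans (nmB _ _) _; rewrite !nmM !nm_nat; lra.
have -> : 10 * nm w = 40 * nm w ^- 8 * (nm w ^+ 7 * (nm w / 2) ^+ 2).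
  by field; rewrite gt_eqF.
rewrite ler_wpM2l ?mulr_ge0 ?invr_ge0 ?exprn_ge0 ?nm_ge0//.
rewrite ler_wpM2l ?exprn_ge0 ?nm_ge0//.
by apply: lerXn2r; rewrite ?nnegrE ?nm_ge0 ?divr_ge0 ?nm_ge0.
Qed.

Lemma jet_wpt A z : sparse A -> A 0 -> ~ (A `\ 0) z ->
  jet 6 (fun x => hsum (A `\ 0) (wpt x)) z.
Proof.
move=> hA A0 hz; have [a [_ [K [d [d0 H]]]]] := wpt_taylor hA A0 hz.
exists ((hsum (A `\ 0) (wpt z))%:P + (2 * a 0%N)%:P * 'X + (3 * a 1%N)%:P * 'X^2
  + (4 * a 2%N)%:P * 'X^3 + (5 * a 3%N)%:P * 'X^4 + (6 * a 4%N)%:P * 'X^5), K, d.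
by split=> // t td; rewrite !(hornerD, hornerM, hornerC, hornerX, hornerXn); exact: H.
Qed.

Lemma jet_wps A z : sparse A -> A 0 -> ~ A z -> jet 6 (wps A) z.
Proof.
move=> hA A0 hz; have z0 : z != 0 by apply/eqP => e; apply: hz; rewrite e.
have J := jetM (jet_inv 6 z0) (jet_inv 6 z0).
have hz' : ~ (A `\ 0) z by move=> [].
apply: jet_near (jetD J (jet_wpt hA A0 hz')); exists 1 => // t _.
by rewrite /wps subr0 -invfM -expr2 div1r.
Qed.

(** The odd power sums vanish because [u] and [- u] cancel. *)
Lemma wps_expansion0 A : sparse A -> A 0 -> (forall u, A u -> A (- u)) ->
  exists a4 a6 : C, [/\ has_sum (A `\ 0) (fun u => u ^- 4) a4,
    has_sum (A `\ 0) (fun u => u ^- 6) a6 &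
  exists K d : R, 0 < d /\ forall t, nm t < d ->
    nm (wps A t - (1 / t ^+ 2 + 3 * a4 * t ^+ 2 + 5 * a6 * t ^+ 4)) <= K * nm t ^+ 6].
Proof.
move=> hA A0 AN; have h0 : ~ (A `\ 0) 0 by move=> [_ /(_ erefl)].
have [a [ha [K [d [d0 H]]]]] := wpt_taylor hA A0 h0.
have ha' k : has_sum (A `\ 0) (fun u => u ^- k.+3) (a k).
  by apply: eq_has_sum (ha k) => u _; rewrite subr0.
have SN : A `\ 0 = [set j | (A `\ 0) (- j)].
  have NA u : A (- u) -> A u by move=> /AN; rewrite opprK.
  apply/seteqP; split=> [u [h1 h2]|u [/NA h1 h2]]; split=> //.
  - exact: AN.
  - by move=> /= /eqP; rewrite oppr_eq0 => /eqP.
  - by move=> /= u0; apply: h2; rewrite /= u0 oppr0.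
have odd0 k : odd k.+3 -> a k = 0.
  move=> ok; have : has_sum (A `\ 0) (fun u => u ^- k.+3) (- a k).
    rewrite SN; apply: (has_sum_bij (h := -%R) (h' := -%R)); try exact: opprK.
    apply: eq_has_sum (has_sumN (ha' k)) => u _.
    by rewrite exprNn -signr_odd ok expr1 mulN1r invrN.
  move=> /(has_sum_uniq (ha' k)) /eqP; rewrite -addr_eq0 -mulr2n mulrn_eq0 /=.
  by move=> /eqP.
have z0 : hsum (A `\ 0) (wpt 0) = 0.
  apply: hsumE; apply: eq_has_sum (has_sum0 _) => u _.
  by rewrite /wpt sub0r sqrrN subrr.
exists (a 1%N), (a 3%N); split; [exact: ha'|exact: ha'|exists K, d; split=> // t td].
have := H t td; rewrite add0r z0 (odd0 0%N isT) (odd0 2%N isT) (odd0 4%N isT) /wps.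
set x := hsum _ _; rewrite (_ : x - _ = 1 / t ^+ 2 + x - (1 / t ^+ 2 + 3 * a 1%N * t ^+ 2 + 5 * a 3%N * t ^+ 4)) //.
by ring.
Qed.

End Taylor.

(** * The product formula at a half period *)

Section HalfPeriods.
Variable R : realType.
Local Notation C := R[i].
Implicit Types (a b m n t u v w z : C).

Lemma lat_even_half m b z : ~ lat m b z -> ~ lat (2 * m) b z /\ ~ lat (2 * m) b (z - m).
Proof.
move=> hz; split => [/lat2l_sub//|/lat2l_sub h]; apply: hz.
by rewrite -(subrK m z); apply: latD h (latl _ _).
Qed.

Lemma lat_2 m b : lat (2 * m) b (m + m).
Proof. by rewrite (_ : m + m = 2 * m); [exact: latl|ring]. Qed.

(** The point [- m] is a centre of symmetry, so only even powers of [t] occur, and the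
constant term is removed. *)
Lemma half_period_jet m b : cross m b != 0 ->
  exists q : {poly C}, exists K d : R, 0 < d /\ forall t, nm t < d ->
    nm (wps (lat (2 * m) b) (t - m) - wps (lat (2 * m) b) m - t ^+ 2 * q.[t ^+ 2])
      <= K * nm t ^+ 6.
Proof.
move=> h; have h2 : cross (2 * m) b != 0 by rewrite cross2l.
set L := lat (2 * m) b; set P := wps L.
have hL : sparse L := sparse_lat h2.
have hm : ~ L m := lat2l_notin h.
have hNm : ~ L (- m) by move=> /latN_iff.
have [p [K [d [d0 d1 K0 H]]]] := jetP (jet_wps hL (lat0 _ _) hNm).
have V : p.[0] = P (- m) := jet_value d0 H.
have [d' d'0 H'] := sparse_near hL hNm.
have PNm : P (- m) = P m by apply: wps_lat_even.
pose s := even_poly p.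
have sE t : s.[t ^+ 2] = (p.[t] + p.[- t]) / 2.
  have E x : p.[x] = s.[x ^+ 2] + (odd_poly p).[x ^+ 2] * x.
    by rewrite -{1}(poly_even_odd p) !(hornerD, hornerM, horner_comp, hornerX, hornerXn).
  by rewrite !E sqrrN; field.
have [q [c qE]] := poly_dec s.
have cE : c = P m.
  have := sE 0; rewrite expr0n /= qE !(hornerD, hornerM, hornerX, hornerC) oppr0 V.
  by rewrite mulr0 add0r PNm => ->; field.
exists q, K, (Num.min d d'); split; first by rewrite lt_min d0.
move=> t; rewrite lt_min => /andP[td td'].
have ev : P (- m - t) = P (- m + t).
  rewrite -opprD /P wps_lat_even//; last first.
    move=> hmt; apply: (H' t td'); apply/(latDr (- m + t) (lat_2 m b)).
    by rewrite (_ : - m + t + (m + m) = m + t)//; ring.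
  rewrite -[RHS](wps_periodic h2 (H' t td') (lat_2 m b)); congr wps; ring.
have t2 : t ^+ 2 * q.[t ^+ 2] = (p.[t] + p.[- t]) / 2 - P m.
  by rewrite -sE qE !(hornerD, hornerM, hornerX, hornerC) cE; ring.
rewrite t2 (_ : _ - _ = ((P (- m + t) - p.[t]) + (P (- m + - t) - p.[- t])) / 2).
  have := H _ td; have := H (- t); rewrite !nmN => /(_ td) h3 h4.
  rewrite nmM nmV nm_nat ler_pdivrMr//; apply: le_trans (nmD _ _) _; lra.
by rewrite ev [t - m]addrC; field.
Qed.

(** [(wp z - wp m) (wp (z - m) - wp m)] is entire, because the double pole of
one factor meets the double zero of the other, and it is doubly periodic. *)
Lemma half_period_const m b : cross m b != 0 -> exists c : C, forall z, ~ lat m b z ->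
  (wps (lat (2 * m) b) z - wps (lat (2 * m) b) m) *
  (wps (lat (2 * m) b) (z - m) - wps (lat (2 * m) b) m) = c.
Proof.
move=> h; have h2 : cross (2 * m) b != 0 by rewrite cross2l.
have [q [K [d [d0 Hq]]]] := half_period_jet h.
set L := lat (2 * m) b in Hq *; set P := wps L in Hq *.
have hL : sparse L := sparse_lat h2.
have hm : ~ L m := lat2l_notin h.
have hNm : ~ L (- m) by move=> /latN_iff.
have PNm : P (- m) = P m by apply: wps_lat_even.
have L0 : L 0 := lat0 _ _.
(* The value [q.[0]] removes the singularities, all of which are congruent to [0]
modulo the half lattice. *)
pose H z := if `[<lat m b z>] then q.[0] else (P z - P m) * (P (z - m) - P m).
have Hout z : ~ lat m b z -> H z = (P z - P m) * (P (z - m) - P m).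
  by move=> hz; rewrite /H; case: asboolP.
have Hin z : lat m b z -> H z = q.[0].
  by move=> hz; rewrite /H; case: asboolP.
have PL x u : ~ L x -> L u -> P (x + u) = P x by exact: wps_periodic.
have per z u : lat m b u -> H (z + u) = H z.
  move=> hu; have [hz|hz] := pselect (lat m b z).
    by rewrite !Hin//; apply: latD.
  have hzu : ~ lat m b (z + u) by move/(latDr _ hu).
  rewrite !Hout//; have [z1 z2] := lat_even_half hz.
  have := hu; rewrite lat2l_split => -[hu1|hu1].
    by rewrite (PL z u)// (_ : z + u - m = z - m + u) ?(PL (z - m) u)//; ring.
  have e1 : P (z + u - m) = P z.
    by rewrite (_ : z + u - m = z + (u - m)) ?(PL z)//; ring.
  have e2 : P (z + u) = P (z - m).
    rewrite (_ : z + u = z - m + ((u - m) + (m + m))); last by ring.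
    by apply: PL => //; apply: latD hu1 (lat_2 _ _).
  by rewrite e1 e2; ring.
exists (H m) => z hz; rewrite -Hout//.
apply: (liouville_lat h _ per) => {hz}z.
have [hz|hz] := pselect (lat m b z); last first.
  have [z1 z2] := lat_even_half hz.
  have [d1 d10 H1] := sparse_near (sparse_lat h) hz.
  have J1 := jetD (jet_wps hL L0 z1) (jet_cst 6 (- P m) z).
  have J2 : jet 6 (fun x => P (x - m) - P m) z.
    have [p [K' [d' [d'0 H']]]] := jetD (jet_wps hL L0 z2) (jet_cst 6 (- P m) (z - m)).
    exists p, K', d'; split=> // t td; rewrite (_ : z + t - m = z - m + t); first exact: H'.
    by rewrite addrAC.
  apply: jet_near (jet_leq _ (jetM J1 J2)) => //; exists d1 => // t /H1 ht.
  by rewrite Hout.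
have [d1 d10 H1] : exists2 d : R, 0 < d & forall t, nm t < d -> t != 0 -> ~ lat m b t.
  have [[r r0 hr] _] := sparse_lat h; exists r => // t tr t0 ht.
  by have := hr t 0 ht (lat0 _ _) t0; rewrite subr0 leNgt tr.
pose G t := hsum (L `\ 0) (wpt t).
have JG : jet 6 G 0 by apply: jet_wpt => // -[_ /(_ erefl)].
have JW : jet 6 (fun t => P (t - m) - P m) 0.
  have [p [K' [d' [d'0 H']]]] := jetD (jet_wps hL L0 hNm) (jet_cst 6 (- P m) (- m)).
  exists p, K', d'; split=> // t td; rewrite add0r [t - m]addrC; exact: H'.
pose V t := if t == 0 then q.[0] else (P (t - m) - P m) / t ^+ 2.
have JV : jet 4 V 0.
  exists (q \Po 'X^2), K, d; split=> // t td; rewrite add0r /V horner_comp hornerXn.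
  have [->|t0] := eqVneq t 0.
    by rewrite expr2 mulr0 subrr nm0 exprS mul0r mulr0.
  have nt : 0 < nm t ^+ 2 by rewrite exprn_gt0// nm_gt0.
  rewrite -(ler_pM2r nt) -nmX -nmM nmX -mulrA -exprD (le_trans _ (Hq _ td))//.
  by rewrite mulrBl mulfVK ?expf_neq0// [q.[_] * _]mulrC.
have JH : jet 4 H 0.
  have J := jetD JV (jet_leq (isT : (4 <= 6)%N) (jetM (jetD JG (jet_cst 6 (- P m) 0)) JW)).
  apply: jet_near J; exists d1 => // t td; rewrite add0r /V.
  have [->|t0] := eqVneq t 0.
    by rewrite ?eqxx Hin ?sub0r; [rewrite PNm subrr mulr0 addr0|exact: lat0].
  rewrite Hout; last exact: H1.
  have -> : P t = 1 / t ^+ 2 + G t by [].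
  by ring.
have [p [K' [d' [d'0 H']]]] := JH; exists p, K', d'; split=> // t td.
by have := H' t td; rewrite add0r (addrC z) per.
Qed.

End HalfPeriods.

(** * The values at the half periods and the invariants *)

Section HalfValues.
Variable R : realType.
Local Notation C := R[i].
Implicit Types (a b m n t u v w z : C).

(** Lattices are parametrized by half periods, since it is the values there that matter. *)
Definition hlat m n : set C := lat (2 * m) (2 * n).
Definition hwp m n : C -> C := wps (hlat m n).

Lemma cross2r m n : (cross m (2 * n) != 0) = (cross m n != 0).
Proof. by rewrite crossC oppr_eq0 cross2l crossC oppr_eq0. Qed.

Lemma cross_hlat m n : cross m n != 0 -> cross (2 * m) (2 * n) != 0.
Proof. by rewrite cross2l cross2r. Qed.

Lemma cross_swap m n : cross m n != 0 -> cross n m != 0.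
Proof. by rewrite crossC oppr_eq0. Qed.

Lemma cross_add m n : cross m n != 0 -> cross (m + n) n != 0.
Proof. by move=> h; rewrite crossC crossD crossaa addr0 -crossC. Qed.

Lemma hlatC m n : hlat m n = hlat n m.
Proof. exact: latC. Qed.

Lemma hlat_add m n : hlat (m + n) n = hlat m n.
Proof. by rewrite /hlat mulrDr lat_addl. Qed.

Lemma hwpC m n : hwp m n = hwp n m.
Proof. by rewrite /hwp hlatC. Qed.

Lemma hwp_add m n : hwp (m + n) n = hwp m n.
Proof. by rewrite /hwp hlat_add. Qed.

Lemma hlat_m m n : cross m n != 0 -> ~ hlat m n m.
Proof. by move=> h; apply: lat2l_notin; rewrite cross2r. Qed.

Lemma hlat_n m n : cross m n != 0 -> ~ hlat m n n.
Proof. by move=> h; rewrite hlatC; apply: hlat_m; exact: cross_swap. Qed.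

Lemma hlat_mn m n : cross m n != 0 -> ~ hlat m n (m + n).
Proof. by move=> h; rewrite -hlat_add; apply: hlat_m; exact: cross_add. Qed.

Lemma hlat0 m n : hlat m n 0. Proof. exact: lat0. Qed.

Lemma hlat_2m m n : hlat m n (2 * m). Proof. exact: latl. Qed.

Lemma hlat_2n m n : hlat m n (2 * n). Proof. exact: latr. Qed.

Lemma hwp_per m n z u : cross m n != 0 -> ~ hlat m n z -> hlat m n u ->
  hwp m n (z + u) = hwp m n z.
Proof. by move=> h; apply: wps_periodic; exact: cross_hlat. Qed.

Lemma hwp_even m n z : cross m n != 0 -> ~ hlat m n z -> hwp m n (- z) = hwp m n z.
Proof. by move=> h; apply: wps_lat_even; exact: cross_hlat. Qed.

Lemma hwp_eq m n z w : cross m n != 0 -> ~ hlat m n w -> hlat m n (z - w) ->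
  hwp m n z = hwp m n w.
Proof. by move=> h hw hu; rewrite -(hwp_per h hw hu) addrC subrK. Qed.

Lemma hwp_eqN m n z w : cross m n != 0 -> ~ hlat m n w -> hlat m n (z + w) ->
  hwp m n z = hwp m n w.
Proof.
move=> h hw hu; rewrite -(hwp_even h hw); apply: hwp_eq => //; last by rewrite opprK.
by move/latN_iff.
Qed.

(** The constant of [half_period_const] is its value at [n]. *)
Lemma half_product m n z : cross m n != 0 -> ~ hlat m n z -> ~ hlat m n (z - m) ->
  (hwp m n z - hwp m n m) * (hwp m n (z - m) - hwp m n m) =
  (hwp m n n - hwp m n m) * (hwp m n (m + n) - hwp m n m).
Proof.
move=> h z1 z2; have h' : cross m (2 * n) != 0 by rewrite cross2r.
have [c H] := half_period_const h'.
have -> : hwp m n (m + n) = hwp m n (n - m).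
  apply: hwp_eq => //; last by rewrite (_ : _ - _ = 2 * m); [exact: hlat_2m|ring].
  move=> hn; apply: (hlat_mn h); rewrite (_ : m + n = n - m + 2 * m); last by ring.
  exact: latD hn (hlat_2m _ _).
have on w : ~ hlat m n w -> ~ hlat m n (w - m) -> ~ lat m (2 * n) w.
  by move=> w1 w2; rewrite lat2l_split => -[].
have nm2 : ~ hlat m n (n - m).
  move=> hn; apply: (hlat_mn h); rewrite (_ : m + n = n - m + 2 * m); last by ring.
  exact: latD hn (hlat_2m _ _).
rewrite /hwp /hlat H; last exact: on.
by rewrite H//; apply: on => //; exact: hlat_n.
Qed.

Lemma lat_hlat m n u : lat m n u <-> hlat m n (2 * u).
Proof.
have D (v : C) (k : int) : (2 * v) *~ k = 2 * (v *~ k) by rewrite mulrzAr.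
split=> -[i [j e]]; exists i, j; first by rewrite e !D; ring.
apply: (@mulfI _ 2); first by rewrite pnatr_eq0.
by rewrite e !D; ring.
Qed.

Lemma lat_cosets m n z : ~ lat m n z ->
  [/\ ~ hlat m n z, ~ hlat m n (z - m), ~ hlat m n (z - n) & ~ hlat m n (z - (m + n))].
Proof.
move=> hz; have S : hlat m n `<=` lat m n.
  by apply: sub_lat; rewrite mulr_natl mulr2n; apply: latD; (exact: latl || exact: latr).
have D v : lat m n v -> ~ hlat m n (z - v).
  by move=> hv /S hzv; apply: hz; rewrite -(subrK v z); apply: latD.
split; last by apply: D; apply: latD; [exact: latl|exact: latr].
- by move=> /S.
- by apply: D; exact: latl.
- by apply: D; exact: latr.
Qed.

(** Duplication in additive form: the function of the lattice scaled by one
half, split into the four cosets of the original lattice. *)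
Lemma hwp_dup m n z : cross m n != 0 -> ~ lat m n z ->
  4 * hwp m n (2 * z) = hwp m n z + (hwp m n (z - m) - hwp m n m)
    + (hwp m n (z - n) - hwp m n n) + (hwp m n (z - (m + n)) - hwp m n (m + n)).
Proof.
move=> h hz; have h1 : cross (2 * m) n != 0 by rewrite cross2l.
have S w : ~ lat (2 * m) n w -> wps (lat (2 * m) n) w = hwp m n w + hwp m n (w - n) - hwp m n n.
  move=> hw; rewrite latC in hw *.
  by rewrite (wps_halve (cross_swap h1) hw) /hwp /hlat latC.
have [z1 z2] := lat_even_half hz.
have -> : 4 * hwp m n (2 * z) = wps (lat m n) z.
  have e2 : (2^-1 : C) != 0 by rewrite invr_eq0 pnatr_eq0.
  have hz2 : ~ hlat m n (2 * z) by move=> h3; apply: hz; apply/lat_hlat.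
  have := wps_scale (sparse_lat (cross_hlat h)) (hlat0 m n) e2 hz2.
  rewrite invrK mulKf ?pnatr_eq0// (_ : [set u | _] = lat m n).
    move=> ->; rewrite /hwp exprVn invrK; congr (_ * _); ring.
  apply/seteqP; split => u; first by move=> hu; apply/lat_hlat.
  by move=> /(lat_hlat m n u).1.
rewrite (wps_halve h hz) !S//; last exact: lat2l_notin.
rewrite (_ : z - m - n = z - (m + n)); last by ring.
have -> : hwp m n (m - n) = hwp m n (m + n).
  apply: hwp_eq => //; first exact: hlat_mn.
  by rewrite (_ : _ - _ = - (2 * n)); [apply/latN_iff; exact: hlat_2n|ring].
by ring.
Qed.

(** At the quarter period [q = m / 2] the values at [q] and at [q - n] are fixed by the
two involutions of the product formula, so both are roots of
[(X - wp m) ^ 2 = c].  If they are opposite roots, the duplication formula at [q]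
gives the first alternative; if they are equal, it gives the second one. *)
Lemma quarter_value m n : cross m n != 0 ->
  hwp m n m + hwp m n n + hwp m n (m + n) = 0 \/
  16 * ((hwp m n n - hwp m n m) * (hwp m n (m + n) - hwp m n m))
    = (hwp m n m + hwp m n n + hwp m n (m + n)) ^+ 2.
Proof.
move=> h; set P := hwp m n; pose q := m / 2.
have mq : m = 2 * q by rewrite /q mulrC divfK// pnatr_eq0.
have hq : ~ lat m n q by move/lat_hlat; rewrite -mq; exact: hlat_m.
have [q0 qm qn qmn] := lat_cosets hq.
have E1 : P (q - m) = P q.
  by apply: hwp_eqN => //; rewrite mq (_ : _ + _ = 0); [exact: hlat0|ring].
have E2 : P (q - (m + n)) = P (q - n).
  apply: hwp_eqN => //; rewrite mq (_ : _ + _ = - (2 * n)); last by ring.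
  by apply/latN_iff; exact: hlat_2n.
have := hwp_dup h hq; rewrite -/P -mq E1 E2.
have := half_product h q0 qm; rewrite -/P E1.
have e3 : q - n - m = q - (m + n) by ring.
have qn' : ~ hlat m n (q - n - m) by rewrite e3.
have := half_product h qn qn'; rewrite -/P e3 E2.
set c := (P n - P m) * (P (m + n) - P m); set x := P q; set y := P (q - n) => hy hx hd.
have : (y - x) * (y + x - 2 * P m) = 0.
  transitivity ((y - P m) * (y - P m) - (x - P m) * (x - P m)); first by ring.
  by rewrite hx hy subrr.
move=> /eqP; rewrite mulf_eq0 => /orP[/eqP yx|/eqP yx]; [right|left].
  have {}yx : y = x by apply/eqP; rewrite -subr_eq0 yx.
  rewrite -hx; have -> : P m + P n + P (m + n) = 4 * (x - P m).
    by move: hd; rewrite yx => hd; transitivity (4 * x - 4 * P m); [rewrite hd; ring|ring].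
  by ring.
have {}yx : y = 2 * P m - x by apply/eqP; rewrite -subr_eq0 -yx; apply/eqP; ring.
have : 4 * P m = 4 * P m - (P m + P n + P (m + n)) by rewrite {1}hd yx; ring.
by move/eqP; rewrite -subr_eq0 opprB addrC subrK => /eqP.
Qed.

(** If the sum were nonzero, the second alternative of [quarter_value] would hold at each
of the three half periods; the three equations make two of the values coincide,
which makes the sum zero after all. *)
Lemma half_sum m n : cross m n != 0 -> hwp m n m + hwp m n n + hwp m n (m + n) = 0.
Proof.
move=> h; have h1 := cross_swap h; have h2 := cross_add h.
have := quarter_value h; have := quarter_value h1; have := quarter_value h2.
rewrite hwp_add (hwpC n m) (addrC n m).
have -> : hwp m n (m + n + n) = hwp m n m.
  apply: hwp_eq => //; first exact: hlat_m.
  by rewrite (_ : _ - _ = 2 * n); [exact: hlat_2n|ring].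
set x := hwp m n m; set y := hwp m n n; set w := hwp m n (m + n).
rewrite (_ : w + y + x = x + y + w); last by ring.
rewrite (_ : y + x + w = x + y + w); last by ring.
set s := x + y + w => -[//|h3] [//|h4] [//|h5].
have [//|s0] := eqVneq s 0.
have s2 : s ^+ 2 != 0 by rewrite expf_neq0.
have n16 : (16 : C) != 0 by rewrite pnatr_eq0.
have key (p q r : C) : 16 * ((q - p) * (r - p)) = s ^+ 2 -> 16 * ((p - q) * (r - q)) = s ^+ 2 ->
    2 * r = p + q.
  move=> e1 e2; have pq : q - p != 0.
    by apply: contraNneq s2 => e; rewrite -e1 e mul0r mulr0.
  apply/eqP; rewrite -subr_eq0; apply/eqP; apply: (mulfI n16); apply: (mulfI pq).
  rewrite !mulr0; transitivity (16 * ((q - p) * (r - p)) - 16 * ((p - q) * (r - q))).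
    by ring.
  by rewrite e1 e2 subrr.
have k1 := key x y w h5 h4.
have k2 := key y w x.
have e3 : 16 * ((w - y) * (x - y)) = s ^+ 2 by rewrite -h4; ring.
have e4 : 16 * ((y - w) * (x - w)) = s ^+ 2 by rewrite -h3; ring.
have {}k2 := k2 e3 e4.
have xw : 3 * (x - w) = 0.
  transitivity ((2 * x - (y + w)) - (2 * w - (x + y))); first by ring.
  by rewrite k1 k2 !subrr.
have {}xw : x - w = 0.
  by apply/eqP; move/eqP: xw; rewrite mulf_eq0 pnatr_eq0.
by case/eqP: s2; rewrite -e4 xw !mulr0.
Qed.

Lemma coef_zero (x y : C) (K d : R) : 0 < d ->
  (forall s : R, 0 < s -> s < d -> nm (s%:C * x + (s ^+ 2)%:C * y) <= K * s ^+ 3) ->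
  x = 0 /\ y = 0.
Proof.
move=> d0 H.
have lim (v : C) (M : R) : (forall s : R, 0 < s -> s < d -> nm v <= M * s) -> v = 0.
  move=> hv; apply: nm_small_eq => e e0; rewrite subr0.
  have M0 : 0 < `|M| + 1 by rewrite ltr_wpDl.
  pose s := Num.min (d / 2) (e / (`|M| + 1)).
  have s0 : 0 < s by rewrite lt_min !divr_gt0.
  have sd : s < d by rewrite gt_min (_ : d / 2 < d)//; lra.
  apply: le_trans (hv s s0 sd) _.
  have : s <= e / (`|M| + 1) by rewrite ge_min lexx orbT.
  rewrite ler_pdivlMr// => h; apply: le_trans h; rewrite mulrC ler_pM2l//.
  by have := ler_norm M; lra.
pose d' := Num.min d 1.
have x0 : x = 0.
  apply: (lim x (`|K| * d ^+ 1 + nm y)) => s s0 sd.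
  have := H s s0 sd; set a := s%:C * x; set b := (s ^+ 2)%:C * y => h.
  have h1 := nmD (a + b) (- b); rewrite addrK nmN in h1.
  have na : nm a = s * nm x by rewrite nmM nm_real gtr0_norm.
  have nb : nm b = s ^+ 2 * nm y by rewrite nmM nm_real ger0_norm// sqr_ge0.
  rewrite -(ler_pM2l s0) -na (le_trans h1)// nb.
  rewrite (_ : s * _ = `|K| * d * s ^+ 2 + s ^+ 2 * nm y); last by rewrite expr1; ring.
  rewrite lerD2r (le_trans h)// (le_trans (ler_norm _))// normrM (ger0_norm (_ : 0 <= s ^+ 3)); last first.
    by rewrite exprn_ge0// ltW.
  by rewrite -mulrA ler_wpM2l// exprS ler_wpM2r ?sqr_ge0// ltW.
split=> //; apply: (lim y K) => s s0 sd.
have := H s s0 sd; rewrite x0 mulr0 add0r nmM nm_real ger0_norm ?sqr_ge0//.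
rewrite (_ : K * s ^+ 3 = s ^+ 2 * (K * s)); last by ring.
by rewrite ler_pM2l ?exprn_gt0.
Qed.

(** Writing [wp (z - p) - wp p] as [c / (wp z - wp p)] turns the duplication formula into
an identity in [wp z] and [wp (2 z)].  In its expansion at the origin the poles
cancel, and the coefficients of [z ^ 2] and [z ^ 4] are the two claims. *)
Lemma half_invariants m n (a4 a6 : C) : cross m n != 0 ->
  has_sum (hlat m n `\ 0) (fun u => u ^- 4) a4 ->
  has_sum (hlat m n `\ 0) (fun u => u ^- 6) a6 ->
  let x := hwp m n m in let y := hwp m n n in let w := hwp m n (m + n) in
  60 * a4 = - 4 * (x * y + y * w + w * x) /\ 140 * a6 = 4 * (x * y * w).
Proof.
move=> h ha4 ha6 x y w.
have hL : sparse (hlat m n) := sparse_lat (cross_hlat h).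
have [b4 [b6 [/(has_sum_uniq ha4) <- /(has_sum_uniq ha6) <- [K [d [d0 HK]]]]]] :=
  wps_expansion0 hL (hlat0 m n) (@latN _ _ _).
pose g1 (p q r : C) := (q - p) * (r - p).
pose al := g1 x y w + g1 y x w + g1 w x y.
pose be := g1 x y w * x + g1 y x w * y + g1 w x y * w.
suff [e1 e2] : 45 * a4 - al = 0 /\ 315 * a6 - be = 0.
  have s0 : w = - (x + y).
    by apply/eqP; rewrite -subr_eq0 opprK addrC; apply/eqP; exact: half_sum.
  have n3 : (3 : C) != 0 by rewrite pnatr_eq0.
  have n9 : (9 : C) != 0 by rewrite pnatr_eq0.
  split; [apply: (mulfI n3)|apply: (mulfI n9)]; apply/eqP; rewrite -subr_eq0; apply/eqP.
    transitivity (4 * (45 * a4 - al)); last by rewrite e1 mulr0.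
    by rewrite /al /g1 s0; ring.
  transitivity (4 * (315 * a6 - be)); last by rewrite e2 mulr0.
  by rewrite /be /g1 s0; ring.
have [d1 d10 H1] : exists2 d : R, 0 < d & forall t, nm t < d -> t != 0 -> ~ lat m n t.
  have [[r r0 hr] _] := sparse_lat h; exists r => // t tr t0 ht.
  by have := hr t 0 ht (lat0 _ _) t0; rewrite subr0 leNgt tr.
(* As [wp t = t ^ (-2) + O (t ^ 2)], the quotient [c / (wp t - p)] begins with
[c t ^ 2 + c p t ^ 4]. *)
have inv_exp (c p : C) : exists2 K' : R, 0 <= K' & exists2 d' : R, 0 < d' &
    forall t, nm t < d' -> t != 0 -> hwp m n t != p /\
    nm (c / (hwp m n t - p) - (c * t ^+ 2 + c * p * t ^+ 4)) <= K' * nm t ^+ 6.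
  pose G t := hwp m n t - 1 / t ^+ 2.
  pose KG := 3 * nm a4 + 5 * nm a6 + `|K|.
  have KG0 : 0 <= KG by rewrite !addr_ge0 ?mulr_ge0 ?nm_ge0.
  have HG t : nm t < d -> nm t <= 1 -> nm (G t) <= KG * nm t ^+ 2.
    move=> td t1; have := HK t td; rewrite -/(hwp m n) => hk.
    have -> : G t = (hwp m n t - (1 / t ^+ 2 + 3 * a4 * t ^+ 2 + 5 * a6 * t ^+ 4))
       + (3 * a4 * t ^+ 2 + 5 * a6 * t ^+ 4) by rewrite /G; ring.
    have p4 : nm t ^+ 4 <= nm t ^+ 2 by apply: ler_wiXn2l => //; exact: nm_ge0.
    have p6 : nm t ^+ 6 <= nm t ^+ 2 by apply: ler_wiXn2l => //; exact: nm_ge0.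
    have k6 : K * nm t ^+ 6 <= `|K| * nm t ^+ 2.
      by rewrite (le_trans (ler_wpM2r _ (ler_norm K))) ?exprn_ge0 ?nm_ge0// ler_wpM2l.
    have n6 : 5 * nm a6 * nm t ^+ 4 <= 5 * nm a6 * nm t ^+ 2.
      by rewrite ler_wpM2l// mulr_ge0// nm_ge0.
    apply: le_trans (nmD _ _) _; rewrite /KG.
    have s4 : nm (3 * a4 * t ^+ 2) = 3 * nm a4 * nm t ^+ 2 by rewrite nmM nmX nmM nm_nat.
    have s6 : nm (5 * a6 * t ^+ 4) = 5 * nm a6 * nm t ^+ 4 by rewrite nmM nmX nmM nm_nat.
    have := nmD (3 * a4 * t ^+ 2) (5 * a6 * t ^+ 4); lra.
  pose N := KG + nm p + 1.
  have N1 : 1 <= N by rewrite /N; have := nm_ge0 p; lra.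
  exists (2 * nm c * (KG + nm p * N)).
    by rewrite !mulr_ge0 ?addr_ge0 ?mulr_ge0 ?nm_ge0//; lra.
  exists (Num.min d (1 / (2 * N))).
    by rewrite lt_min d0 divr_gt0// mulr_gt0//; lra.
  move=> t; rewrite lt_min => /andP[td tN] t0.
  have tN' : nm t * (2 * N) < 1 by rewrite -ltr_pdivlMr//; lra.
  have nt0 : 0 < nm t by rewrite nm_gt0.
  have t1 : nm t <= 1 by nra.
  have hG := HG t td t1; have hG' : nm (G t - p) <= N.
    apply: le_trans (nmB _ _) _; rewrite /N; have : nm t ^+ 2 <= 1 by rewrite exprn_ile1 ?nm_ge0.
    move=> ?; have : KG * nm t ^+ 2 <= KG * 1 by rewrite ler_wpM2l.
    lra.
  pose D := 1 + t ^+ 2 * (G t - p).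
  have hD : 1 / 2 <= nm D.
    have h1 : nm (t ^+ 2 * (G t - p)) <= 1 / 2.
      rewrite nmM nmX; apply: (@le_trans _ _ (nm t ^+ 2 * N)).
        by rewrite ler_wpM2l// exprn_ge0// ltW.
      by rewrite expr2; nra.
    have := nm_sub 1 (- (t ^+ 2 * (G t - p))); rewrite opprK nm1 nmN; rewrite -/D; lra.
  have D0 : D != 0 by rewrite -nm_gt0; lra.
  have PE : hwp m n t - p = D / t ^+ 2.
    by rewrite /D /G; field.
  split; first by rewrite -subr_eq0 PE mulf_neq0// invr_eq0 expf_neq0.
  have -> : c / (hwp m n t - p) - (c * t ^+ 2 + c * p * t ^+ 4) =
      - (c * t ^+ 4 * (G t + t ^+ 2 * (p * (G t - p)))) / D.
    by rewrite PE; rewrite /D in D0 *; field; rewrite t0 D0.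
  rewrite nmM nmN nmV ler_pdivrMr; last by lra.
  rewrite nmM (nmM c) nmX.
  have hs : nm (G t + t ^+ 2 * (p * (G t - p))) <= (KG + nm p * N) * nm t ^+ 2.
    apply: le_trans (nmD _ _) _; rewrite mulrDl lerD// nmM nmX nmM mulrC.
    by rewrite ler_wpM2r ?exprn_ge0 ?(ltW nt0)// ler_wpM2l ?nm_ge0.
  apply: (@le_trans _ _ (nm c * nm t ^+ 4 * ((KG + nm p * N) * nm t ^+ 2))).
    by rewrite ler_wpM2l// mulr_ge0 ?exprn_ge0 ?nm_ge0.
  set Q := KG + nm p * N.
  have Q0 : 0 <= Q by rewrite addr_ge0// mulr_ge0 ?nm_ge0//; lra.
  rewrite (_ : _ * (Q * _) = nm c * Q * nm t ^+ 6); last by ring.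
  rewrite (_ : 2 * nm c * Q * nm t ^+ 6 * nm D = nm c * Q * nm t ^+ 6 * (2 * nm D)); last by ring.
  rewrite ler_peMr//; last lra.
  by rewrite !mulr_ge0 ?nm_ge0 ?exprn_ge0 ?nm_ge0.
have [K1 K10 [e1 e10 I1]] := inv_exp (g1 x y w) x.
have [K2 K20 [e2 e20 I2]] := inv_exp (g1 y x w) y.
have [K3 K30 [e3 e30 I3]] := inv_exp (g1 w x y) w.
pose dd := Num.min (Num.min (d / 2) d1) (Num.min e1 (Num.min e2 e3)).
have dd0 : 0 < dd by rewrite !lt_min divr_gt0// d10 e10 e20 e30.
pose KK := 4 * `|K| * 64 + `|K| + K1 + K2 + K3.
(* Only even powers of [t] occur, so it suffices to let [t] be a positive real, with
square [s]. *)
apply: (@coef_zero _ _ KK (Num.min (dd ^+ 2) 1)); first by rewrite lt_min exprn_gt0// ltr01.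
move=> s s0; rewrite lt_min => /andP[sd s1].
pose r := Num.sqrt s; pose t : C := r%:C.
have r0 : 0 < r by rewrite sqrtr_gt0.
have r2 : r ^+ 2 = s by rewrite sqr_sqrtr// ltW.
have nt : nm t = r by rewrite nm_real gtr0_norm.
have rdd : r < dd by rewrite -(ltr_pXn2r (ltn0Sn 1)) ?nnegrE ?ltW// r2.
have t0 : t != 0 by rewrite -nm_gt0 nt.
move: (rdd); rewrite /dd !lt_min => /andP[/andP[rd rd1] /and3P[re1 re2 re3]].
have tl : ~ lat m n t by apply: H1; rewrite ?nt.
have [z1 z2 z3 z4] := lat_cosets tl.
have [|n1 B1] := I1 t _ t0; first by rewrite nt.
have [|n2 B2] := I2 t _ t0; first by rewrite nt.
have [|n3 B3] := I3 t _ t0; first by rewrite nt.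
have P1 : hwp m n (t - m) - x = g1 x y w / (hwp m n t - x).
  have := half_product h z1 z2; rewrite -/x -/y -/w => e.
  by rewrite /g1 -e mulrAC divff ?mul1r// subr_eq0.
have P2 : hwp m n (t - n) - y = g1 y x w / (hwp m n t - y).
  have := @half_product n m t (cross_swap h); rewrite -(hlatC m n) -(hwpC m n) (addrC n m).
  move=> /(_ z1 z3); rewrite -/x -/y -/w => e.
  by rewrite /g1 -e mulrAC divff ?mul1r// subr_eq0.
have P3 : hwp m n (t - (m + n)) - w = g1 w x y / (hwp m n t - w).
  have := @half_product (m + n) n t (cross_add h); rewrite hlat_add hwp_add.
  have -> : hwp m n (m + n + n) = x.
    apply: hwp_eq => //; first exact: hlat_m.
    by rewrite (_ : _ - _ = 2 * n); [exact: hlat_2n|ring].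
  move=> /(_ z1 z4); rewrite -/y -/w => e.
  by rewrite /g1 (mulrC (x - w)) -e mulrAC divff ?mul1r// subr_eq0.
have := hwp_dup h tl; rewrite -/x -/y -/w P1 P2 P3 => dup.
have n2t : nm (2 * t) = 2 * r by rewrite nmM nm_nat nt.
have td : nm t < d by rewrite nt; lra.
have t2d : nm (2 * t) < d by rewrite n2t; lra.
have A1 := HK t td; have A2 := HK (2 * t) t2d.
rewrite -/(hwp m n) nt in A1; rewrite -/(hwp m n) n2t in A2.
move: A1 A2 B1 B2 B3; rewrite nt.
set E1 := _ - (1 / t ^+ 2 + _ + _); set E2 := _ - (1 / (2 * t) ^+ 2 + _ + _).
set F1 := _ - (g1 x y w * _ + _); set F2 := _ - (g1 y x w * _ + _).
set F3 := _ - (g1 w x y * _ + _) => A1 A2 B1 B2 B3.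
have -> : s%:C * (45 * a4 - al) + (s ^+ 2)%:C * (315 * a6 - be) =
    E1 + F1 + F2 + F3 - 4 * E2.
  have -> : s%:C = t ^+ 2 by rewrite /t -rmorphXn r2.
  have -> : (s ^+ 2)%:C = t ^+ 4 by rewrite -r2 -exprM /t -rmorphXn.
  rewrite /E2 [4 * (_ - _)]mulrBr dup /E1 /F1 /F2 /F3 /al /be.
  set q1 := g1 x y w / _; set q2 := g1 y x w / _; set q3 := g1 w x y / _.
  by field; rewrite ?t0.
have s3 : r ^+ 6 = s ^+ 3 by rewrite -r2 -exprM.
have s3' : (2 * r) ^+ 6 = 64 * s ^+ 3 by rewrite exprMn s3; congr (_ * _); ring.
rewrite s3 in A1 B1 B2 B3; rewrite s3' in A2.
have s30 : 0 <= s ^+ 3 by rewrite exprn_ge0// ltW.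
have Kle : K * s ^+ 3 <= `|K| * s ^+ 3 by rewrite ler_wpM2r// ler_norm.
apply: le_trans (nmB _ _) _; rewrite nmM nm_nat.
have := nmD (E1 + F1 + F2) F3; have := nmD (E1 + F1) F2; have := nmD E1 F1.
rewrite /KK; lra.
Qed.

End HalfValues.

(** * The complex sine *)

Section ComplexSine.
Variable R : realType.
Local Notation C := R[i].
Implicit Types (z w h : C).

(** Integrating a bound on the derivative. *)
Lemma mvt_bound (f f' : R -> R) (K : R) (n : nat) :
  (forall x : R, is_derive x 1 f (f' x)) -> f 0 = 0 ->
  (forall x, `|x| <= 1 -> `|f' x| <= K * `|x| ^+ n) ->
  forall x, `|x| <= 1 -> `|f x| <= K * `|x| ^+ n.+1.
Proof.
move=> hd f0 hf x x1.
have cf (a b : R) : {within `[a, b], continuous f}.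
  apply: continuous_subspaceT => y; apply: differentiable_continuous.
  by apply/derivable1_diffP; apply: ex_derive.
have main c : `|c| <= `|x| -> `|f x| = `|f' c * x| -> `|f x| <= K * `|x| ^+ n.+1.
  move=> cx ->; rewrite normrM exprSr mulrA ler_wpM2r//.
  have K0 : 0 <= K by have := hf 1; rewrite normr1 expr1n mulr1 => /(_ (lexx _)); apply: le_trans.
  apply: le_trans (hf c (le_trans cx x1)) _; rewrite ler_wpM2l//.
  by apply: lerXn2r; rewrite ?nnegrE.
have [x0|x0] := leP 0 x.
  have [c + e] := @MVT_segment R f f' 0 x x0 (fun y _ => hd y) (cf 0 x).
  rewrite in_itv /= => /andP[c0 cx].
  apply: (main c); first by rewrite !ger0_norm.
  by move: e; rewrite f0 !subr0 => ->.
have [c + e] := @MVT_segment R f f' x 0 (ltW x0) (fun y _ => hd y) (cf x 0).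
rewrite in_itv /= => /andP[cx c0].
apply: (main c); first by rewrite !ler0_norm ?lerN2 ?(ltW x0).
by move: e; rewrite f0 !sub0r => e; rewrite -normrN e mulrN normrN.
Qed.

Lemma sin_bound1 (x : R) : `|x| <= 1 -> `|sin x| <= `|x|.
Proof.
move=> x1; have := @mvt_bound sin cos 1 0 (fun x => is_derive_sin x) (sin0 _) _ x x1.
rewrite mul1r expr1; apply => y _.
by rewrite expr0 mulr1 cos_max.
Qed.

Lemma cos_bound2 (x : R) : `|x| <= 1 -> `|cos x - 1| <= `|x| ^+ 2.
Proof.
move=> x1; have := @mvt_bound (fun x => cos x - 1) (fun x => - sin x) 1 1 _ _ _ x x1.
rewrite mul1r; apply.
- move=> y; rewrite -[- sin y]subr0.
  exact: (is_deriveB (is_derive_cos y) (is_derive_cst (1 : R^o) y 1)).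
- by rewrite cos0 subrr.
- by move=> y y1; rewrite normrN mul1r expr1 sin_bound1.
Qed.

Lemma sin_bound3 (x : R) : `|x| <= 1 -> `|sin x - x| <= `|x| ^+ 3.
Proof.
move=> x1; have := @mvt_bound (fun x => sin x - x) (fun x => cos x - 1) 1 2 _ _ _ x x1.
rewrite mul1r; apply.
- by rewrite sin0 subrr.
- by move=> y y1; rewrite mul1r cos_bound2.
Qed.

Lemma cos_bound3 (x : R) : `|x| <= 1 -> `|cos x - 1 + x ^+ 2 / 2| <= `|x| ^+ 3.
Proof.
move=> x1.
have := @mvt_bound (fun x => cos x - 1 + x ^+ 2 / 2) (fun x => - (sin x - x)) 1 2 _ _ _ x x1.
rewrite mul1r; apply.
- move=> y; have h := is_deriveD (is_deriveB (is_derive_cos y) (is_derive_cst (1 : R^o) y 1))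
    (is_deriveZ (2^-1 : R) (is_deriveX 2 (is_derive_id (y : R^o) 1))).
  have e : (cos \- cst 1 + 2^-1 \*: (id : R -> R^o) ^+ 2 : R -> R^o) = (fun x => cos x - 1 + x ^+ 2 / 2).
    by apply/funext => v; rewrite /= mulrC.
  rewrite -e; refine (eq_ind _ (fun d => is_derive _ _ _ d) h _ _).
  by rewrite subr0 /= expr1 /GRing.scale /=; field.
- by rewrite cos0 subrr expr0n /= mul0r addr0.
- move=> y y1; rewrite normrN mul1r; apply: le_trans (sin_bound3 y1) _.
  by apply: ler_wiXn2l.
Qed.

Lemma exp_bound3 : exists2 K : R, 0 <= K & forall x : R, `|x| <= 1 ->
  `|expR x - 1| <= K * `|x| /\ `|expR x - 1 - x - x ^+ 2 / 2| <= K * `|x| ^+ 3.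
Proof.
exists (expR 1); first exact: expR_ge0.
have E0 (x : R) : `|x| <= 1 -> `|expR x| <= expR 1 * `|x| ^+ 0.
  by rewrite ler_norml => /andP[_ x1]; rewrite expr0 mulr1 ger0_norm ?expR_ge0// ler_expR.
have E1 : forall x : R, `|x| <= 1 -> `|expR x - 1| <= expR 1 * `|x| ^+ 1.
  apply: (@mvt_bound (fun x => expR x - 1) expR _ 0) => //; last by rewrite expR0 subrr.
  move=> y; rewrite -[X in is_derive _ _ _ X]subr0.
  exact: (is_deriveB (is_derive_expR y) (is_derive_cst (1 : R^o) y 1)).
have E2 : forall x : R, `|x| <= 1 -> `|expR x - 1 - x| <= expR 1 * `|x| ^+ 2.
  apply: (@mvt_bound (fun x => expR x - 1 - x) (fun x => expR x - 1)) => //; last first.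
    by rewrite expR0 subrr subr0.
  move=> y; rewrite -[X in X - 1]subr0.
  exact: (is_deriveB (is_deriveB (is_derive_expR y) (is_derive_cst (1 : R^o) y 1)) (is_derive_id (y : R^o) 1)).
move=> x x1; split; first by have := E1 x x1; rewrite expr1.
apply: (@mvt_bound (fun x => expR x - 1 - x - x ^+ 2 / 2) (fun x => expR x - 1 - x)) => // [y|].
  have h := is_deriveB (is_deriveB (is_deriveB (is_derive_expR y) (is_derive_cst (1 : R^o) y 1)) (is_derive_id (y : R^o) 1))
    (is_deriveZ (2^-1 : R) (is_deriveX 2 (is_derive_id (y : R^o) 1))).
  have e : (expR \- cst 1 \- id \- 2^-1 \*: (id : R -> R^o) ^+ 2 : R -> R^o) = (fun x => expR x - 1 - x - x ^+ 2 / 2).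
    by apply/funext => v; rewrite /= mulrC.
  rewrite -e; refine (eq_ind _ (fun d => is_derive _ _ _ d) h _ _).
  by rewrite subr0 /= expr1 /GRing.scale /=; field.
by rewrite expR0 subrr expr0n /= mul0r !subr0.
Qed.
Lemma cexpD z w : cexp (z + w) = cexp z * cexp w.
Proof.
case: z w => [a b] [c d]; rewrite /cexp /= expRD cosD sinD.
by apply/eqP; rewrite eq_complex /=; apply/andP; split; apply/eqP; ring.
Qed.

Lemma cexp0 : cexp (0 : C) = 1.
Proof. by apply/eqP; rewrite /cexp /= expR0 cos0 sin0 eq_complex /= !mul0r !mul1r subr0 addr0 !eqxx. Qed.

Lemma cexpNM z : cexp z * cexp (- z) = 1.
Proof. by rewrite -cexpD subrr cexp0. Qed.

Lemma cexp_neq0 z : cexp z != 0.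
Proof. by apply/eqP => e; have /eqP := cexpNM z; rewrite e mul0r eq_sym oner_eq0. Qed.

Lemma cexpN z : cexp (- z) = (cexp z)^-1.
Proof. by apply: (mulfI (cexp_neq0 z)); rewrite cexpNM mulfV// cexp_neq0. Qed.

Lemma i_neq0 : 'i%C != 0 :> C.
Proof. by rewrite eq_complex /= negb_and oner_eq0 orbT. Qed.

Lemma sqr_iC : 'i%C * 'i%C = -1 :> C.
Proof. by rewrite -expr2 sqr_i. Qed.

Lemma cexp_ihalfpi : cexp ('i%C * (pi / 2)%:C) = 'i%C :> C.
Proof.
rewrite /cexp /= !mul0r !mul1r ?mulr0 subr0 ?add0r ?addr0 expR0 cos_pihalf sin_pihalf.
by apply/eqP; rewrite eq_complex /= !mul0r mulr0 mul1r subr0 addr0 !eqxx.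
Qed.

Lemma csin_shift w : csin (w + pi%:C) = - csin w.
Proof.
have e : cexp ('i%C * pi%:C) = -1 :> C.
  have -> : 'i%C * pi%:C = 'i%C * (pi / 2)%:C + 'i%C * (pi / 2)%:C :> C.
    by rewrite -mulrDr -rmorphD -splitr.
  by rewrite cexpD cexp_ihalfpi sqr_iC.
rewrite /csin mulrDr opprD !cexpD !cexpN e.
by rewrite invrN1; ring.
Qed.

Lemma csin2 w : csin (2 * w) = 2 * (csin w * csin (w + (pi / 2)%:C)).
Proof.
have i2 := sqr_iC.
have iV : ('i%C)^-1 = - 'i%C :> C.
  by apply: (mulfI i_neq0); rewrite mulfV ?i_neq0// mulrN sqr_iC opprK.
have n2 : (2 : C) != 0 by rewrite pnatr_eq0.
rewrite /csin invfM iV [_ * (w + _)]mulrDr opprD !cexpD !cexpN cexp_ihalfpi iV.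
have -> : 'i%C * (2 * w) = 'i%C * w + 'i%C * w by ring.
rewrite cexpD; set E := cexp _; have E0 : E != 0 := cexp_neq0 _.
have -> : (E * E - (E * E)^-1) * (2^-1 * - 'i%C) =
   - ('i%C * 'i%C) * (E * E - (E * E)^-1) * (2^-1 * - 'i%C) by rewrite i2; ring.
by field; rewrite E0.
Qed.

Lemma csinE (x y : R) : csin (x +i* y) =
  ((expR y + expR (- y)) / 2 * sin x) +i* ((expR y - expR (- y)) / 2 * cos x).
Proof.
rewrite /csin; have -> : 'i%C * (x +i* y) = (- y) +i* x.
  by apply/eqP; rewrite eq_complex /= !mul0r !mul1r sub0r add0r !eqxx.
have -> : - ((- y) +i* x) = y +i* (- x) :> C.
  by apply/eqP; rewrite eq_complex /= opprK !eqxx.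
apply: (mulIf (_ : 2 * 'i%C != 0)).
  by rewrite mulf_neq0 ?i_neq0// pnatr_eq0.
rewrite divfK; last by rewrite mulf_neq0 ?i_neq0// pnatr_eq0.
rewrite /cexp /= cosN sinN mulr_natl.
by apply/eqP; rewrite eq_complex /=; apply/andP; split; apply/eqP; field.
Qed.

Lemma nm_csin (x y : R) : nm (csin (x +i* y)) ^+ 2 =
  sin x ^+ 2 + ((expR y - expR (- y)) / 2) ^+ 2.
Proof.
rewrite csinE sqr_nm /=.
have e : expR y * expR (- y) = 1 by rewrite -expRD subrr expR0.
have c := cos2Dsin2 x.
transitivity (expR y * expR (- y) * sin x ^+ 2 + ((expR y - expR (- y)) / 2) ^+ 2 * (cos x ^+ 2 + sin x ^+ 2)).
  by field.
by rewrite e c mul1r mulr1.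
Qed.

(** Real and imaginary parts are expanded from the real functions. *)
Lemma cexp_taylor : exists2 K : R, 0 <= K & forall w : C, nm w <= 1 ->
  nm (cexp w - (1 + w + w ^+ 2 / 2)) <= K * nm w ^+ 3.
Proof.
have [K K0 HK] := exp_bound3.
exists (12 * K + 20); first by rewrite addr_ge0 ?mulr_ge0.
case=> x y; set r := nm _ => r1.
have hx : `|x| <= r := normr_Re_nm (x +i* y).
have hy : `|y| <= r := normr_Im_nm (x +i* y).
have r0 : 0 <= r := nm_ge0 _.
have [_ ha] := HK x (le_trans hx r1).
have hb := cos_bound3 (le_trans hy r1); have hc := sin_bound3 (le_trans hy r1).
set a := expR x - 1 - x - x ^+ 2 / 2 in ha.
set b := cos y - 1 + y ^+ 2 / 2 in hb; set c := sin y - y in hc.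
have r30 : 0 <= r ^+ 3 by rewrite exprn_ge0.
have cube (v : R) : `|v| <= r -> `|v| ^+ 3 <= r ^+ 3.
  by move=> hv; apply: lerXn2r; rewrite ?nnegrE.
have {}ha : `|a| <= K * r ^+ 3 by rewrite (le_trans ha)// ler_wpM2l// cube.
have {}hb : `|b| <= r ^+ 3 by rewrite (le_trans hb)// cube.
have {}hc : `|c| <= r ^+ 3 by rewrite (le_trans hc)// cube.
have ca : `|cos y| <= 1 := cos_max _; have sa : `|sin y| <= 1 := sin_max _.
have re : complex.Re (cexp (x +i* y) - (1 + (x +i* y) + (x +i* y) ^+ 2 / 2)) =
   a * cos y + (1 + x + x ^+ 2 / 2) * b - (x * (y * y) / 2 + x * x * (y * y) / 4).
  by rewrite -[2^-1]/(2%:R^-1) -(rmorph_nat (real_complex R)) -fmorphV /cexp /= /a /b; field.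
have im : complex.Im (cexp (x +i* y) - (1 + (x +i* y) + (x +i* y) ^+ 2 / 2)) =
   a * sin y + (1 + x + x ^+ 2 / 2) * c + x * x * y / 2.
  by rewrite -[2^-1]/(2%:R^-1) -(rmorph_nat (real_complex R)) -fmorphV /cexp /= /a /c; field.
have p3 (u v w : R) : `|u| <= r -> `|v| <= r -> `|w| <= r -> `|u * v * w| <= r ^+ 3.
  move=> hu hv hw; rewrite !normrM (_ : r ^+ 3 = r * r * r); last by ring.
  by rewrite !ler_pM// mulr_ge0.
have m1 : `|1 + x + x ^+ 2 / 2| <= 3.
  have x1 := le_trans hx r1; have := ler_normD (1 + x) (x ^+ 2 / 2).
  have := ler_normD 1 x; rewrite normr1 normrM normrX (ger0_norm (_ : 0 <= 2^-1))//.
  have : `|x| ^+ 2 <= 1 by rewrite exprn_ile1.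
  lra.
have m2 (u : R) : `|u| <= r ^+ 3 -> `|(1 + x + x ^+ 2 / 2) * u| <= 3 * r ^+ 3.
  by move=> hu; rewrite normrM ler_pM.
have m3 (u : R) : `|u| <= 1 -> `|a * u| <= K * r ^+ 3.
  by move=> hu; rewrite normrM -[leRHS]mulr1 ler_pM.
have m4 : `|x * (y * y)| <= r ^+ 3 by rewrite mulrA p3.
have m5 : `|x * x * (y * y)| <= r ^+ 3.
  rewrite mulrA normrM -[leRHS]mulr1 ler_pM// ?p3//; exact: le_trans hy r1.
have m6 := p3 x x y hx hx hy.
apply: le_trans (nm_le_ReIm _) _; rewrite re im.
have := m2 b hb; have := m2 c hc; have := m3 _ ca; have := m3 _ sa.
move: m4 m5 m6; rewrite !ler_norml => /andP[? ?] /andP[? ?] /andP[? ?] /andP[? ?] /andP[? ?] /andP[? ?] /andP[? ?].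
have [q1 q2] : `|a * cos y + (1 + x + x ^+ 2 / 2) * b - (x * (y * y) / 2 + x * x * (y * y) / 4)| <= (K + 5) * r ^+ 3
   /\ `|a * sin y + (1 + x + x ^+ 2 / 2) * c + x * x * y / 2| <= (K + 5) * r ^+ 3.
  by split; rewrite ler_norml; apply/andP; split; lra.
have Kr : 0 <= K * r ^+ 3 by rewrite mulr_ge0.
lra.
Qed.

Lemma cexp_lip : exists2 K : R, 0 <= K & forall w : C, nm w <= 1 ->
  nm (cexp w - 1) <= K * nm w.
Proof.
have [K K0 HK] := cexp_taylor; exists (2 + K); first by rewrite addr_ge0.
move=> w w1; have h := HK w w1.
rewrite (_ : cexp w - 1 = (cexp w - (1 + w + w ^+ 2 / 2)) + (w + w ^+ 2 / 2)); last by ring.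
apply: le_trans (nmD _ _) _.
have h2 := nmD w (w ^+ 2 / 2); have w0 := nm_ge0 w.
have e : nm (w ^+ 2 / 2) = nm w * nm w / 2 by rewrite nmM nmV nm_nat nmX expr2.
have : nm w ^+ 3 <= nm w.
  by rewrite -[leRHS]expr1 ler_wiXn2l.
move=> h3; have : K * nm w ^+ 3 <= K * nm w by rewrite ler_wpM2l.
have : nm w * nm w <= nm w by rewrite ler_piMr.
lra.
Qed.

Lemma csin_taylor : exists2 K : R, 0 <= K & forall w : C, nm w <= 1 ->
  nm (csin w - w) <= K * nm w ^+ 3.
Proof.
have [K K0 HK] := cexp_taylor; exists K => // w w1.
have n1 : nm ('i%C * w) = nm w by rewrite nmM nm_i mul1r.
have n2 : nm (- ('i%C * w)) = nm w by rewrite nmN.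
have := HK ('i%C * w); have := HK (- ('i%C * w)); rewrite n1 n2 => /(_ w1) h1 /(_ w1) h2.
have i0 := i_neq0.
have -> : csin w - w = ((cexp ('i%C * w) - (1 + 'i%C * w + ('i%C * w) ^+ 2 / 2))
  - (cexp (- ('i%C * w)) - (1 + - ('i%C * w) + (- ('i%C * w)) ^+ 2 / 2))) / (2 * 'i%C).
  by rewrite /csin; field.
rewrite nmM nmV nmM nm_nat nm_i mulr1 ler_pdivrMr//.
apply: le_trans (nmB _ _) _; lra.
Qed.

Lemma csin_lip w : exists2 K : R, 0 <= K & forall h : C, nm h <= 1 ->
  nm (csin (w + h) - csin w) <= K * nm h.
Proof.
have [K K0 HK] := cexp_lip.
pose A := cexp ('i%C * w); pose B := cexp (- ('i%C * w)).
exists ((nm A + nm B) * K); first by rewrite mulr_ge0// addr_ge0 ?nm_ge0.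
move=> h h1; have i0 := i_neq0.
have n1 : nm ('i%C * h) = nm h by rewrite nmM nm_i mul1r.
have n2 : nm (- ('i%C * h)) = nm h by rewrite nmN.
have := HK ('i%C * h); have := HK (- ('i%C * h)); rewrite n1 n2 => /(_ h1) e1 /(_ h1) e2.
have -> : csin (w + h) - csin w = (A * (cexp ('i%C * h) - 1) - B * (cexp (- ('i%C * h)) - 1)) / (2 * 'i%C).
  by rewrite /csin mulrDr opprD !cexpD -/A -/B; field.
rewrite nmM nmV nmM nm_nat nm_i mulr1 ler_pdivrMr//.
apply: le_trans (nmB _ _) _; rewrite (nmM A) (nmM B).
have : nm A * nm (cexp ('i%C * h) - 1) <= nm A * (K * nm h) by rewrite ler_wpM2l ?nm_ge0.
have : nm B * nm (cexp (- ('i%C * h)) - 1) <= nm B * (K * nm h) by rewrite ler_wpM2l ?nm_ge0.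
have : 0 <= (nm A + nm B) * K * nm h by rewrite !mulr_ge0 ?addr_ge0 ?nm_ge0.
lra.
Qed.

Lemma sinh_ge (y : R) : (`|y| / 2) ^+ 2 <= ((expR y - expR (- y)) / 2) ^+ 2.
Proof.
wlog y0 : y / 0 <= y => [hw|].
  have [|y0] := leP 0 y; first exact: hw.
  have := hw (- y); rewrite normrN opprK oppr_ge0 => /(_ (ltW y0)) h.
  by apply: le_trans h _; rewrite le_eqVlt; apply/orP; left; apply/eqP; ring.
have e1 := expR_ge1Dx y; have ey := expR_gt0 y.
have e2 : expR (- y) * expR y = 1 by rewrite -expRD addNr expR0.
have e3 : expR (- y) * (1 + y) <= 1 by rewrite -[leRHS]e2 ler_wpM2l ?expR_ge0.
have e4 := expR_ge0 (- y).
have h : y <= expR y - expR (- y) by nra.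
have h0 := le_trans y0 h.
by rewrite ger0_norm//; apply: lerXn2r; rewrite ?nnegrE ?divr_ge0//; lra.
Qed.

(** Near [0] the bound comes from the Taylor expansion; on the rest of the strip
[sin] is bounded away from [0], as [|sin (x + i y)| ^ 2 = sin x ^ 2 + sinh y ^ 2]. *)
Lemma csin_strip : exists B : R, forall w : C, `|complex.Re w| <= pi / 2 -> w != 0 ->
  csin w != 0 /\ nm (1 / csin w ^+ 2 - 1 / w ^+ 2) <= B.
Proof.
have [K K0 HK] := csin_taylor.
pose rho := (2 * K + 1)^-1.
have K1 : 0 < 2 * K + 1 by lra.
have rho0 : 0 < rho by rewrite invr_gt0.
have rho1 : rho <= 1 by rewrite invf_le1//; lra.
have Krho : K * rho <= 1 / 2 by rewrite ler_pdivrMr//; lra.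
pose d := rho / 2.
have pi2 : 1 <= (pi : R) / 2 := pihalf_ge1 R.
pose c0 := Num.min (sin d) (d / 2).
have d0 : 0 < d by rewrite divr_gt0.
have dpi : d <= (pi : R) / 2 by rewrite /d; lra.
have sd : 0 < sin d.
  by apply: sin_gt0_pi; rewrite d0 /=; lra.
have c00 : 0 < c0 by rewrite lt_min sd divr_gt0.
exists (12 * K + c0 ^- 2 + rho ^- 2) => w hw w0.
have nw : 0 < nm w by rewrite nm_gt0.
have [small|large] := leP (nm w) rho.
  have w1 : nm w <= 1 by apply: le_trans small rho1.
  have h := HK w w1.
  have h3 : K * nm w ^+ 3 <= nm w / 2.
    have e : nm w ^+ 3 = nm w * nm w * nm w by ring.
    rewrite e; have : K * nm w <= K * rho by rewrite ler_wpM2l.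
    move=> hk; have : K * nm w * nm w <= 1 / 2 * 1 by rewrite ler_pM// ?mulr_ge0 ?nm_ge0// (le_trans hk).
    rewrite mulrA mulrA => hk2; have : K * nm w * nm w * nm w <= 1 / 2 * nm w.
      by rewrite ler_wpM2r ?nm_ge0//; lra.
    lra.
  have s2 : nm w / 2 <= nm (csin w) by have := nm_sub w (w - csin w); rewrite subKr (nmC w); lra.
  have s0 : csin w != 0 by rewrite -nm_gt0; lra.
  split=> //; apply: (@le_trans _ _ (12 * K)); last first.
    by rewrite -addrA lerDl addr_ge0// invr_ge0 exprn_ge0// ltW.
  have -> : 1 / csin w ^+ 2 - 1 / w ^+ 2 = - ((csin w - w) * (csin w + w)) / (csin w ^+ 2 * w ^+ 2).
    by field; rewrite w0 s0.
  rewrite nmM nmN nmV nmM (nmM (_ ^+ 2)) !nmX.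
  have sp : 0 < nm (csin w) by rewrite nm_gt0.
  rewrite ler_pdivrMr ?mulr_gt0 ?exprn_gt0//.
  have s3 : nm (csin w + w) <= 3 * nm w.
    rewrite (_ : csin w + w = (csin w - w) + 2 * w); last by ring.
    apply: le_trans (nmD _ _) _; rewrite nmM nm_nat; lra.
  apply: (@le_trans _ _ (K * nm w ^+ 3 * (3 * nm w))); first by rewrite ler_pM ?nm_ge0.
  rewrite (_ : K * _ * _ = 12 * K * ((nm w / 2) ^+ 2 * nm w ^+ 2)); last by field.
  rewrite ler_wpM2l ?mulr_ge0// ler_wpM2r ?exprn_ge0 ?nm_ge0//.
  by apply: lerXn2r; rewrite ?nnegrE ?divr_ge0 ?nm_ge0.
have low : c0 <= nm (csin w).
  rewrite -(@ler_pXn2r _ 2)// ?nnegrE ?nm_ge0 ?(ltW c00)//.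
  case: w hw w0 nw large => x y /= hx w0 nw large; rewrite nm_csin.
  have c2 (v : R) : c0 <= v -> c0 ^+ 2 <= v ^+ 2.
    by move=> hv; apply: lerXn2r; rewrite ?nnegrE ?(ltW c00)// (le_trans (ltW c00)).
  have [xs|xs] := leP d `|x|.
    rewrite (le_trans (c2 (sin d) _)) ?ge_min ?lexx//.
    apply: (@le_trans _ _ (sin `|x| ^+ 2)); last first.
      rewrite (_ : sin `|x| ^+ 2 = sin x ^+ 2) ?lerDl ?sqr_ge0//.
      by have [x0|x0] := leP 0 x; rewrite ?(ger0_norm x0) ?(ltr0_norm x0) ?sinN ?sqrrN.
    have hle : sin d <= sin `|x|.
      move: xs; rewrite le_eqVlt => /predU1P[<-//|xs]; apply: ltW.
      rewrite ltr_sin// in_itv /=; first by rewrite dpi andbT; lra.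
      by rewrite hx andbT; have := normr_ge0 x; lra.
    by apply: lerXn2r; rewrite ?nnegrE ?(ltW sd)// (le_trans (ltW sd)).
  have hy : d <= `|y|.
    have := nm_le_ReIm (x +i* y); rewrite /= in large *; move: large; rewrite /d in xs *.
    move=> l1 l2; have := lt_le_trans l1 l2; lra.
  rewrite (le_trans (c2 (d / 2) _)) ?ge_min ?lexx ?orbT//.
  apply: le_trans (_ : (`|y| / 2) ^+ 2 <= _).
    by have y0 := normr_ge0 y; apply: lerXn2r; rewrite ?nnegrE; lra.
  by apply: le_trans (sinh_ge y) _; rewrite lerDr sqr_ge0.
have sp : 0 < nm (csin w) by apply: lt_le_trans low.
split; first by rewrite -nm_gt0.
apply: le_trans (nmB _ _) _; rewrite !div1r !nmV !nmX -addrA.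
have h1 : nm (csin w) ^- 2 <= c0 ^- 2.
  rewrite lef_pV2 ?posrE ?exprn_gt0//.
  by apply: lerXn2r; rewrite ?nnegrE ?(ltW c00) ?nm_ge0.
have h2 : nm w ^- 2 <= rho ^- 2.
  rewrite lef_pV2 ?posrE ?exprn_gt0//.
  by apply: lerXn2r; rewrite ?nnegrE ?(ltW rho0) ?nm_ge0// ltW.
lra.
Qed.

End ComplexSine.

(** * The Weierstrass sum of a cyclic group *)

Section Herglotz.
Variable R : realType.
Local Notation C := R[i].
Implicit Types (z w u g : C).

Definition multiples g : set C := [set u | exists n : int, u = g *~ n].
Local Notation zints := (multiples 1).

Lemma multiplesB g u v : multiples g u -> multiples g v -> multiples g (u - v).
Proof. by move=> [m ->] [n ->]; exists (m - n); rewrite mulrzBr. Qed.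

Lemma multiples0 g : multiples g 0.
Proof. by exists 0; rewrite mulr0z. Qed.

Lemma Re_int (n : int) : complex.Re (n%:~R : C) = n%:~R.
Proof. by rewrite -(rmorph_int (real_complex R)). Qed.

Lemma csin_int_shift w (k : int) : csin (w + pi%:C * k%:~R) ^+ 2 = csin w ^+ 2.
Proof.
have step (v : C) : csin (v + pi%:C) ^+ 2 = csin v ^+ 2 by rewrite csin_shift sqrrN.
have pos (v : C) (n : nat) : csin (v + pi%:C * n%:R) ^+ 2 = csin v ^+ 2.
  elim: n => [|n IH]; first by rewrite mulr0 addr0.
  by rewrite -natr1 mulrDr mulr1 addrA step.
case: k => n; first exact: pos.
by rewrite NegzE rmorphN mulrN -(pos (w - _) n.+1) subrK.
Qed.

Lemma csin_sqr w : csin w ^+ 2 + csin (w + (pi / 2)%:C) ^+ 2 = 1.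
Proof.
have i2 := sqr_iC R; have i0 := i_neq0 R.
have iV : ('i%C)^-1 = - 'i%C :> C.
  by apply: (mulfI i0); rewrite mulfV// mulrN i2 opprK.
rewrite /csin invfM iV mulrDr opprD !cexpD !cexpN cexp_ihalfpi iV.
set E := cexp _; have E0 : E != 0 := cexp_neq0 _.
have -> : ((E - E^-1) * (2^-1 * - 'i%C)) ^+ 2 = ((E - E^-1) * 2^-1) ^+ 2 * ('i%C * 'i%C) by ring.
have -> : ((E * 'i%C - E^-1 * - 'i%C) * (2^-1 * - 'i%C)) ^+ 2 =
  ((E + E^-1) * 2^-1) ^+ 2 * ('i%C * 'i%C) * ('i%C * 'i%C) by ring.
by rewrite i2; field; rewrite E0.
Qed.

Lemma nearest_int z : exists k : int, `|complex.Re z - k%:~R| <= 1 / 2.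
Proof.
exists (Num.floor (complex.Re z + 1 / 2)).
have := floor_le (complex.Re z + 1 / 2); have := lt_succ_floor (complex.Re z + 1 / 2).
by rewrite intrD ler_norml => *; apply/andP; split; lra.
Qed.

Lemma pi_neq0 : (pi : R)%:C != 0 :> C.
Proof. by rewrite -nm_gt0 nm_real normr_gt0 gt_eqF// pi_gt0. Qed.

Lemma csin_pi_bound : exists B : R, forall z, ~ zints z -> csin (pi%:C * z) != 0 /\
  forall k : int, `|complex.Re z - k%:~R| <= 1 / 2 ->
    nm (pi%:C ^+ 2 / csin (pi%:C * z) ^+ 2 - 1 / (z - k%:~R) ^+ 2) <= B.
Proof.
have [B HB] := csin_strip R; exists (pi ^+ 2 * B) => z hz.
have main (k : int) : `|complex.Re z - k%:~R| <= 1 / 2 -> csin (pi%:C * z) != 0 /\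
    nm (pi%:C ^+ 2 / csin (pi%:C * z) ^+ 2 - 1 / (z - k%:~R) ^+ 2) <= pi ^+ 2 * B.
  move=> hk; pose w := pi%:C * (z - k%:~R).
  have zk : z - k%:~R != 0.
    by rewrite subr_eq0; apply/eqP => e; apply: hz; exists k; rewrite e.
  have w0 : w != 0 by rewrite mulf_neq0// pi_neq0.
  have hw : `|complex.Re w| <= pi / 2.
    have -> : complex.Re w = pi * (complex.Re z - k%:~R).
      rewrite /w -(rmorph_int (real_complex R)); case: (z) => a b /=; ring.
    by rewrite normrM (gtr0_norm (pi_gt0 _)) ler_pM2l ?pi_gt0//; lra.
  have [s0 hs] := HB w hw w0.
  have e : csin (pi%:C * z) ^+ 2 = csin w ^+ 2.
    by rewrite -(csin_int_shift w k) /w -mulrDr subrK.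
  split; first by rewrite -sqrf_eq0 e sqrf_eq0.
  have p0 := pi_neq0.
  rewrite e (_ : _ - _ = pi%:C ^+ 2 * (1 / csin w ^+ 2 - 1 / w ^+ 2)).
    by rewrite nmM nmX nm_real (gtr0_norm (pi_gt0 _)) ler_pM2l ?exprn_gt0 ?pi_gt0.
  move: s0 p0; move: (csin w) => s s0; rewrite /w; move: (pi%:C) => P p0.
  by field; rewrite s0 zk p0.
have [k /main[s0 _]] := nearest_int z.
by split=> // k' /main[].
Qed.

(** Off the nearest integer the terms are dominated by [16 weight j weight 0], where [j]
is the distance of [u] from that integer. *)
Lemma ints_bounded z (k : int) : `|complex.Re z - k%:~R| <= 1 / 2 ->
  abs_bounded (zints `\ k%:~R) (fun u => 1 / (z - u) ^+ 2) 576.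
Proof.
move=> hk K KA.
pose c u : int * int := (Num.floor (complex.Re u) - k, 0).
have cE u : zints u -> u = ((c u).1 + k)%:~R.
  by move=> [n ->]; rewrite /c /= Re_int intrKfloor subrK.
apply: (@le_trans _ _ (\sum_(u <- K) 16 * (weight R (c u).1 * weight R (c u).2))).
  rewrite big_seq [leRHS]big_seq; apply: ler_sum => u /KA [hu uk].
  have E := cE u hu; set j := (c u).1 in E *.
  have j0 : j != 0 by apply/eqP => j0; apply: uk; rewrite /= E j0 add0r.
  have -> : weight R (c u).2 = 1 by rewrite /weight normr0 addr0 sqrtr1 expr1n invr1.
  rewrite mulr1 div1r nmV nmX.
  have j1 : 1 <= `|j|%:~R :> R.
    by rewrite -[1]/(1%:~R) ler_int; lia.
  have low : (1 + `|j|%:~R) / 4 <= nm (z - u).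
    apply: le_trans (normr_Re_nm _).
    have -> : complex.Re (z - u) = (complex.Re z - k%:~R) - j%:~R.
      rewrite E -(rmorph_int (real_complex R)) rmorphD /=; case: (z) => a b /=.
      by rewrite intrD; ring.
    rewrite intr_norm in j1 *.
    have := lerB_dist (j%:~R : R) (complex.Re z - k%:~R); rewrite [in leRHS]distrC; lra.
  rewrite /weight; set s := Num.sqrt _.
  have s2 : s ^+ 2 = 1 + `|j|%:~R by rewrite sqr_sqrtr// addr_ge0// ler0z.
  have s1 : 1 <= s by rewrite -sqrtr1 ler_wsqrtr// lerDl ler0z.
  have s0 : 0 < s by apply: lt_le_trans s1.
  apply: (@le_trans _ _ ((s ^+ 2 / 4) ^- 2)).
    rewrite lef_pV2 ?posrE ?exprn_gt0 ?divr_gt0 ?exprn_gt0//; last first.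
      by apply: lt_le_trans low; rewrite -s2 divr_gt0// exprn_gt0.
    by apply: lerXn2r; rewrite ?nnegrE ?nm_ge0 ?divr_ge0 ?exprn_ge0 ?(ltW s0)// s2.
  rewrite (_ : (s ^+ 2 / 4) ^- 2 = 16 * (s ^- 3 * s^-1)); last by field; rewrite gt_eqF.
  by rewrite ler_pM2l// ler_piMr ?invr_ge0 ?exprn_ge0 ?(ltW s0)// invf_le1.
rewrite -mulr_sumr (_ : 576 = 16 * 36 :> R); last by ring.
rewrite ler_pM2l//; apply: sum_weight2; first exact: fset_uniq.
move=> u v /KA[hu _] /KA[hv _] [e].
by rewrite (cE u hu) (cE v hv) /c /= e.
Qed.

Definition int_sum z : C := hsum zints (fun u => 1 / (z - u) ^+ 2).

Lemma zints_split (k : int) : zints = [set k%:~R] `|` (zints `\ k%:~R).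
Proof.
rewrite setUDr setUC setDv setD0; apply/esym/setUidPl => _ ->.
by exists k.
Qed.

Lemma int_sum_near z (k : int) : `|complex.Re z - k%:~R| <= 1 / 2 ->
  has_sum zints (fun u => 1 / (z - u) ^+ 2) (int_sum z) /\
  nm (int_sum z - 1 / (z - k%:~R) ^+ 2) <= 576.
Proof.
move=> hk; have hB := ints_bounded hk; have [l hl] := abs_bounded_has_sum hB.
have h : has_sum zints (fun u => 1 / (z - u) ^+ 2) (1 / (z - k%:~R) ^+ 2 + l).
  rewrite (zints_split k); apply: has_sumU hl; last exact: has_sum1.
  by rewrite setDE setICA setICr setI0.
rewrite /int_sum (hsumE h); split=> //.
by rewrite addrAC subrr add0r; apply: has_sum_le hl.
Qed.

Lemma int_sumP z : has_sum zints (fun u => 1 / (z - u) ^+ 2) (int_sum z).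
Proof. by have [k /int_sum_near[]] := nearest_int z. Qed.

Lemma half_notint z : ~ zints z -> ~ zints (z / 2) /\ ~ zints ((z - 1) / 2).
Proof.
have n2 : (2 : C) != 0 by rewrite pnatr_eq0.
move=> hz; split=> -[n e]; apply: hz.
  by exists (n * 2); rewrite mulrzA -e -mulrzr divfK.
exists (n * 2 + 1); rewrite mulrzDr_tmp mulrzA -e mulr1z.
by rewrite -mulrzr divfK// subrK.
Qed.

Lemma zints_parity : zints = [set u | zints (u / 2)] `|` [set u | zints ((u - 1) / 2)].
Proof.
have n2 : (2 : C) != 0 by rewrite pnatr_eq0.
apply/seteqP; split=> [_ [n ->]|u [[n e]|[n e]]].
- have : n = 2 * (n %/ 2)%Z \/ n = 2 * (n %/ 2)%Z + 1 by lia.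
  set k := (n %/ 2)%Z => -[->|->]; [left|right]; exists k.
    by rewrite [_ *~ (_ * _)]intrM mulrAC mulfV// mul1r.
  by rewrite [_ *~ _]intrD intrM addrK mulrAC mulfV// mul1r.
- by exists (n * 2); rewrite mulrzA -e -mulrzr divfK.
- exists (n * 2 + 1); rewrite mulrzDr_tmp mulrzA -e mulr1z.
  by rewrite -mulrzr divfK// subrK.
Qed.

Lemma zints_parity0 : [set u | zints (u / 2)] `&` [set u | zints ((u - 1) / 2)] = set0.
Proof.
have n2 : (2 : C) != 0 by rewrite pnatr_eq0.
apply/seteqP; split=> // u [[n e] [m e']].
have : (2 * n - 2 * m)%:~R = (1 : C).
  by rewrite rmorphB !rmorphM /= -[n%:~R]e -[m%:~R]e'; field.
move=> /(congr1 (fun x : C => complex.Re x)); rewrite Re_int => /eqP.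
rewrite [X in _ == X](_ : _ = 1%:~R)// eqr_int => /eqP; lia.
Qed.

(** The sum is split into the even and the odd integers. *)
Lemma int_sum_halve z : 4 * int_sum z = int_sum (z / 2) + int_sum ((z - 1) / 2).
Proof.
have n2 : (2 : C) != 0 by rewrite pnatr_eq0.
have h1 : has_sum [set u | zints (u / 2)] (fun u => 1 / (z - u) ^+ 2) (4^-1 * int_sum (z / 2)).
  apply: (has_sum_bij (h := fun u => u * 2) (h' := fun u => u / 2)).
  - by move=> u; rewrite mulfK.
  - by move=> u; rewrite divfK.
  apply: eq_has_sum (has_sumZ 4^-1 (int_sumP (z / 2))) => u _.
  have -> : z - u * 2 = 2 * (z / 2 - u) by field.
  by rewrite exprMn !div1r [RHS]invfM -natrX.
have h2 : has_sum [set u | zints ((u - 1) / 2)] (fun u => 1 / (z - u) ^+ 2) (4^-1 * int_sum ((z - 1) / 2)).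
  apply: (has_sum_bij (h := fun u => u * 2 + 1) (h' := fun u => (u - 1) / 2)).
  - by move=> u; rewrite addrK mulfK.
  - by move=> u; rewrite divfK// subrK.
  apply: eq_has_sum (has_sumZ 4^-1 (int_sumP ((z - 1) / 2))) => u _.
  have -> : z - (u * 2 + 1) = 2 * ((z - 1) / 2 - u) by field.
  by rewrite exprMn !div1r [RHS]invfM -natrX.
have h := has_sumU zints_parity0 h1 h2; rewrite -zints_parity in h.
by rewrite (has_sum_uniq (int_sumP z) h); field.
Qed.

Lemma trig_halve z : ~ zints z ->
  4 * (pi%:C ^+ 2 / csin (pi%:C * z) ^+ 2) =
  pi%:C ^+ 2 / csin (pi%:C * (z / 2)) ^+ 2 + pi%:C ^+ 2 / csin (pi%:C * ((z - 1) / 2)) ^+ 2.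
Proof.
move=> hz; have [z1 z2] := half_notint hz; have [B HB] := csin_pi_bound.
have n2 : (2 : C) != 0 by rewrite pnatr_eq0.
have [s1 _] := HB _ z1; have [s2 _] := HB _ z2.
pose w := pi%:C * (z / 2); have wE : pi%:C * z = 2 * w by rewrite /w; field.
have w2 : csin (pi%:C * ((z - 1) / 2)) ^+ 2 = csin (w + (pi / 2)%:C) ^+ 2.
  rewrite -(csin_int_shift (pi%:C * ((z - 1) / 2)) 1); congr (csin _ ^+ 2).
  by rewrite /w rmorphM fmorphV rmorph_nat; field.
have c0 : csin (w + (pi / 2)%:C) != 0 by rewrite -sqrf_eq0 -w2 sqrf_eq0.
rewrite wE csin2 w2 -/w; rewrite -/w in s1; have := csin_sqr w.
set s := csin w in s1 *; set c := csin _ in c0 * => sc.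
transitivity (pi%:C ^+ 2 * (s ^+ 2 + c ^+ 2) / (s ^+ 2 * c ^+ 2)).
  by rewrite sc; field; rewrite s1 c0.
by field; rewrite s1 c0.
Qed.

(** The difference of the two sides is bounded off the integers, and it is at most half
of any bound on its values at [z / 2] and [(z - 1) / 2]; so it vanishes. *)
Lemma int_sum_trig z : ~ zints z -> int_sum z = pi%:C ^+ 2 / csin (pi%:C * z) ^+ 2.
Proof.
move=> hz; have [B HB] := csin_pi_bound.
pose D z := int_sum z - pi%:C ^+ 2 / csin (pi%:C * z) ^+ 2.
have Dhalf w : ~ zints w -> 4 * D w = D (w / 2) + D ((w - 1) / 2).
  by move=> hw; rewrite /D mulrBr int_sum_halve trig_halve//; ring.
have bnd n w : ~ zints w -> nm (D w) <= (576 + B) / 2 ^+ n.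
  elim: n w => [|n IH] w hw.
    rewrite expr0 divr1; have [k hk] := nearest_int w.
    have [_ h1] := int_sum_near hk; have [_ /(_ k hk) h2] := HB w hw.
    apply: le_trans (nm_tri (1 / (w - k%:~R) ^+ 2) _ _) _.
    by rewrite lerD// nmC.
  have [w1 w2] := half_notint hw; have := IH _ w1; have := IH _ w2.
  have e := congr1 (fun x : C => nm x) (Dhalf w hw); rewrite nmM nm_nat in e.
  have := nmD (D (w / 2)) (D ((w - 1) / 2)); rewrite -e.
  have -> : (576 + B) / 2 ^+ n.+1 = (576 + B) / 2 ^+ n / 2 by rewrite exprS invfM; ring.
  lra.
apply/eqP; rewrite -subr_eq0; apply/eqP; apply: nm_small_eq => e e0; rewrite subr0 -/(D z).
have B0 : 0 <= 576 + B by have := bnd 0%N z hz; rewrite expr0 divr1; apply: le_trans; exact: nm_ge0.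
pose n := (Num.trunc ((576 + B) / e)).+1.
apply: le_trans (bnd n z hz) _; rewrite ler_pdivrMr ?exprn_gt0//.
have : (576 + B) / e < n%:R := truncnS_gt _.
have : n%:R <= 2 ^+ n :> R by rewrite -natrX ler_nat ltnW// ltn_expl.
move=> h1 h2; have := lt_le_trans h2 h1; rewrite ltr_pdivrMr// => /ltW.
by rewrite mulrC.
Qed.

Lemma sparse_multiples g : g != 0 -> sparse (multiples g).
Proof.
move=> g0; have h : cross g (g * 'i%C) != 0.
  have -> : cross g (g * 'i%C) = nm g ^+ 2.
    by rewrite sqr_nm /cross; case: (g) => a b /=; ring.
  by rewrite expf_eq0 nm_eq0 (negbTE g0).
apply: sparse_sub (sparse_lat h) => _ [n ->].
by exists n, 0; rewrite mulr0z addr0.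
Qed.

Lemma multiples_scale g : g != 0 -> [set u | zints (g^-1 * u)] = multiples g.
Proof.
move=> g0; apply/seteqP; split=> [u [n e]|_ [n ->]]; exists n.
  by rewrite -mulrzr -[n%:~R]e mulVKf.
by rewrite -mulrzr mulKf.
Qed.

Lemma csin_halfpi : csin (pi%:C * (1 / 2)) = 1 :> C.
Proof.
have i0 := i_neq0 R.
have -> : pi%:C * (1 / 2) = (pi / 2)%:C :> C by rewrite rmorphM fmorphV rmorph_nat mul1r.
rewrite /csin cexpN cexp_ihalfpi; have -> : ('i%C)^-1 = - 'i%C :> C.
  by apply: (mulfI i0); rewrite mulfV// mulrN sqr_iC opprK.
by field.
Qed.

(** The Weierstrass sum differs from [int_sum] by the sum of the inverse squares, whose
value [pi ^ 2 / 3] comes out of comparing the halving formulas of the two sums. *)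
Lemma wps_zints z : ~ zints z ->
  wps zints z = pi%:C ^+ 2 * (1 / csin (pi%:C * z) ^+ 2 - 1 / 3).
Proof.
have one0 : (1 : C) != 0 by rewrite oner_eq0.
have n2 : (2 : C) != 0 by rewrite pnatr_eq0.
have hZ := sparse_multiples one0; have Z0 := multiples0 1.
have [zeta hzeta] : exists l, has_sum (zints `\ 0) (fun u => 1 / u ^+ 2) l.
  have hk : `|complex.Re (0 : C) - 0%:~R| <= 1 / 2 by rewrite /= subrr normr0 divr_ge0.
  have [l hl] := abs_bounded_has_sum (ints_bounded hk); exists l.
  by apply: eq_has_sum hl => u _; rewrite sub0r sqrrN.
have wE w : ~ zints w -> wps zints w = int_sum w - zeta.
  move=> hw.
  have h : has_sum zints (fun u => 1 / (w - u) ^+ 2) (1 / w ^+ 2 + (hsum (zints `\ 0) (wpt w) + zeta)).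
    rewrite {1}(zints_split 0); apply: has_sumU.
    - by rewrite setDE setICA setICr setI0.
    - by rewrite -[w in 1 / w ^+ 2]subr0; exact: has_sum1.
    have h2 := wpt_sum hZ Z0 (fun h : (zints `\ 0) w => hw h.1).
    apply: eq_has_sum (has_sumD h2 hzeta) => u _.
    by rewrite /wpt subrK.
  by rewrite (has_sum_uniq (int_sumP w) h) /wps addrA addrK.
have half : ~ zints (1 / 2).
  move=> [n e]; have : (n * 2)%:~R = (1 : C) by rewrite rmorphM /= -[n%:~R]e; field.
  move=> /(congr1 (fun x : C => complex.Re x)); rewrite Re_int => /eqP.
  rewrite [X in _ == X](_ : _ = 1%:~R)// eqr_int => /eqP; lia.
move=> hz; have [z1 z2] := half_notint hz.
pose Z2 := [set u | zints (2^-1 * u)].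
have Z2E u : Z2 u <-> zints (u / 2) by rewrite /Z2 /= mulrC.
have sc w : ~ zints w -> wps Z2 (2 * w) = 4^-1 * wps zints w.
  by move=> hw; rewrite (wps_scale hZ Z0 n2 hw) -natrX.
have spl : wps zints z = wps Z2 z + wps Z2 (z - 1) - wps Z2 1.
  apply: wps_split => //.
  - by rewrite /Z2 /= mulr0.
  - by move=> u v; rewrite /Z2 /= mulrBr; apply: multiplesB.
  - rewrite [LHS]zints_parity; congr (_ `|` _); apply/seteqP; split=> u; rewrite /Z2 /= mulrC//.
  - by rewrite /Z2 /= mulr1 -div1r.
have e1 := sc _ z1; have e2 := sc _ z2; have e3 := sc _ half.
rewrite (_ : 2 * (z / 2) = z) in e1; last by field.
rewrite (_ : 2 * ((z - 1) / 2) = z - 1) in e2; last by field.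
rewrite (_ : 2 * (1 / 2) = 1) in e3; last by field.
have hz3 : zeta = pi%:C ^+ 2 / 3.
  have s12 : int_sum (1 / 2) = pi%:C ^+ 2 by rewrite int_sum_trig// csin_halfpi expr1n divr1.
  have := int_sum_halve z; move: spl; rewrite e1 e2 e3 (wE _ hz) (wE _ z1) (wE _ z2) (wE _ half) s12.
  set p := pi%:C ^+ 2; set s1 := int_sum (z / 2); set s2 := int_sum ((z - 1) / 2) => h1 h2.
  have e : p = (s1 + s2) - 4 * (4^-1 * (s1 - zeta) + 4^-1 * (s2 - zeta) - 4^-1 * (p - zeta)) - zeta.
    by field.
  by rewrite -h1 -h2 in e; rewrite e; field.
by rewrite (wE _ hz) int_sum_trig// hz3; ring.
Qed.

Theorem wps_multiples g z : g != 0 -> ~ multiples g z ->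
  csin (pi%:C * z / g) != 0 /\
  wps (multiples g) z = (pi%:C / g) ^+ 2 * (1 / csin (pi%:C * z / g) ^+ 2 - 1 / 3).
Proof.
move=> g0 hz; have one0 : (1 : C) != 0 by rewrite oner_eq0.
have hz1 : ~ zints (z / g).
  by move=> h; apply: hz; rewrite -multiples_scale//= mulrC.
have [B HB] := csin_pi_bound; have [s0 _] := HB _ hz1.
rewrite -mulrA; split=> //.
have := wps_scale (sparse_multiples one0) (multiples0 1) g0 hz1.
rewrite multiples_scale// mulrC divfK// => ->; rewrite wps_zints//.
by move: (1 / _ - 1 / 3) => X; move: (pi%:C) => P; field; rewrite g0.
Qed.

End Herglotz.

(** * Unordered pairs and triples *)

Section UnorderedLemmas.
Variable T : choiceType.
Implicit Types a b c x y z : T.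

Lemma unordered_eq n (s t : unordered T n) : (umset s = umset t) -> s = t.
Proof. exact: val_inj. Qed.

Lemma perm_eq2 a b x y : perm_eq [:: a; b] [:: x; y] -> (a = x /\ b = y) \/ (a = y /\ b = x).
Proof.
move=> h; have : a \in [:: x; y] by rewrite -(perm_mem h) mem_head.
rewrite !inE => /orP[/eqP ax|/eqP ay]; [left|right]; subst a; split=> //.
  by move: h; rewrite perm_cons => /perm_small_eq -/(_ isT)[].
have : perm_eq [:: y; b] [:: y; x] by rewrite (perm_trans h)// (perm_catC [:: x] [:: y]).
by rewrite perm_cons => /perm_small_eq -/(_ isT)[].
Qed.

Lemma upair_inj a b x y : upair a b = upair x y -> (a = x /\ b = y) \/ (a = y /\ b = x).
Proof. by move=> /(congr1 (@umset T 2))/eq_seq_msetP/perm_eq2. Qed.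

Lemma upairC a b : upair a b = upair b a.
Proof. by apply: unordered_eq; apply/eq_seq_msetP; exact/permPl/(perm_catC [:: a] [:: b]). Qed.

Lemma utriple_perm a b c x y z : perm_eq [:: a; b; c] [:: x; y; z] ->
  utriple a b c = utriple x y z.
Proof. by move=> h; apply: unordered_eq; apply/eq_seq_msetP. Qed.

Lemma utriple_inj a b c x y z : utriple a b c = utriple x y z ->
  perm_eq [:: a; b; c] [:: x; y; z].
Proof. by move=> /(congr1 (@umset T 3))/eq_seq_msetP. Qed.

Lemma ucons_upair a b c : ucons a (upair b c) = utriple a b c.
Proof.
apply: unordered_eq; apply/eq_seq_msetP; rewrite perm_cons; exact: perm_eq_seq_mset.
Qed.

Lemma utriple_swap a b c : utriple a b c = utriple b a c.
Proof.
by apply: utriple_perm; rewrite -[[:: a; b; c]]/([:: a] ++ [:: b] ++ [:: c]) perm_catCA.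
Qed.

Lemma perm_eq3 a b c x y z : perm_eq [:: a; b; c] [:: x; y; z] ->
  [\/ x = a /\ perm_eq [:: b; c] [:: y; z], x = b /\ perm_eq [:: a; c] [:: y; z]
    | x = c /\ perm_eq [:: a; b] [:: y; z]].
Proof.
move=> h; have : x \in [:: a; b; c] by rewrite (perm_mem h) mem_head.
rewrite !inE => /or3P[] /eqP e; subst x; [constructor 1|constructor 2|constructor 3];
  split=> //.
- by rewrite -(perm_cons a).
- rewrite -(perm_cons b); apply: perm_trans h.
  by rewrite -[[:: a; b; c]]/([:: a] ++ [:: b] ++ [:: c]) perm_sym perm_catCA.
- rewrite -(perm_cons c); apply: perm_trans h.
  by rewrite -[[:: a; b; c]]/([:: a; b] ++ [:: c]) perm_sym perm_catC.
Qed.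

End UnorderedLemmas.

(** * One step of the recursion on triples *)

Section LandenStep.
Variable R : realType.
Local Notation C := R[i].
Implicit Types (a b c x y z : C).

Lemma ltc_nm x y : (`|x| < `|y|) = (nm x < nm y).
Proof. by rewrite !normE ltcR. Qed.

Lemma lec_nm x y : (`|x| <= `|y|) = (nm x <= nm y).
Proof. by rewrite !normE lecR. Qed.

(** The two remaining values are determined, as an unordered pair, by their sum and the
product of their distances to [f1]. *)
Lemma landenE (e1 e2 e3 f1 f2 f3 : C) : f1 = - e1 / 2 -> f1 + f2 + f3 = 0 ->
  16 * (f2 - f1) * (f3 - f1) = (e2 - e3) ^+ 2 ->
  landen (e1, upair e2 e3) = (f1, upair f2 f3).
Proof.
move=> h1 hs hp; rewrite /landen; apply: xget_unique; first by exists e2, e3, f2, f3; split.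
move=> [g1 g] /= [a [b [g2 [g3 [/= hab -> hg1 hgs hgp]]]]].
have e : (a - b) ^+ 2 = (e2 - e3) ^+ 2.
  by case: (upair_inj hab) => -[-> ->]//; ring.
have g1f : g1 = f1 by rewrite hg1 h1.
rewrite g1f; congr (_, _).
have n16 : (16 : C) != 0 by rewrite pnatr_eq0.
have s3 : g3 = - f1 - g2 by move/eqP: hgs; rewrite g1f addrC addr_eq0 => /eqP ->; ring.
have t3 : f3 = - f1 - f2 by move/eqP: hs; rewrite addrC addr_eq0 => /eqP ->; ring.
have : (g2 - f2) * (g2 - f3) = 0.
  apply: (mulfI n16); rewrite mulr0.
  transitivity (16 * (f2 - f1) * (f3 - f1) - 16 * (g2 - g1) * (g3 - g1)).
    by rewrite s3 g1f t3; ring.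
  by rewrite hp hgp e subrr.
move=> /eqP; rewrite mulf_eq0 !subr_eq0 => /orP[/eqP eg|/eqP eg].
  by rewrite s3 t3 eg.
by rewrite upairC s3 eg t3; congr upair; ring.
Qed.

(** Two different marks would each have to be farther from the others than these are from
each other. *)
Lemma markE a b c : a + b + c = 0 -> nm (b - c) < nm (a - b) -> nm (b - c) < nm (a - c) ->
  mark (utriple a b c) = (a, upair b c).
Proof.
move=> hs h1 h2; rewrite /mark; apply: xget_unique.
  by exists a, b, c; split; rewrite ?ltc_nm.
move=> _ [x [y [z [hxyz _ h3 h4 ->]]]]; rewrite !ltc_nm in h3 h4.
case: (perm_eq3 (utriple_inj hxyz)) => -[ex /perm_eq2 h]; rewrite ex in h3 h4 *.
- by case: h => -[-> ->]//; rewrite upairC.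
- move: h3 h4; case: h => -[<- <-]; rewrite ?(nmC b a) ?(nmC c a) => h3 h4; exfalso; clear -h1 h2 h3 h4; lra.
- move: h3 h4; case: h => -[<- <-]; rewrite ?(nmC b a) ?(nmC c a) ?(nmC c b) => h3 h4; exfalso; clear -h1 h2 h3 h4; lra.
Qed.

(** One step of the arithmetic-geometric mean for the differences [al], [be]
of the marked value to the other two.  Here [|al + be| ^ 2 >= 3 m ^ 2] by the
parallelogram identity, where [m] bounds both below; so [p], the larger of the two new
differences, is of the order of [m], and [q] is of the order of [(al - be) ^ 2 / m]. *)
Lemma agm_step (al be p q : C) (m : R) : 0 < m -> m <= nm al -> m <= nm be ->
  nm (al - be) <= m -> p + q = (al + be) / 2 -> 16 * (p * q) = (al - be) ^+ 2 ->
  nm q <= nm p ->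
  [/\ nm q <= nm (al - be) ^+ 2 / (6 * m),
      m - nm (al - be) / 2 - 2 * nm q <= nm p, m - nm (al - be) / 2 - 2 * nm q <= nm (p - q),
      5 / 12 * m <= nm p & 5 / 12 * m <= nm (p - q)].
Proof.
move=> m0 ha hb; set D := nm (al - be) => hD hs hp hqp.
have par : nm (al + be) ^+ 2 + D ^+ 2 = 2 * nm al ^+ 2 + 2 * nm be ^+ 2.
  rewrite /D !sqr_nm; case: (al) (be) => a1 a2 [b1 b2] /=; ring.
have D0 : 0 <= D := nm_ge0 _.
have sum_low : 3 / 2 * m <= nm (al + be).
  rewrite -(@ler_pXn2r _ 2)// ?nnegrE ?nm_ge0 ?mulr_ge0 ?divr_ge0 ?(ltW m0)//.
  have : m ^+ 2 <= nm al ^+ 2 by apply: lerXn2r; rewrite ?nnegrE ?nm_ge0 ?(ltW m0).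
  have : m ^+ 2 <= nm be ^+ 2 by apply: lerXn2r; rewrite ?nnegrE ?nm_ge0 ?(ltW m0).
  have : D ^+ 2 <= m ^+ 2 by apply: lerXn2r; rewrite ?nnegrE ?(ltW m0).
  rewrite exprMn; have := sqr_ge0 m; lra.
have nh : nm ((al + be) / 2) = nm (al + be) / 2 by rewrite nmM nmV nm_nat.
have pq : nm (al + be) / 2 <= nm p + nm q by rewrite -nh -hs nmD.
have p1 : 3 / 8 * m <= nm p by lra.
have hpq : 16 * (nm p * nm q) = D ^+ 2 by rewrite -[RHS]nmX -hp nmM nm_nat nmM.
have q1 : nm q <= D ^+ 2 / (6 * m).
  rewrite ler_pdivlMr ?mulr_gt0// -hpq.
  have : nm q * (3 / 8 * m) <= nm q * nm p by rewrite ler_wpM2l// nm_ge0.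
  lra.
have q2 : nm q <= m / 6.
  apply: le_trans q1 _; rewrite ler_pdivrMr ?mulr_gt0//.
  have : D ^+ 2 <= m ^+ 2 by apply: lerXn2r; rewrite ?nnegrE ?(ltW m0).
  rewrite expr2 expr2; lra.
have pl : nm (al + be) / 2 - nm q <= nm p by lra.
have pql : nm (al + be) / 2 - 2 * nm q <= nm (p - q) by have := nm_sub p q; lra.
have al2 : m - D / 2 <= nm (al + be) / 2.
  rewrite -nh (_ : (al + be) / 2 = al - (al - be) / 2); last by field.
  have := nm_sub al ((al - be) / 2); rewrite [nm ((al - be) / 2)]nmM nmV nm_nat -/D; lra.
have := nm_ge0 q; split; lra.
Qed.

End LandenStep.

(** * The Landen transformation of lattices *)

Section Landen.
Variable R : realType.
Local Notation C := R[i].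
Implicit Types (m n z : C).

Lemma cross_dbl m n : cross m n != 0 -> cross (2 * m) n != 0.
Proof. by rewrite cross2l. Qed.

Lemma hlat_dbl_sub m n : hlat (2 * m) n `<=` hlat m n.
Proof. exact: lat2l_sub. Qed.

Lemma hwp_landen m n z : cross m n != 0 -> ~ hlat m n z ->
  hwp m n z = hwp (2 * m) n z + hwp (2 * m) n (z - 2 * m) - hwp (2 * m) n (2 * m).
Proof.
move=> h hz; apply: wps_halve => //; exact: cross_hlat.
Qed.

(** The halving formula at [n], where the two terms are the values of the smaller lattice
at its other half periods; the three values add up to zero. *)
Lemma landen_value1 m n : cross m n != 0 -> hwp m n n = - 2 * hwp (2 * m) n (2 * m).
Proof.
move=> h; have h' := cross_dbl h; rewrite hwp_landen//; last exact: hlat_n.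
have -> : hwp (2 * m) n (n - 2 * m) = hwp (2 * m) n (2 * m + n).
  apply: hwp_eq => //; first exact: hlat_mn.
  by rewrite (_ : _ - _ = - (2 * (2 * m))); [apply/latN_iff; exact: hlat_2m|ring].
have := half_sum h'; set x := hwp (2 * m) n (2 * m); set y := hwp (2 * m) n n.
set w := hwp (2 * m) n (2 * m + n); move=> /eqP; rewrite [X in X == _]addrC addr_eq0 => /eqP ->; ring.
Qed.

(** Write [f1], [x], [y] for the values on the smaller lattice at [2 m], [m] and [m + n].
Halving gives [2 x - f1] and [2 y - f1] for the values on the right, and
[x + y = 2 f1] because the values add up to zero.  So the right side is
[16 (x - f1) ^ 2], which the product formula at [m] identifies with the left side. *)
Lemma landen_value23 m n : cross m n != 0 ->
  16 * ((hwp (2 * m) n n - hwp (2 * m) n (2 * m)) *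
        (hwp (2 * m) n (2 * m + n) - hwp (2 * m) n (2 * m)))
  = (hwp m n m - hwp m n (m + n)) ^+ 2.
Proof.
move=> h; have h' := cross_dbl h; set f1 := hwp (2 * m) n (2 * m).
have k1 : ~ hlat (2 * m) n m by move=> /hlat_dbl_sub; exact: hlat_m.
have k2 : ~ hlat (2 * m) n (m + n) by move=> /hlat_dbl_sub; exact: hlat_mn.
have k3 : ~ hlat (2 * m) n (m - 2 * m).
  by rewrite (_ : m - 2 * m = - m); [move/latN_iff|ring].
have e1 : hwp (2 * m) n (m - 2 * m) = hwp (2 * m) n m.
  by apply: hwp_eqN => //; rewrite (_ : _ + _ = 0); [exact: hlat0|ring].
have v1 : hwp m n m = 2 * hwp (2 * m) n m - f1.
  by rewrite hwp_landen ?e1 -/f1 //; [ring|exact: hlat_m].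
have e2 : hwp (2 * m) n (m + n - 2 * m) = hwp (2 * m) n (m + n).
  by apply: hwp_eqN => //; rewrite (_ : _ + _ = 2 * n); [exact: hlat_2n|ring].
have v2 : hwp m n (m + n) = 2 * hwp (2 * m) n (m + n) - f1.
  by rewrite hwp_landen ?e2 -/f1 //; [ring|exact: hlat_mn].
have := half_product h' k1 k3; rewrite e1 -/f1 => <-.
have s := half_sum h; rewrite v1 v2 landen_value1// -/f1 in s *.
set x := hwp (2 * m) n m in s *; set y := hwp (2 * m) n (m + n) in s *.
have yE : y = 2 * f1 - x.
  have n2 : (2 : C) != 0 by rewrite pnatr_eq0.
  apply: (mulfI n2); apply/eqP; rewrite -subr_eq0 -[X in _ == X]s; apply/eqP; ring.
by rewrite yE; ring.
Qed.

(** The halving formula, in which the product formula expresses [hwp (2 m) n (z - 2 m)] by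
[hwp (2 m) n z]; the constant is computed in [landen_value23]. *)
Lemma landen_phi m n z : cross m n != 0 -> ~ hlat m n z ->
  hwp m n m != hwp m n (m + n) ->
  hwp (2 * m) n z != hwp (2 * m) n (2 * m) /\
  hwp m n z = hwp (2 * m) n z + (hwp m n m - hwp m n (m + n)) ^+ 2 / 16 /
     (hwp (2 * m) n z - hwp (2 * m) n (2 * m)).
Proof.
move=> h hz hne; have h' := cross_dbl h.
have z1 : ~ hlat (2 * m) n z by move=> /hlat_dbl_sub.
have z2 : ~ hlat (2 * m) n (z - 2 * m).
  move=> /hlat_dbl_sub hz2; apply: hz; rewrite -(subrK (2 * m) z).
  by apply: latD hz2 (hlat_2m _ _).
have n16 : (16 : C) != 0 by rewrite pnatr_eq0.
have e1 := half_product h' z1 z2; have e2 := landen_value23 h.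
have e3 : (hwp m n m - hwp m n (m + n)) ^+ 2 / 16 =
    (hwp (2 * m) n z - hwp (2 * m) n (2 * m)) * (hwp (2 * m) n (z - 2 * m) - hwp (2 * m) n (2 * m)).
  by rewrite -e2 e1 mulrAC mulfV// mul1r.
have : (hwp m n m - hwp m n (m + n)) ^+ 2 / 16 != 0.
  by rewrite mulf_neq0 ?invr_eq0// sqrf_eq0 subr_eq0.
rewrite e3 mulf_eq0 negb_or subr_eq0 => /andP[n1 _]; split=> //.
by rewrite [X in _ = _ + X]mulrAC divff ?subr_eq0// mul1r hwp_landen// [RHS]addrA.
Qed.

End Landen.

(** * Quadratic smallness and the arithmetic-geometric mean *)

Section Quadratic.
Variable R : realType.
Local Notation C := R[i].
Implicit Types (r s : nat -> R) (u v : nat -> C).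

Definition qsmall r := exists c q : R, [/\ 0 < c, 0 < q &
  exists N, forall n, (N <= n)%N -> r n <= c * expR (- (q * 2 ^+ n))].

Lemma qsmall_dom r s (c : R) : qsmall r ->
  (exists N, forall n, (N <= n)%N -> s n <= c * r n) -> 0 <= c -> qsmall s.
Proof.
move=> [c1 [q [c10 q0 [N1 H1]]]] [N2 H2] c0.
exists (c * c1 + 1), q; split=> //; first by rewrite ltr_wpDl// mulr_ge0// ltW.
exists (maxn N1 N2) => n; rewrite geq_max => /andP[/H1 h1 /H2 h2].
apply: le_trans h2 _; apply: (@le_trans _ _ (c * (c1 * expR (- (q * 2 ^+ n))))).
  by rewrite ler_wpM2l.
by rewrite mulrA ler_wpM2r ?expR_ge0// lerDl.
Qed.

Lemma qsmall_le r s : qsmall r -> (exists N, forall n, (N <= n)%N -> s n <= r n) -> qsmall s.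
Proof.
move=> hr [N H]; apply: (@qsmall_dom r s 1) => //.
by exists N => n /H; rewrite mul1r.
Qed.

Lemma qsmallD r s : qsmall r -> qsmall s -> qsmall (fun n => r n + s n).
Proof.
move=> [c1 [q1 [c10 q10 [N1 H1]]]] [c2 [q2 [c20 q20 [N2 H2]]]].
exists (c1 + c2), (Num.min q1 q2); split; [exact: addr_gt0|by rewrite lt_min q10|].
exists (maxn N1 N2) => n; rewrite geq_max => /andP[/H1 h1 /H2 h2].
have e q : Num.min q1 q2 <= q -> expR (- (q * 2 ^+ n)) <= expR (- (Num.min q1 q2 * 2 ^+ n)) :> R.
  by move=> h; rewrite ler_expR lerN2 ler_wpM2r// exprn_ge0.
rewrite mulrDl lerD//; [apply: le_trans h1 _|apply: le_trans h2 _];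
  by rewrite ler_pM2l// e// ge_min lexx ?orbT.
Qed.

Lemma qsmallS r : qsmall r -> qsmall (fun n => r n.+1).
Proof.
move=> [c [q [c0 q0 [N H]]]]; exists c, q; split=> //; exists N => n nN.
apply: le_trans (H n.+1 (leqW nN)) _; rewrite ler_pM2l// ler_expR lerN2.
by rewrite ler_pM2l// ler_eXn2l// ltr1n.
Qed.

Lemma qsmall_pred r : qsmall (fun n => r n.+1) -> qsmall r.
Proof.
move=> [c [q [c0 q0 [N H]]]]; exists c, (q / 2); split=> //; first by rewrite divr_gt0.
exists N.+1 => -[//|n] nN; apply: le_trans (H n nN) _.
by rewrite ler_pM2l// exprS mulrA divfK.
Qed.

Lemma qsmall_lt r (eps : R) : qsmall r -> 0 < eps ->
  exists N, forall n, (N <= n)%N -> r n < eps.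
Proof.
move=> [c [q [c0 q0 [N H]]]] e0.
pose M := (Num.trunc (c / (q * eps))).+1.
exists (maxn N M) => n; rewrite geq_max => /andP[/H h nM].
apply: le_lt_trans h _.
have n2 : n%:R <= 2 ^+ n :> R by rewrite -natrX ler_nat ltnW// ltn_expl.
have Mn : c / (q * eps) < n%:R by apply: lt_le_trans (truncnS_gt _) _; rewrite ler_nat.
have qe : 0 < q * eps by rewrite mulr_gt0.
have h1 : c < (2 ^+ n) * (q * eps).
  by rewrite -ltr_pdivrMr//; apply: lt_le_trans n2.
have h2 := expR_ge1Dx (q * 2 ^+ n); have h3 : expR (q * 2 ^+ n) * expR (- (q * 2 ^+ n)) = 1.
  by rewrite -expRD subrr expR0.
have p0 := expR_gt0 (q * 2 ^+ n).
rewrite -(ltr_pM2l p0) mulrCA h3 mulr1 (lt_le_trans h1)//.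
rewrite mulrA ler_wpM2r ?(ltW e0)// mulrC; lra.
Qed.

(** [x exp (- q x / 2)] is bounded. *)
Lemma qsmall_pow2 r : qsmall r -> (forall n, 0 <= r n) -> qsmall (fun n => 2 ^+ n * r n).
Proof.
move=> [c [q [c0 q0 [N H]]]] r0; exists (c * (2 / q)), (q / 2).
split; [by rewrite mulr_gt0// divr_gt0|by rewrite divr_gt0|].
exists N => n /H h; set x := 2 ^+ n in h *.
have x0 : 0 <= x by rewrite exprn_ge0.
apply: (@le_trans _ _ (x * (c * expR (- (q * x))))); first by rewrite ler_wpM2l.
have -> : expR (- (q * x)) = expR (- (q / 2 * x)) * expR (- (q / 2 * x)) :> R.
  by rewrite -expRD; congr expR; field.
set E := expR (- (q / 2 * x)).
have E0 : 0 < E := expR_gt0 _.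
have h2 := expR_ge1Dx (q / 2 * x); have h3 : expR (q / 2 * x) * E = 1.
  by rewrite -expRD subrr expR0.
have h4 : q / 2 * x * E <= 1 by rewrite -[leRHS]h3 ler_wpM2r ?(ltW E0)//; lra.
have h5 : x * E <= 2 / q.
  by rewrite ler_pdivlMr//; lra.
rewrite (_ : x * (c * (E * E)) = c * (x * E) * E); last by ring.
by rewrite ler_wpM2r ?(ltW E0)// ler_pM2l.
Qed.

(** A sequence whose increments are quadratically small is quadratically close
to its limit: the tail of the increments is at most twice its first bound. *)
Lemma qsmall_tail u (l : C) : qsmall (fun n => nm (u n.+1 - u n)) -> tends u l ->
  qsmall (fun n => nm (u n - l)).
Proof.
move=> [c [q [c0 q0 [N H]]]] hu.
have [N1 H1] : exists N1, forall n, (N1 <= n)%N -> expR (- (q * 2 ^+ n)) < 1 / 2 :> R.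
  apply: (@qsmall_lt (fun n => expR (- (q * 2 ^+ n)))); last by rewrite divr_gt0.
  by exists 1, q; split=> //; exists 0%N => n _; rewrite mul1r.
exists (2 * c), q; split=> //; first by rewrite mulr_gt0.
exists (maxn N N1) => n; rewrite geq_max => /andP[nN nN1].
have Eh k : (N1 <= k)%N -> 2 * expR (- (q * 2 ^+ k.+1)) <= expR (- (q * 2 ^+ k)) :> R.
  move=> kN; have -> : expR (- (q * 2 ^+ k.+1)) = expR (- (q * 2 ^+ k)) * expR (- (q * 2 ^+ k)) :> R.
    by rewrite -expRD; congr expR; rewrite exprS; ring.
  have := H1 k kN; have := expR_gt0 (- (q * 2 ^+ k)); nra.
have step j : forall k, (N <= k)%N -> (N1 <= k)%N ->
    nm (u k - u (k + j)%N) <= 2 * c * expR (- (q * 2 ^+ k)).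
  elim: j => [|j IH] k kN kN1.
    by rewrite addn0 subrr nm0 mulr_ge0 ?expR_ge0// mulr_ge0// ltW.
  apply: le_trans (nm_tri (u k.+1) _ _) _.
  have := IH k.+1 (leqW kN) (leqW kN1); rewrite addSnnS.
  have := H k kN; rewrite nmC; have := Eh k kN1.
  move: (expR (- (q * 2 ^+ k))) (expR (- (q * 2 ^+ k.+1))) => E E' hE.
  have : c * (2 * E') <= c * E by rewrite ler_pM2l.
  lra.
have h : tends (fun k => u n - u k) (u n - l) by apply: tendsB => //; exact: tends_cst.
apply: (tends_bound h); exists n => k /subnKC <-.
exact: step.
Qed.

Definition qcvg u (l : C) := qsmall (fun n => nm (u n - l)).

Lemma qcvg_tends u l : qcvg u l -> tends u l.
Proof. by move=> h e e0; exact: qsmall_lt h e0. Qed.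

Lemma qcvg_cst l : qcvg (fun=> l) l.
Proof.
exists 1, 1; split=> //; exists 0%N => n _.
by rewrite subrr nm0 mul1r expR_ge0.
Qed.

Lemma qcvgD u v l m : qcvg u l -> qcvg v m -> qcvg (fun n => u n + v n) (l + m).
Proof.
move=> hu hv; apply: qsmall_le (qsmallD hu hv) _; exists 0%N => n _.
by rewrite (_ : _ - _ = (u n - l) + (v n - m)) ?nmD//; ring.
Qed.

Lemma qcvgM u v l m : qcvg u l -> qcvg v m -> qcvg (fun n => u n * v n) (l * m).
Proof.
move=> hu hv; have [B [N HB]] := tends_bounded (qcvg_tends hu).
apply: (@qsmall_dom _ _ (`|B| + nm m) (qsmallD hu hv)); last by rewrite addr_ge0 ?nm_ge0.
exists N => n /HB hB; have {}hB : nm (u n) <= `|B| by rewrite (le_trans hB)// ler_norm.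
rewrite (_ : _ - _ = u n * (v n - m) + (u n - l) * m); last by ring.
apply: le_trans (nmD _ _) _; rewrite !nmM.
have := nm_ge0 (u n - l); have := nm_ge0 (v n - m); have := nm_ge0 m.
have : nm (u n) * nm (v n - m) <= `|B| * nm (v n - m) by rewrite ler_wpM2r ?nm_ge0.
have := normr_ge0 B; nra.
Qed.

Lemma qcvg_near u l (eps : R) : qcvg u l -> 0 < eps ->
  exists N, forall n, (N <= n)%N -> nm (u n - l) < eps.
Proof. exact: qsmall_lt. Qed.

Lemma qcvgV u l : l != 0 -> qcvg u l -> qcvg (fun n => (u n)^-1) l^-1.
Proof.
move=> l0 hu; have nl : 0 < nm l by rewrite nm_gt0.
have [N H] := qcvg_near hu (divr_gt0 nl (ltr0n R 2) : 0 < nm l / 2).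
apply: (@qsmall_dom _ _ (2 / nm l ^+ 2) hu); last by rewrite divr_ge0// exprn_ge0// ltW.
exists N => n /H h; have low : nm l / 2 < nm (u n).
  by have := nm_sub l (u n); rewrite nmC; lra.
have u0 : 0 < nm (u n) by lra.
have un0 : u n != 0 by rewrite -nm_gt0.
rewrite (_ : _ - _ = (l - u n) / (u n * l)); last by field; rewrite un0 l0.
rewrite nmM nmV nmM nmC mulrC ler_wpM2r ?nm_ge0//.
rewrite invfM (_ : 2 / _ = (nm l / 2)^-1 * (nm l)^-1); last by field; rewrite gt_eqF.
by rewrite ler_wpM2r ?invr_ge0 ?(ltW nl)// lef_pV2 ?posrE ?divr_gt0// ltW.
Qed.

Lemma tends_geometric u (c : R) : (forall n, nm (u n.+1 - u n) <= c / 2 ^+ n) ->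
  exists l, tends u l.
Proof.
move=> hu; have c0 : 0 <= c by have := hu 0%N; rewrite expr0 divr1; apply: le_trans; exact: nm_ge0.
pose f n := u n.+1 - u n.
have B : abs_bounded [set: nat] f (2 * c).
  move=> K _; have [N hN] : exists N, forall i, i \in (K : seq nat) -> (i < N)%N.
    elim: (K : seq nat) => [|a s [N IH]]; first by exists 0%N.
    exists (maxn a.+1 N) => i; rewrite inE leq_max => /orP[/eqP ->|/IH ->]; by rewrite ?leqnn ?orbT.
  apply: (@le_trans _ _ (\sum_(i <- K) c / 2 ^+ i)); first by apply: ler_sum => i _; exact: hu.
  apply: (@le_trans _ _ (\sum_(i <- iota 0 N) c / 2 ^+ i)).
    apply: ler_sum_subset; first exact: fset_uniq.
      by move=> i /hN h; rewrite mem_iota.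
    by move=> i; rewrite divr_ge0// exprn_ge0.
  have -> : \sum_(i <- iota 0 N) c / 2 ^+ i = 2 * c - 2 * c / 2 ^+ N.
    elim: N {hN} => [|N IH]; first by rewrite big_nil expr0 divr1 subrr.
    rewrite -[in iota 0 _]addn1 iotaD big_cat IH big_seq1 add0n exprS invfM.
    by rewrite /=; field; rewrite expf_neq0.
  by rewrite lerBlDr lerDl divr_ge0 ?exprn_ge0// mulr_ge0.
have [l hl] := abs_bounded_has_sum B.
have := @has_sum_along _ _ _ _ _ (fun n => [fset x in iota 0 n]%fset) _ _ hl.
have h1 : forall n, [set` [fset x in iota 0 n]%fset] `<=` [set: nat] by [].
have h2 : forall i : nat, [set: nat] i -> exists N, forall n, (N <= n)%N -> i \in [fset x in iota 0 n]%fset.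
  by move=> i _; exists i.+1 => n hn; rewrite in_fset mem_iota.
move=> /(_ h1 h2) h; exists (u 0%N + l).
apply: tends_eq (tendsD (tends_cst (u 0%N)) h); exists 0%N => n _.
rewrite big_fset_seq ?iota_uniq// -[n in iota 0 n]subn0 (GRing.telescope_sumr u)//.
by rewrite addrC subrK.
Qed.

(** The scalar recursion behind the arithmetic-geometric mean: [D] measures the
gap between the two means and [m] bounds both from below.  The first bound yields
[D n / m n <= 5/2 (2/5) ^ (2 ^ n)] by induction, because a step changes
[D / m] into at most [2/5 (D / m) ^ 2]; the total loss of [m] is then controlled by a telescoping
comparison with [D]. *)
Lemma agm_recursion (D m : nat -> R) : (forall n, 0 <= D n) -> 0 < m 0%N -> D 0%N <= m 0%N ->
  (forall n, 0 < m n -> D n <= m n -> [/\ D n.+1 <= D n ^+ 2 / (6 * m n),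
     m n - D n / 2 - 2 * D n.+1 <= m n.+1 & 5 / 12 * m n <= m n.+1]) ->
  [/\ forall n, 0 < m n /\ D n <= m n, exists2 mu : R, 0 < mu & forall n, mu <= m n,
      forall n, D n.+1 <= D n / 2 /\ D n.+1 < m n.+1 & qsmall D].
Proof.
move=> D0 m0 Dm H.
have six n : 0 < m n -> D n <= m n -> D n.+1 <= D n / 6.
  move=> mn Dn; have [h _ _] := H n mn Dn; apply: le_trans h _.
  rewrite ler_pdivrMr ?mulr_gt0//.
  by have := D0 n; nra.
have inv n : 0 < m n /\ D n <= m n.
  elim: n => [//|n [mn Dn]]; have [_ _ h] := H n mn Dn; have := six n mn Dn; split; lra.
have [mp Dle] : (forall n, 0 < m n) /\ (forall n, D n <= m n) by split=> n; case: (inv n).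
have D6 n := six n (mp n) (Dle n).
have t n : D n <= 5 / 2 * (2 / 5) ^+ (2 ^ n) * m n.
  elim: n => [|n IH]; first by rewrite expn0 expr1; have := Dm; lra.
  have [h1 _ h3] := H n (mp n) (Dle n); apply: le_trans h1 _.
  rewrite ler_pdivrMr ?mulr_gt0//.
  set x := (2 / 5) ^+ (2 ^ n) in IH.
  have -> : (2 / 5) ^+ (2 ^ n.+1) = x * x :> R by rewrite expnS mul2n -addnn exprD.
  have x0 : 0 <= x by rewrite exprn_ge0// divr_ge0.
  have sq : D n ^+ 2 <= (5 / 2 * x * m n) ^+ 2.
    by apply: lerXn2r; rewrite ?nnegrE// (le_trans (D0 n)).
  apply: le_trans sq _.
  have : 5 / 2 * (x * x) * (5 / 12 * m n) * (6 * m n) <= 5 / 2 * (x * x) * m n.+1 * (6 * m n).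
    rewrite ler_pM2r ?mulr_gt0// ler_wpM2l// mulr_ge0// ?mulr_ge0//; lra.
  rewrite expr2; lra.
have D1 n : D n.+1 <= 2 / 5 * m n.+1.
  by have [_ _ h] := H n (mp n) (Dle n); have := D6 n; have := Dle n; lra.
split=> //.
- exists (Num.min (m 0%N) (3 / 5 * m 1%N)); first by rewrite lt_min m0 mulr_gt0// divr_gt0.
  case=> [|n]; first by rewrite ge_min lexx.
  rewrite ge_min; apply/orP; right.
  suff : m 1%N - D 1%N <= m n.+1 - D n.+1 by have := D1 0%N; have := D0 n.+1; lra.
  elim: n => [//|n IH]; apply: le_trans IH _.
  have [h1 h2 _] := H n.+1 (mp _) (Dle _).
  have : D n.+2 <= D n.+1 / 15.
    apply: le_trans h1 _; rewrite ler_pdivrMr ?mulr_gt0//.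
    by have := D1 n; have := D0 n.+1; nra.
  by have := D0 n.+1; lra.
- by move=> n; have := D6 n; have := D0 n; have := D1 n; have := mp n.+1; split; lra.
have Ddec n : D n <= D 0%N.
  by elim: n => [//|n IH]; have := D6 n; have := D0 n; lra.
apply: qsmall_pred; exists (5 / 2 * D 0%N + 1), (1 / 2); split=> //.
  by have := D0 0%N; lra.
exists 0%N => n _.
have E : (2 / 5) ^+ (2 ^ n) <= expR (- (1 / 2 * 2 ^+ n)) :> R.
  have -> : - (1 / 2 * 2 ^+ n) = (2 ^ n)%:R * - (1 / 2) :> R by rewrite natrX; ring.
  rewrite expRM_natl; apply: lerXn2r; rewrite ?nnegrE ?expR_ge0 ?divr_ge0//.
  by have := expR_ge1Dx (- (1 / 2) : R); lra.
set x := (2 / 5) ^+ (2 ^ n) in E; have x0 : 0 <= x by rewrite exprn_ge0// divr_ge0.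
have h1 : D n.+1 <= 5 / 2 * D 0%N * x.
  have [h _ _] := H n (mp n) (Dle n); apply: le_trans h _.
  rewrite ler_pdivrMr ?mulr_gt0//.
  have h2 := t n; rewrite -/x in h2.
  have : D n * D n <= D 0%N * (5 / 2 * x * m n) by rewrite ler_pM.
  have : 0 <= D 0%N * (5 / 2 * x * m n) by rewrite !mulr_ge0// ?divr_ge0// ltW.
  rewrite expr2; lra.
apply: le_trans h1 _; apply: ler_pM => //; last by lra.
by rewrite mulr_ge0 ?divr_ge0.
Qed.

End Quadratic.

(** * The chain of lattices *)

Section DuplicationProduct.
Variable R : realType.
Local Notation C := R[i].
Implicit Types (m n z : C).

(** The duplication formula with the translates of [z] eliminated by the product formula
and the denominators cleared. *)
Lemma hwp_dup_mul m n z : cross m n != 0 -> ~ lat m n z ->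
  let P := hwp m n in let x := P m in let y := P n in let w := P (m + n) in
  (4 * P (2 * z) - P z) * ((P z - x) * (P z - y) * (P z - w)) =
  (y - x) * (w - x) * ((P z - y) * (P z - w)) + (x - y) * (w - y) * ((P z - x) * (P z - w))
  + (x - w) * (y - w) * ((P z - x) * (P z - y)).
Proof.
move=> h hz P x y w; have [z1 z2 z3 z4] := lat_cosets hz.
have e1 : (P z - x) * (P (z - m) - x) = (y - x) * (w - x) := half_product h z1 z2.
have e2 : (P z - y) * (P (z - n) - y) = (x - y) * (w - y).
  have := @half_product R n m z (cross_swap h); rewrite -(hlatC m n) -(hwpC m n) (addrC n m).
  exact.
have e3 : (P z - w) * (P (z - (m + n)) - w) = (x - w) * (y - w).
  have := @half_product R (m + n) n z (cross_add h); rewrite hlat_add hwp_add -/P.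
  have -> : P (m + n + n) = x.
    apply: hwp_eq => //; first exact: hlat_m.
    by rewrite (_ : _ - _ = 2 * n); [exact: hlat_2n|ring].
  by move=> /(_ z1 z4) ->; rewrite mulrC.
rewrite -e1 -e2 -e3 hwp_dup// -/P -/x -/y -/w; ring.
Qed.

End DuplicationProduct.

Section Chain.
Variable R : realType.
Local Notation C := R[i].
Implicit Types (a b z u g : C) (ab : C * C).

(** The half periods of the next lattice: the first one is doubled, and of the
two candidates for the second one the choice is the one whose value is farther
from the value at the first.  So [value1] is the next marked root. *)
Definition landen_next ab : C * C :=
  let a := 2 * ab.1 in let b := ab.2 in
  (a, if nm (hwp a b (a + b) - hwp a b a) <= nm (hwp a b b - hwp a b a) then b else a + b).

Lemma landen_next_spec a b : cross a b != 0 ->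
  let a' := (landen_next (a, b)).1 in let b' := (landen_next (a, b)).2 in
  let P := hwp (2 * a) b in
  [/\ a' = 2 * a, b' = b \/ b' = 2 * a + b, cross a' b' != 0, hlat a' b' = hlat (2 * a) b &
   [/\ P b' + P (a' + b') = P b + P (a' + b),
      (P b' - P a') * (P (a' + b') - P a') = (P b - P a') * (P (a' + b) - P a') &
      nm (P (a' + b') - P a') <= nm (P b' - P a')]].
Proof.
move=> h a' b' P; have h' := cross_dbl h; have a'E : a' = 2 * a by [].
have [e|e] := boolP (nm (P (2 * a + b) - P (2 * a)) <= nm (P b - P (2 * a))).
  have -> : b' = b by rewrite /b' /landen_next /= e.
  by split=> //; left.
have -> : b' = 2 * a + b by rewrite /b' /landen_next /= (negbTE e).
have hl : hlat a' (2 * a + b) = hlat (2 * a) b.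
  by rewrite a'E hlatC addrC hlat_add hlatC.
have v : P (a' + (2 * a + b)) = P b.
  apply: hwp_eq => //; first exact: hlat_n.
  by rewrite a'E (_ : _ - _ = 2 * (2 * a)); [exact: hlat_2m|ring].
split=> //; first by right.
  by rewrite a'E; apply: cross_swap; rewrite addrC; apply: cross_add; exact: cross_swap.
split; rewrite v a'E; [exact: addrC|exact: mulrC|].
by rewrite ltW// ltNge.
Qed.

Variables A B : C.
Hypothesis hAB : cross A B != 0.

Definition chain n : C * C := iter n landen_next (A, B).
Local Notation pa n := (chain n).1.
Local Notation pb n := (chain n).2.
Definition chain_lat n := hlat (pa n) (pb n).
Definition chain_wp n := hwp (pa n) (pb n).
Definition value1 n := chain_wp n (pb n).
Definition value2 n := chain_wp n (pa n).
Definition value3 n := chain_wp n (pa n + pb n).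

Lemma chainS n : chain n.+1 = landen_next (pa n, pb n).
Proof. by rewrite /chain iterS -surjective_pairing. Qed.

Lemma chain_cross n : cross (pa n) (pb n) != 0.
Proof.
elim: n => [//|n IH]; rewrite chainS.
by have [_ _ h _ _] := landen_next_spec IH.
Qed.

Lemma chain_latS n : chain_lat n.+1 = hlat (2 * pa n) (pb n).
Proof.
by rewrite /chain_lat chainS; have [_ _ _ h _] := landen_next_spec (chain_cross n).
Qed.

Lemma chain_wpS n : chain_wp n.+1 = hwp (2 * pa n) (pb n).
Proof. by rewrite /chain_wp /hwp -/(chain_lat n.+1) chain_latS. Qed.

Lemma chain_lat_sub n : chain_lat n.+1 `<=` chain_lat n.
Proof. by rewrite chain_latS; exact: hlat_dbl_sub. Qed.

Lemma chain_sum n : value1 n + value2 n + value3 n = 0.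
Proof. by rewrite (addrC (value1 n)); exact: half_sum (chain_cross n). Qed.

Lemma chain_value1 n : value1 n = - 2 * value2 n.+1.
Proof.
have [e _ _ _ _] := landen_next_spec (chain_cross n).
by rewrite /value1 /value2 chain_wpS chainS e; exact: landen_value1 (chain_cross n).
Qed.

Lemma chain_prod n : 16 * ((value1 n.+1 - value2 n.+1) * (value3 n.+1 - value2 n.+1))
  = (value2 n - value3 n) ^+ 2.
Proof.
have h := chain_cross n; have [e _ _ _ [_ hp _]] := landen_next_spec h.
rewrite /value1 /value2 /value3 !chain_wpS !chainS hp e; exact: landen_value23.
Qed.

Lemma chain_far n : nm (value3 n.+1 - value2 n.+1) <= nm (value1 n.+1 - value2 n.+1).
Proof.
have h := chain_cross n; have [e _ _ _ [_ _ hp]] := landen_next_spec h.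
by rewrite /value1 /value2 /value3 !chain_wpS !chainS.
Qed.

Lemma chain_phi n z : ~ chain_lat n z -> value2 n != value3 n ->
  chain_wp n.+1 z != value2 n.+1 /\
  chain_wp n z = chain_wp n.+1 z + (value2 n - value3 n) ^+ 2 / 16 / (chain_wp n.+1 z - value2 n.+1).
Proof.
move=> hz hne; have h := chain_cross n; have [e _ _ _ _] := landen_next_spec h.
have := landen_phi h hz hne; rewrite -(chain_wpS n).
by have -> : value2 n.+1 = chain_wp n.+1 (2 * pa n) by rewrite /value2 [in pa _]chainS e.
Qed.

Hypothesis hne : value2 0 != value3 0.
Hypothesis hord : nm (value2 0 - value3 0) <= nm (value1 0 - value2 0) /\
                  nm (value2 0 - value3 0) <= nm (value1 0 - value3 0).

Lemma chain_ne n : value2 n != value3 n.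
Proof.
elim: n => [//|n IH]; have := chain_prod n.
have : (value2 n - value3 n) ^+ 2 != 0 by rewrite sqrf_eq0 subr_eq0.
move=> + e; rewrite -e !mulf_eq0 !negb_or => /and3P[_ _].
by rewrite subr_eq0 eq_sym.
Qed.

(** The gap [value2 - value3] and the smaller of the distances from [value1] obey
[agm_recursion]; the increments of [value1] are these gaps, [value2] follows
by [chain_value1], and [value3] because the three values add up to zero. *)
Theorem chain_limits : exists eps : C, [/\ eps != 0,
  qcvg value1 (- 2 * eps), qcvg value2 eps, qcvg value3 eps &
  [/\ qsmall (fun n => nm (value2 n - value3 n)),
   forall n, nm (value2 n.+1 - value3 n.+1) < nm (value1 n.+1 - value2 n.+1) &
   forall n, nm (value2 n.+1 - value3 n.+1) < nm (value1 n.+1 - value3 n.+1)]].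
Proof.
pose D n := nm (value2 n - value3 n).
pose m n := Num.min (nm (value1 n - value2 n)) (nm (value1 n - value3 n)).
have D0 : 0 < D 0%N by rewrite nm_gt0 subr_eq0.
have Dm : D 0%N <= m 0%N by rewrite le_min hord.1 hord.2.
have DE n : D n = nm ((value1 n - value2 n) - (value1 n - value3 n)).
  by rewrite /D nmC; congr nm; ring.
have [||||inv [mu mu0 hmu] hdec hq] := @agm_recursion R D m.
- by move=> n; exact: nm_ge0.
- exact: lt_le_trans Dm.
- exact: Dm.
- move=> n mn Dn.
  have m1 : m n <= nm (value1 n - value2 n) by rewrite ge_min lexx.
  have m2 : m n <= nm (value1 n - value3 n) by rewrite ge_min lexx orbT.
  have s : (value1 n.+1 - value2 n.+1) + (value3 n.+1 - value2 n.+1)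
      = ((value1 n - value2 n) + (value1 n - value3 n)) / 2.
    have s1 : value3 n = - (value1 n + value2 n).
      by apply/eqP; rewrite -addr_eq0 addrC; apply/eqP; exact: chain_sum.
    have s2 : value3 n.+1 = - (value1 n.+1 + value2 n.+1).
      by apply/eqP; rewrite -addr_eq0 addrC; apply/eqP; exact: chain_sum.
    by rewrite s1 s2 (chain_value1 n); field.
  have pr : 16 * ((value1 n.+1 - value2 n.+1) * (value3 n.+1 - value2 n.+1)) =
      ((value1 n - value2 n) - (value1 n - value3 n)) ^+ 2 by rewrite chain_prod; ring.
  have dm : nm ((value1 n - value2 n) - (value1 n - value3 n)) <= m n by rewrite -DE.
  have [q1 q2 q3 q4 q5] := agm_step mn m1 m2 dm s pr (chain_far n).
  have e : value1 n.+1 - value2 n.+1 - (value3 n.+1 - value2 n.+1) = value1 n.+1 - value3 n.+1 by ring.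
  rewrite e in q3 q5; rewrite -DE in q1 q2 q3.
  have DS : D n.+1 = nm (value3 n.+1 - value2 n.+1) by rewrite /D nmC.
  by rewrite DS; split=> //; rewrite le_min ?q2 ?q4.
have inc n : value1 n.+1 - value1 n = value2 n.+1 - value3 n.+1.
  have s2 : value3 n.+1 = - (value1 n.+1 + value2 n.+1).
    by apply/eqP; rewrite -addr_eq0 addrC; apply/eqP; exact: chain_sum.
  by rewrite s2 (chain_value1 n); ring.
have Dgeo n : D n <= D 0%N / 2 ^+ n.
  elim: n => [|n IH]; first by rewrite expr0 divr1.
  have [h _] := hdec n; apply: le_trans h _.
  have -> : D 0%N / 2 ^+ n.+1 = D 0%N / 2 ^+ n / 2 by rewrite exprS invfM; ring.
  lra.
have [X hX] : exists X, tends value1 X.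
  apply: (@tends_geometric _ _ (D 0%N)) => n; rewrite inc.
  by have [h _] := hdec n; have := Dgeo n; have := nm_ge0 (value2 n - value3 n); rewrite -/(D n.+1) -/(D n) in h *; lra.
have qX : qcvg value1 X.
  apply: qsmall_tail hX; apply: qsmall_le (qsmallS hq) _.
  by exists 0%N => n _; rewrite inc.
have X0 : X != 0.
  apply/eqP => e; have [N hN] := hX (mu / 3) (divr_gt0 mu0 (ltr0n _ 3)).
  have := hN N (leqnn _); rewrite e subr0.
  have m1 : m N <= nm (value1 N - value2 N) by rewrite ge_min lexx.
  have := hmu N; have [_] := inv N; rewrite DE.
  set al := value1 N - value2 N in m1 *; set be := value1 N - value3 N => h1 h2 h3.
  have s1 : 3 * value1 N = 2 * al - (al - be).
    have s : value3 N = - (value1 N + value2 N).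
      by apply/eqP; rewrite -addr_eq0 addrC; apply/eqP; exact: chain_sum.
    by rewrite /al /be s; ring.
  have := nm_sub (2 * al) (al - be); rewrite -s1 !nmM !nm_nat; lra.
have n2 : (2 : C) != 0 by rewrite pnatr_eq0.
pose eps := - X / 2.
have XE : X = - 2 * eps by rewrite /eps; field.
have q2 : qcvg value2 eps.
  apply: qsmall_pred; apply: qsmall_le qX _; exists 0%N => n _.
  have -> : value2 n.+1 - eps = (value1 n - X) * (- 2^-1) by rewrite chain_value1 /eps; field.
  rewrite nmM nmN nmV nm_nat; have := nm_ge0 (value1 n - X); lra.
exists eps; split.
- by rewrite mulf_neq0 ?oppr_eq0// invr_eq0.
- by rewrite -XE.
- exact: q2.
- have h := qcvgM (qcvg_cst (-1)) (qcvgD qX q2).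
  have -> : eps = -1 * (X + eps) by rewrite XE; ring.
  apply: qsmall_le h _; exists 0%N => n _.
  by rewrite (_ : value3 n = -1 * (value1 n + value2 n))// mulN1r; apply/eqP; rewrite -addr_eq0 addrC; apply/eqP; exact: chain_sum.
split=> //.
- by move=> n; have [_] := hdec n; rewrite lt_min => /andP[].
- by move=> n; have [_] := hdec n; rewrite lt_min => /andP[].
Qed.

End Chain.

(** * The limit of the chain *)

Section ChainLimit.
Variable R : realType.
Local Notation C := R[i].
Implicit Types (a b z u v g w : C).

Lemma tends_shift (f : nat -> C) (l : C) N : tends (fun n => f (N + n)%N) l -> tends f l.
Proof.
move=> h e e0; have [M HM] := h e e0; exists (N + M)%N => n nM.
have -> : n = (N + (n - N))%N by lia.
apply: HM; lia.
Qed.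

(** The coordinate along [b] is injective on [E], which it embeds in the integers. *)
Lemma sub_multiples a b (E : set C) : cross a b != 0 -> E `<=` lat a b -> E 0 ->
  (forall u v, E u -> E v -> E (u - v)) -> (forall m : int, E (a *~ m) -> m = 0) ->
  exists g, E = multiples g.
Proof.
move=> h EL E0 EB Ea.
have EN u : E u -> E (- u) by move=> hu; rewrite -sub0r; apply: EB.
have ED u v : E u -> E v -> E (u + v) by move=> hu /EN hv; rewrite -[v]opprK; apply: EB.
have EZ u (k : int) : E u -> E (u *~ k).
  move=> hu; have pos (j : nat) : E (u *+ j).
    by elim: j => [|j IH]; rewrite ?mulr0n// mulrS; apply: ED.
  by case: k => j; rewrite ?NegzE ?mulrNz; [exact: pos|apply: EN; exact: pos].
pose Q (k : nat) := `[<(0 < k)%N /\ exists m : int, E (a *~ m + b *~ k%:Z)>].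
have [exQ|noQ] := pselect (exists k, Q k); last first.
  exists 0; apply/seteqP; split=> [u hu|_ [n ->]]; last by rewrite mul0rz.
  have [m [k e]] := EL u hu; have [k0|k0] := eqVneq k 0.
    move: hu; rewrite e k0 mulr0z addr0 => /Ea ->; exists 0.
    by rewrite !mulr0z.
  case: noQ; exists (absz k); apply/asboolP; split; first by rewrite absz_gt0.
  have [kp|kn] := leP 0 k.
    by exists m; rewrite gez0_abs// -e.
  exists (- m); rewrite ltz0_abs// !mulrNz -opprD -e; exact: EN.
have [d /asboolP[d0 [m0 hg]] dmin] := ex_minnP exQ.
exists (a *~ m0 + b *~ d%:Z); apply/seteqP; split=> [u hu|_ [n ->]]; last exact: EZ.
have [m [k e]] := EL u hu; pose q := (k %/ d%:Z)%Z; pose r := (k %% d%:Z)%Z.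
have dz : d%:Z != 0 :> int by rewrite eqz_nat -lt0n.
have kE : k = q * d%:Z + r by exact: divz_eq.
have r0 : 0 <= r by exact: modz_ge0.
have rd : r < d%:Z by rewrite ltz_pmod// ltz_nat.
have hr : E (a *~ (m - m0 * q) + b *~ r).
  have := EB _ _ hu (EZ _ q hg); rewrite e kE; congr E.
  rewrite mulrzDl_tmp -!mulrzA mulrzBr (mulrC q) mulrzDr_tmp; ring.
have r00 : r = 0.
  apply/eqP; apply: contraTT isT => rn0; have : Q (absz r).
    apply/asboolP; split; first by rewrite absz_gt0.
    by exists (m - m0 * q); rewrite gez0_abs.
  by move=> /dmin; lia.
exists q; rewrite r00 mulr0z addr0 in hr; have m0E := Ea _ hr.
rewrite e kE r00 addr0 (_ : m = m0 * q); last by lia.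
by rewrite mulrzDl_tmp -!mulrzA (mulrC q).
Qed.

Section WithChain.
Variables A B : C.
Hypothesis hAB : cross A B != 0.
Local Notation pa n := (chain A B n).1.
Local Notation pb n := (chain A B n).2.
Local Notation cl := (chain_lat A B).
Local Notation cw := (chain_wp A B).

(** This puts all the lattices of the chain in coordinates with respect to one basis. *)
Lemma chain_coord n : exists s : int, pa n = A *~ (2 ^ n)%N /\ pb n = B + A *~ s.
Proof.
elim: n => [|n [s [ea eb]]]; first by exists 0; rewrite mulr0z addr0 mulr1z.
have h := chain_cross hAB n; have [e1 e2 _ _ _] := landen_next_spec h.
have ea' : 2 * pa n = A *~ (2 ^ n.+1)%N.
  rewrite ea.
  have -> : 2 * (A *~ (2 ^ n)%N) = (2 * A) *~ (2 ^ n)%N by rewrite mulrzAr.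
  by rewrite expnS PoszM mulrzA mulr_natl.
rewrite chainS e1; case: e2 => ->; first by exists s; rewrite ea' eb.
by exists (s + (2 ^ n.+1)%N); split; rewrite // ea' eb mulrzDr_tmp; ring.
Qed.

Definition chain_inf : set C := [set u | forall n, cl n u].

Lemma chain_lat_le n k : (n <= k)%N -> cl k `<=` cl n.
Proof.
move=> /subnK <-; elim: (k - n)%N => [|j IH]; first exact: subset_refl.
rewrite addSn; apply: subset_trans IH; exact: chain_lat_sub.
Qed.

(** A multiple [2 A m] in all lattices of the chain has its coefficient [m] divisible by
[2 ^ n] for all [n], so [sub_multiples] applies. *)
Lemma chain_inf_multiples : exists g, chain_inf = multiples g.
Proof.
have h2 := cross_hlat hAB.
apply: (sub_multiples h2).
- by move=> u /(_ 0%N).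
- by move=> n; exact: hlat0.
- move=> u v hu hv n; exact: latB (hu n) (hv n).
move=> m hm; have [s [ea eb]] := chain_coord (absz m).
have [i [j e]] := hm (absz m).
have : (2 * A) *~ m + (2 * B) *~ 0 = (2 * A) *~ ((2 ^ absz m)%N%:Z * i + s * j) + (2 * B) *~ j.
  have D2 (x : C) (k : int) : 2 * (x *~ k) = (2 * x) *~ k by rewrite mulrzAr.
  rewrite mulr0z addr0 e ea eb mulrzDr_tmp !mulrzA mulrDr !D2 mulrzDl_tmp.
  by rewrite addrA addrAC.
move=> /(lat_coord h2)[e1 e2].
have : (absz m < 2 ^ absz m)%N by exact: ltn_expl.
move: e1; rewrite -e2 mulr0 addr0 => e1.
have : absz m = (2 ^ absz m * absz i)%N by rewrite {1}e1 abszM.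
have [->|i0] := eqVneq i 0; first by lia.
have : (0 < absz i)%N by rewrite absz_gt0.
by move=> ? ? ?; exfalso; nia.
Qed.

Lemma chain_sparse n : sparse (cl n).
Proof. exact: sparse_lat (cross_hlat (chain_cross hAB n)). Qed.

Lemma chain_inf_sub n : chain_inf `<=` cl n.
Proof. by move=> u; apply. Qed.

(** Dominated convergence over the decreasing lattices of the chain. *)
Lemma chain_wp_tends z : ~ chain_inf z -> tends (fun n => cw n z) (wps chain_inf z).
Proof.
move=> hz; have [N hN] : exists N, ~ cl N z by exact/existsNP.
apply: (@tends_shift _ _ N).
have hE := sparse_sub (@chain_inf_sub N) (chain_sparse N).
have E0 : chain_inf 0 by move=> n; exact: hlat0.
have hzn n : ~ cl (N + n)%N z by move=> /(chain_lat_le (leq_addr n N)).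
have D (L : set C) : ~ L z -> ~ (L `\ 0) z by move=> hL [].
have [Bd hB] := wpt_bounded (chain_sparse N) (hlat0 _ _) (D _ hN).
have t : tends (fun n => hsum (cl (N + n)%N `\ 0) (wpt z)) (hsum (chain_inf `\ 0) (wpt z)).
  apply: (has_sum_decreasing hB (D := fun n => cl (N + n)%N `\ 0)).
  - by move=> n u [/(chain_lat_le (leq_addr n N)) ? ?].
  - by move=> n u []; rewrite addnS => /(chain_lat_sub hAB) ? ?.
  - by move=> n; apply: wpt_sum; [exact: chain_sparse|exact: hlat0|exact: D].
  have -> : [set i | forall n, (cl (N + n)%N `\ 0) i] = chain_inf `\ 0.
    apply/seteqP; split=> u.
      move=> hu; split; last by case: (hu 0%N).
      move=> n; have [h _] := hu n; apply: chain_lat_le h; exact: leq_addl.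
    by move=> [hu u0] n; split.
  by apply: wpt_sum => //; exact: D.
exact: tendsD (tends_cst _) t.
Qed.

Variable eps : C.
Hypothesis eps0 : eps != 0.
Hypothesis lim1 : tends (value1 A B) (- 2 * eps).
Hypothesis lim2 : tends (value2 A B) eps.
Hypothesis lim3 : tends (value3 A B) eps.

(** In the limit two of the three values coincide, and the duplication formula acquires the
factor [(y - eps) ^ 2]. *)
Lemma limit_duplication z : ~ chain_inf z -> ~ chain_inf (2 * z) ->
  let y := wps chain_inf z in
  y = eps \/ (4 * wps chain_inf (2 * z) - y) * (y + 2 * eps) = 9 * eps ^+ 2.
Proof.
move=> hz hz2 y; have t1 := chain_wp_tends hz; have t2 := chain_wp_tends hz2.
have c (k : C) : tends (fun=> k) k := tends_cst k.
have d1 := tendsB t1 lim1; have d2 := tendsB t1 lim2; have d3 := tendsB t1 lim3.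
have l := tendsM (tendsB (tendsM (c 4) t2) t1) (tendsM (tendsM d2 d1) d3).
have r := tendsD (tendsD
  (tendsM (tendsM (tendsB lim1 lim2) (tendsB lim3 lim2)) (tendsM d1 d3))
  (tendsM (tendsM (tendsB lim2 lim1) (tendsB lim3 lim1)) (tendsM d2 d3)))
  (tendsM (tendsM (tendsB lim2 lim3) (tendsB lim1 lim3)) (tendsM d2 d1)).
have [N hN] : exists N, ~ cl N (2 * z) by exact/existsNP.
have e : exists N, forall n, (N <= n)%N ->
   (4 * cw n (2 * z) - cw n z) * ((cw n z - value2 A B n) * (cw n z - value1 A B n) * (cw n z - value3 A B n))
   = (value1 A B n - value2 A B n) * (value3 A B n - value2 A B n) * ((cw n z - value1 A B n) * (cw n z - value3 A B n))
   + (value2 A B n - value1 A B n) * (value3 A B n - value1 A B n) * ((cw n z - value2 A B n) * (cw n z - value3 A B n))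
   + (value2 A B n - value3 A B n) * (value1 A B n - value3 A B n) * ((cw n z - value2 A B n) * (cw n z - value1 A B n)).
  exists N => n nN; apply: (hwp_dup_mul (chain_cross hAB n)).
  by move/lat_hlat => h; apply: hN; apply: (chain_lat_le nN).
have := tends_uniq (tends_eq e l) r; rewrite -/y; set y2 := wps _ (2 * z) => E.
have : (y - eps) ^+ 2 * ((4 * y2 - y) * (y + 2 * eps) - 9 * eps ^+ 2) = 0.
  transitivity ((4 * y2 - y) * ((y - eps) * (y - - 2 * eps) * (y - eps)) - 9 * eps ^+ 2 * (y - eps) ^+ 2); first by ring.
  by rewrite E; ring.
move=> /eqP; rewrite mulf_eq0 sqrf_eq0 !subr_eq0 => /orP[/eqP|/eqP]; [left|right] => //.
Qed.

(** [sin (i t) ^ 2]: an explicit infinite family of distinct values of [sin ^ 2]. *)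
Definition sinh_test (t : R) : C := csin (0 +i* t) ^+ 2.

Lemma sinh_testE (t : R) : sinh_test t = - ((((expR t - expR (- t)) / 2) ^+ 2)%:C).
Proof.
rewrite /sinh_test csinE sin0 cos0 mulr0 mulr1.
by apply/eqP; rewrite expr2 eq_complex /= expr2; apply/andP; split; apply/eqP; ring.
Qed.

Lemma sinh_test_inj (s t : R) : 0 < s -> s < t -> sinh_test s != sinh_test t.
Proof.
move=> s0 st; rewrite !sinh_testE eqr_opp; apply/eqP => /complexI.
have h1 : expR s < expR t by rewrite ltr_expR.
have h2 : expR (- t) < expR (- s) by rewrite ltr_expR ltrN2.
have h3 : expR (- s) < expR s by rewrite ltr_expR; lra.
set x := (expR s - _) / 2; set y := (expR t - _) / 2.
have xy : x < y by rewrite /x /y; lra.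
have x0 : 0 < x by rewrite /x; lra.
have : x ^+ 2 < y ^+ 2 by rewrite ltr_pXn2r ?nnegrE//; lra.
by move=> + e; rewrite e ltxx.
Qed.

(** The limit function is known twice: as a trigonometric function of the
limit period [g], and through its duplication formula, which involves [eps].
If [g = 0] it is [1 / z ^ 2], for which the duplication formula fails.  Otherwise, put
[k = (pi / g) ^ 2] and [s = sin (pi z / g) ^ 2]: if [k + 3 eps] is nonzero, then
[s] satisfies one of two linear equations, each of which has at most one solution, and
three values of [s] contradict this. *)
Theorem limit_value g : chain_inf = multiples g ->
  g != 0 /\ eps = - (pi%:C / g) ^+ 2 / 3.
Proof.
move=> Eg.
have g0 : g != 0.
  apply/eqP => g0; have E0 : chain_inf = [set 0].
    rewrite Eg g0; apply/seteqP; split=> [_ [n ->]|_ ->]; first by rewrite mul0rz.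
    by exists 0; rewrite mulr0z.
  have wE z : wps chain_inf z = 1 / z ^+ 2.
    rewrite /wps E0 setDv (hsumE (has_sum_set0 _)) addr0 //.
  have key z : z != 0 -> 1 / z ^+ 2 = eps.
    move=> z0; have n2 : (2 : C) != 0 by rewrite pnatr_eq0.
    have hz w : w != 0 -> ~ chain_inf w by rewrite E0 => w0 /= e; rewrite e eqxx in w0.
    have := limit_duplication (hz z z0) (hz (2 * z) (mulf_neq0 n2 z0)).
    rewrite !wE => -[//|].
    have -> : 4 * (1 / (2 * z) ^+ 2) - 1 / z ^+ 2 = 0 by field.
    rewrite mul0r => /esym/eqP; rewrite mulf_eq0 pnatr_eq0 sqrf_eq0 (negbTE eps0).
    by [].
  have k1 := key 1 (oner_neq0 _); have n2 : (2 : C) != 0 by rewrite pnatr_eq0.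
  have := key 2 n2; rewrite -k1 expr1n divr1 => e.
  have n3 : (3 : C) != 0 by rewrite pnatr_eq0.
  have e4 : 4 * (1 / (2 : C) ^+ 2) = 1 by field.
  rewrite e mulr1 in e4.
  have : (3 : C) = 0 by rewrite -(subrr 1) -[X in X - 1]e4; ring.
  by move/eqP; rewrite (negbTE n3).
split=> //.
pose k := (pi%:C / g) ^+ 2.
have k0 : k != 0 by rewrite sqrf_eq0 mulf_neq0 ?invr_eq0// pi_neq0.
have n3 : (3 : C) != 0 by rewrite pnatr_eq0.
suff : k + 3 * eps = 0.
  by move=> /eqP; rewrite addrC addr_eq0 => /eqP h; apply: (mulfI n3); rewrite h /k; field.
apply/eqP; apply: contraT => kn.
have key (t : R) : 0 < t -> sinh_test t * (k + 3 * eps) = 3 * k \/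
    3 * (k - 3 * eps) = sinh_test t * (k - 9 * eps).
  move=> t0; pose z := (0 +i* t) * g / pi%:C.
  have p0 := @pi_neq0 R.
  have cancel (P x : C) : P != 0 -> P * (x * g / P) / g = x.
    by move=> P0; field; rewrite ?P0 ?g0.
  have wz : pi%:C * z / g = 0 +i* t := cancel _ _ p0.
  have wz2 : pi%:C * (2 * z) / g = 2 * (0 +i* t) by rewrite /z !mulrA -(cancel _ (2 * (0 +i* t)) p0) !mulrA.
  have notin (s : R) : 0 < s -> ~ multiples g ((0 +i* s) * g / pi%:C).
    move=> s0 [n e].
    have : (0 +i* s) = (pi * n%:~R)%:C.
      rewrite -[LHS](cancel _ _ p0) e rmorphM rmorph_int -(mulrzr g).
      by rewrite mulrCA mulrAC divff// mul1r.
    by move/(congr1 (fun x : C => complex.Im x)) => /= s1; rewrite s1 ltxx in s0.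
  have h1 : ~ chain_inf z by rewrite Eg; exact: notin.
  have h2 : ~ chain_inf (2 * z).
    have -> : 2 * z = (0 +i* (t + t)) * g / pi%:C.
      have -> : 0 +i* (t + t) = 2 * (0 +i* t) :> C.
        by rewrite mulr_natl; apply/eqP; rewrite eq_complex /= addr0 !eqxx.
      by rewrite /z !mulrA.
    by rewrite Eg; apply: notin; exact: addr_gt0.
  have := limit_duplication h1 h2; rewrite Eg in h1 h2 *.
  have [s0 ->] := wps_multiples g0 h1; have [s20 ->] := wps_multiples g0 h2.
  rewrite wz2 wz in s0 s20 *; rewrite -/k.
  have e2 : csin (2 * (0 +i* t)) ^+ 2 = 4 * (sinh_test t * (1 - sinh_test t)).
    have := csin_sqr (0 +i* t); rewrite csin2 /sinh_test.
    move: (csin (0 +i* t)) (csin (0 +i* t + _)) => x y xy.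
    have -> : 1 - x ^+ 2 = y ^+ 2 by rewrite -xy addrAC subrr add0r.
    ring.
  have st0 : sinh_test t != 0 by rewrite sqrf_eq0.
  have st1 : 1 - sinh_test t != 0.
    by apply: contraNneq s20 => e; rewrite -sqrf_eq0 e2 e !mulr0.
  rewrite e2 -/(sinh_test t); set s := sinh_test t in st0 st1 *.
  move=> [e|e]; [left|right].
    by rewrite -e; field.
  have e3 : (k + 3 * eps) * (3 * (k - 3 * eps) - s * (k - 9 * eps)) = 0.
    transitivity (3 * (1 - s) * ((4 * (k * (1 / (4 * (s * (1 - s))) - 1 / 3)) - k * (1 / s - 1 / 3)) *
        (k * (1 / s - 1 / 3) + 2 * eps) - 9 * eps ^+ 2)).
      by field; rewrite st0 st1.
    by rewrite e subrr mulr0.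
  by move/eqP: e3; rewrite mulf_eq0 (negbTE kn) subr_eq0 => /eqP.
have ne (s t : R) : 0 < s -> s < t -> sinh_test s - sinh_test t != 0.
  by move=> s0 st; rewrite subr_eq0 sinh_test_inj.
have same1 (s t : R) : 0 < s -> s < t -> sinh_test s * (k + 3 * eps) = 3 * k ->
    sinh_test t * (k + 3 * eps) = 3 * k -> False.
  move=> s0 st e1 e2; have : (sinh_test s - sinh_test t) * (k + 3 * eps) = 0.
    by rewrite mulrBl e1 e2 subrr.
  by move/eqP; rewrite mulf_eq0 (negbTE kn) (negbTE (ne _ _ s0 st)).
have same2 (s t : R) : 0 < s -> s < t -> 3 * (k - 3 * eps) = sinh_test s * (k - 9 * eps) ->
    3 * (k - 3 * eps) = sinh_test t * (k - 9 * eps) -> False.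
  move=> s0 st e1 e2; have : (sinh_test s - sinh_test t) * (k - 9 * eps) = 0.
    by rewrite mulrBl -e1 -e2 subrr.
  move/eqP; rewrite mulf_eq0 (negbTE (ne _ _ s0 st)) /= => /eqP e.
  move: e1; rewrite e mulr0 => e3.
  have : 18 * eps = 0.
    transitivity (3 * (k - 3 * eps) - 3 * (k - 9 * eps)); first by ring.
    by rewrite e3 e mulr0 subrr.
  by move/eqP; rewrite mulf_eq0 pnatr_eq0 (negbTE eps0).
have p1 : (0 : R) < 1 := ltr01. have p2 : (0 : R) < 2 := ltr0n _ 2.
have p3 : (0 : R) < 3 := ltr0n _ 3.
have l12 : (1 : R) < 2 by rewrite ltr1n.
have l13 : (1 : R) < 3 by rewrite ltr1n.
have l23 : (2 : R) < 3 by rewrite ltr_nat.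
exfalso.
case: (key 1 p1) (key 2 p2) (key 3 p3) => a1 [] a2 [] a3;
  solve [exact: (same1 1 2)|exact: (same1 1 3)|exact: (same1 2 3)|
         exact: (same2 1 2)|exact: (same2 1 3)|exact: (same2 2 3)].
Qed.

End WithChain.
End ChainLimit.

(** * Lattices and lattice sums in the sense of the statement *)

Section Bridge.
Variable R : realType.
Local Notation C := R[i].
Implicit Types (G : set C) (f : C -> C) (u v z : C).

(** The two notions of an unordered sum differ in the index type only. *)
Lemma lattice_sumE G f (l : C) : has_sum (G `\ 0) f l -> lattice_sum G f = l.
Proof.
move=> h; rewrite /lattice_sum /summability.sum.
pose F : {fset (G `\ 0 : set C)} -> (R[i])^o :=
  summability.partial_sum (fun u : (G `\ 0 : set C) => f (\val u) : C^o).
have Ft := @summability.totally_filter (G `\ 0 : set C).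
suff HF : F @ summability.totally --> (l : C^o).
  exact: (@cvg_lim C^o (@norm_hausdorff _ _) _ _ _ _ _ HF).
have [_ Hc] := @cvgrPdist_lt _ _ _ _ Ft F (l : C^o).
apply: Hc => e e0.
have [e1 e10 ee] : exists2 e1 : R, 0 < e1 & e = e1%:C.
  have := e0; rewrite ltcE /= => /andP[/eqP i0 r0]; exists (complex.Re e) => //.
  by case: (e) i0 => a b /= ->.
have [J [JG HJ]] := h e1 e10; rewrite ee.
pose s0 : seq (G `\ 0 : set C) := pmap (fun u : C => insub u) (enum_fset J).
pose A0 := [fset x in s0]%fset.
exists A0 => //= B AB /=.
pose K := [fset \val i | i in B]%fset.
have -> : F B = \sum_(u <- K) f u.
  rewrite /F /summability.partial_sum [RHS]big_imfset /=; last by move=> x y _ _; exact: val_inj.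
  by rewrite [RHS]big_seq_fsetE.
have -> : `|l - \sum_(u <- K) f u : C^o| = `|l - \sum_(u <- K) f u : C| by [].
rewrite normE ltcR nmC; apply: HJ.
  apply/fsubsetP => u uJ; apply/imfsetP.
  have uG : u \in (G `\ 0 : set C) by apply/mem_set/JG.
  exists (Sub u uG) => //=; apply: (fsubsetP AB).
  by rewrite in_fset /s0 mem_pmap; apply/mapP; exists u => //; rewrite insubT.
move=> _ /imfsetP[i /= _ ->]; have := set_valP i.
by [].
Qed.

(** If the generators were proportional over the reals, the lattice would be a
discrete group of multiples of one number, and discrete subgroups of the line
are cyclic, so the generators would be dependent over the integers. *)
Lemma lattice_cross G : is_lattice G ->
  exists w1 w2 : C, cross w1 w2 != 0 /\ G = lat w1 w2.
Proof.
move=> [_ [r r0 hr] [w1 [w2 [GE ind]]]]; exists w1, w2; split=> //.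
apply/eqP => h0.
have w20 : w2 != 0.
  apply/eqP => e; have [] := ind 0 1; last by [].
  by rewrite mulr0z mulr1z e addr0.
have [l hl] : exists l : R, w1 = l%:C * w2.
  exists ((complex.Re w1 * complex.Re w2 + complex.Im w1 * complex.Im w2) / nm w2 ^+ 2).
  have n0 : nm w2 ^+ 2 != 0 by rewrite sqrf_eq0 nm_eq0.
  move: n0 h0; rewrite sqr_nm /cross; case: (w1) (w2) => p q [a b] /= n0 /eqP.
  rewrite subr_eq0 => /eqP h0; apply/eqP; rewrite eq_complex /= !mul0r subr0 addr0.
  apply/andP; split; apply/eqP; apply: (mulIf n0); rewrite [RHS]mulrAC divfK//.
    rewrite (_ : (p * a + q * b) * a = p * a ^+ 2 + q * a * b); last by ring.
    by rewrite -h0; ring.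
  rewrite (_ : (p * a + q * b) * b = p * b * a + q * b ^+ 2); last by ring.
  by rewrite h0; ring.
pose T : set R := [set t | 0 < t /\ exists m n : int, t = l * m%:~R + n%:~R].
have n2 : 0 < nm w2 by rewrite nm_gt0.
have GT (m n : int) : w1 *~ m + w2 *~ n = (l * m%:~R + n%:~R)%:C * w2.
  rewrite -(mulrzr w1) -(mulrzr w2) hl rmorphD rmorphM !rmorph_int.
  by rewrite [RHS]mulrDl [w2 * _]mulrC; congr (_ + _); rewrite mulrAC.
pose rho := r / nm w2; have rho0 : 0 < rho by rewrite divr_gt0.
have Tlow t : T t -> rho <= t.
  move=> [t0 [m [n e]]]; rewrite /rho ler_pdivrMr//.
  have : G (t%:C * w2) by rewrite GE; exists m, n; rewrite GT e.
  move=> /hr; rewrite mulf_neq0//; last by rewrite eq_complex /= negb_and gt_eqF.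
  by move=> /(_ isT); rewrite normE lecR nmM nm_real gtr0_norm.
have T1 : T 1 by split=> //; exists 0, 1; rewrite mulr0 add0r.
have Ti : has_inf T by split; [exists 1|exists rho => t /Tlow].
have [t Tt tlt] := inf_adherent rho0 Ti.
have t0 : 0 < t := Tt.1.
have cyc (m n : int) : exists k : int, l * m%:~R + n%:~R = t * k%:~R.
  set x := _ + _; exists (Num.floor (x / t)); set k := Num.floor _.
  have [m1 [n1 et]] := Tt.2.
  have k1 : t * k%:~R <= x by rewrite mulrC -ler_pdivlMr// floor_le.
  have k2 : x < t * k%:~R + t.
    have := floorD1_gt (x / t); rewrite -/k ltr_pdivrMr// => h; apply: lt_le_trans h _.
    by rewrite intrD mulrDl mul1r [t * _]mulrC.
  apply/eqP; apply: contraT => xk.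
  have Tx : T (x - t * k%:~R).
    split; first by rewrite subr_gt0 lt_neqAle eq_sym xk.
    exists (m - m1 * k), (n - n1 * k); rewrite {1}et /x !(intrB, intrM); ring.
  have Ts : T (t - (x - t * k%:~R)).
    split; first by lra.
    have [m2 [n2' e2]] := Tx.2; exists (m1 - m2), (n1 - n2').
    rewrite {1}et e2 !intrB; ring.
  have := Tlow _ Ts; have := inf_lbound Ti.2 Tx; lra.
have [k1 e1] := cyc 1 0; have [k2 e2] := cyc 0 1.
rewrite mulr1 addr0 in e1; rewrite mulr0 add0r in e2.
have [] := ind k2 (- k1).
  have -> : w1 *~ k2 + w2 *~ (- k1) = (l * k2%:~R - k1%:~R)%:C * w2.
    by rewrite GT rmorphN.
  rewrite e1 mulrAC -e2 mul1r subrr; exact: mul0r.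
by move=> k20; move: e2; rewrite k20 mulr0 => /eqP; rewrite oner_eq0.
Qed.

End Bridge.

(** * The roots of the Weierstrass cubic *)

Section Roots.
Variable R : realType.
Local Notation C := R[i].
Implicit Types (G : set C) (m n x y z : C).

Lemma root_cubicE G x (a4 a6 : C) :
  has_sum (G `\ 0) (fun u => u ^- 4) a4 -> has_sum (G `\ 0) (fun u => u ^- 6) a6 ->
  root (weierstrass_cubic G) x -> 4 * x ^+ 3 - 60 * a4 * x - 140 * a6 = 0.
Proof.
move=> h4 h6; have -> : 60 * a4 = g2 G by apply/esym/lattice_sumE; exact: has_sumZ.
have -> : 140 * a6 = g3 G by apply/esym/lattice_sumE; exact: has_sumZ.
by rewrite rootE /weierstrass_cubic !(hornerD, hornerN, hornerZ, hornerXn, hornerX, hornerC) => /eqP.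
Qed.

(** The half periods can be renamed so that the marked root belongs to the second
generator, the position of [value1] in a chain. *)
Lemma lattice_half_periods G (e1 e2 e3 : C) : is_lattice G ->
  uniq [:: e1; e2; e3] -> all (root (weierstrass_cubic G)) [:: e1; e2; e3] ->
  exists A B : C, [/\ cross A B != 0, G = hlat A B, e1 = hwp A B B &
    upair e2 e3 = upair (hwp A B A) (hwp A B (A + B))].
Proof.
move=> hG un rt; have [w1 [w2 [h12 GE]]] := lattice_cross hG.
pose m := w1 / 2; pose n := w2 / 2.
have d2 (w : C) : 2 * (w / 2) = w by rewrite mulrC divfK// pnatr_eq0.
have Gmn : G = hlat m n by rewrite GE /hlat !d2.
have h : cross m n != 0 by rewrite -cross2l -cross2r !d2.
have [a4 [a6 [h4 h6 _]]] := wps_expansion0 (sparse_lat (cross_hlat h)) (lat0 _ _) (fun u => @latN _ _ _ u).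
have [i4 i6] := half_invariants h h4 h6; have s := half_sum h.
rewrite -/(hlat m n) -Gmn in h4 h6.
set X := hwp m n m in i4 i6 s; set Y := hwp m n n in i4 i6 s; set W := hwp m n (m + n) in i4 i6 s.
have sub : {subset [:: e1; e2; e3] <= [:: X; Y; W]}.
  move=> x /(allP rt)/(root_cubicE h4 h6); rewrite i4 i6 => e.
  have : 4 * ((x - X) * (x - Y) * (x - W)) = 0.
    have WE : W = - (X + Y) by apply/eqP; rewrite -addr_eq0 addrC; apply/eqP.
    by rewrite -e WE; ring.
  move/eqP; rewrite !mulf_eq0 pnatr_eq0 /= !subr_eq0 => /orP[/orP[]|] /eqP ->;
    by rewrite !inE eqxx ?orbT.
have [_ eqi] := uniq_min_size un sub (leqnn _).
have pe : perm_eq [:: X; Y; W] [:: e1; e2; e3].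
  rewrite perm_sym; apply: uniq_perm => //.
  by rewrite -(@eq_uniq _ [:: e1; e2; e3] [:: X; Y; W] (erefl _) eqi).
have up (a b c d : C) : perm_eq [:: a; b] [:: c; d] -> upair c d = upair a b.
  by move=> /perm_eq2 [] [-> ->] //; exact: upairC.
case: (perm_eq3 pe) => -[-> /up ->].
- exists n, m; rewrite hlatC hwpC addrC; split=> //; exact: cross_swap.
- by exists m, n.
exists n, (m + n).
have hs := cross_swap (cross_add h).
rewrite hlatC hlat_add hwpC hwp_add; split=> //.
rewrite upairC; congr upair; apply: esym; apply: hwp_eq => //; first exact: hlat_m.
by rewrite (_ : _ - _ = 2 * n); [exact: hlat_2n|ring].
Qed.

End Roots.

(** * The sequence of triples *)

Section LandenSequence.
Variable R : realType.
Local Notation C := R[i].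
Implicit Types (a b c w x y z : C).

(** The Landen map turns the values of one lattice of the chain into those of the next,
and the strict inequalities say that the root to be marked is [value1]. *)
Lemma landen_sequence (A B : C) (e : nat -> C * unordered C 2) : cross A B != 0 ->
  (forall n, nm (value2 A B n.+1 - value3 A B n.+1) < nm (value1 A B n.+1 - value2 A B n.+1)) ->
  (forall n, nm (value2 A B n.+1 - value3 A B n.+1) < nm (value1 A B n.+1 - value3 A B n.+1)) ->
  e 1%N = landen (value1 A B 0, upair (value2 A B 0) (value3 A B 0)) ->
  (forall n, (2 <= n)%N -> e n = landen_tilde (forget_mark (e n.-1))) ->
  forall n, e n.+1 = (value2 A B n.+1, upair (value1 A B n.+1) (value3 A B n.+1)).
Proof.
move=> h h1 h2 e1 es.
have L n : landen (value1 A B n, upair (value2 A B n) (value3 A B n)) =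
    (value2 A B n.+1, upair (value1 A B n.+1) (value3 A B n.+1)).
  have n2 : (2 : C) != 0 by rewrite pnatr_eq0.
  apply: landenE.
  - by rewrite chain_value1// mulNr opprK mulrAC divff// mul1r.
  - by rewrite [X in X + _]addrC; exact: chain_sum.
  by rewrite -mulrA; exact: chain_prod.
elim=> [|n IH]; first by rewrite e1 L.
rewrite es//= IH /landen_tilde /forget_mark /= ucons_upair utriple_swap.
by rewrite markE ?L//; exact: chain_sum.
Qed.

(** The map [phi] with its pole and its coefficient as parameters. *)
Definition landen_map a c (x : option C) : option C :=
  if x is Some w then if w == a then None else Some (w + c / (w - a)) else None.

Lemma phi_upair a b c (x : option C) : phi (a, upair b c) x = landen_map a ((b - a) * (c - a)) x.
Proof.
case: x => //= w; case: ifP => // _; congr (Some (_ + _ / _)).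
rewrite (perm_big _ (perm_eq_seq_mset [:: b; c])) /=.
by rewrite big_cons big_seq1.
Qed.

Lemma PhiS (e : nat -> C * unordered C 2) N (x : option C) :
  Phi e N.+1 x = Phi e N (phi (e N.+1) x).
Proof.
rewrite /Phi /index_iota !subSS !subn0.
have -> : iota 1 N.+1 = iota 1 N ++ [:: N.+1] by have := iotaD 1 N 1; rewrite [(N + 1)%N]addn1.
rewrite big_cat_nested big_cons big_nil.
elim: (iota 1 N) => [|k s IH]; first by rewrite !big_nil.
by rewrite !big_cons /= IH.
Qed.

End LandenSequence.

(** * Propagation of the error *)

Section PullBack.
Variable R : realType.
Local Notation C := R[i].
Variables (y a c : nat -> C) (F : nat -> option C -> option C).
Hypothesis F0 : forall x, F 0%N x = x.
Hypothesis FS : forall n x, F n.+1 x = F n (landen_map (a n) (c n) x).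
Hypothesis ya : forall n, y n.+1 != a n.
Hypothesis yS : forall n, y n = y n.+1 + c n / (y n.+1 - a n).

(** [phi w - phi y = (w - y) (1 - c / ((w - a) (y - a)))]. *)
Lemma landen_map_lip n (k : R) (w : C) : 0 < k -> 2 * k <= nm (y n.+1 - a n) ->
  nm (w - y n.+1) <= k ->
  exists2 w' : C, landen_map (a n) (c n) (Some w) = Some w' &
    nm (w' - y n) <= (1 + nm (c n) / k ^+ 2) * nm (w - y n.+1).
Proof.
move=> k0 hk hw; have y0 : y n.+1 - a n != 0 by rewrite subr_eq0.
have wk : k <= nm (w - a n).
  by have := nm_tri w (y n.+1) (a n); rewrite (nmC (y n.+1) w); lra.
have w0 : w - a n != 0 by rewrite -nm_gt0 (lt_le_trans k0).
rewrite /= -subr_eq0 (negbTE w0); eexists; first by [].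
have -> : w + c n / (w - a n) - y n =
    (w - y n.+1) * (1 - c n / ((w - a n) * (y n.+1 - a n))).
  by rewrite yS; field; rewrite w0 y0.
rewrite nmM mulrC; apply: ler_wpM2r; first exact: nm_ge0.
apply: le_trans (nmB _ _) _; rewrite nm1 lerD2l nmM nmV nmM.
apply: ler_wpM2l; first exact: nm_ge0.
rewrite lef_pV2 ?posrE; [|by rewrite mulr_gt0 ?nm_gt0|by rewrite exprn_gt0].
rewrite expr2; apply: ler_pM => //; try exact: (ltW k0).
by apply: le_trans hk; rewrite ler_peMl ?(ltW k0)// ler1n.
Qed.

Lemma pull_back_at M : exists K d : R, [/\ 0 < K, 0 < d & forall w : C, nm (w - y M) <= d ->
  exists2 w', F M (Some w) = Some w' & nm (w' - y 0%N) <= K * nm (w - y M)].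
Proof.
elim: M => [|M [K [d [K0 d0 IH]]]].
  by exists 1, 1; split=> // w _; exists w; rewrite ?F0// mul1r.
have y0 : 0 < nm (y M.+1 - a M) by rewrite nm_gt0 subr_eq0.
pose k := nm (y M.+1 - a M) / 2; have k0 : 0 < k by rewrite divr_gt0.
pose L := 1 + nm (c M) / k ^+ 2.
have L0 : 0 < L by rewrite ltr_pwDl// divr_ge0 ?nm_ge0// exprn_ge0// ltW.
exists (K * L), (Num.min k (d / L)); split; first exact: mulr_gt0.
  by rewrite lt_min k0 divr_gt0.
move=> w; rewrite le_min => /andP[wk wd].
have hk : 2 * k <= nm (y M.+1 - a M) by rewrite /k; lra.
have [w1 e1 h1] := landen_map_lip k0 hk wk; rewrite -/L in h1.
have h2 : L * nm (w - y M.+1) <= d by rewrite mulrC -ler_pdivlMr.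
have [w2 e2 h3] := IH w1 (le_trans h1 h2).
exists w2; first by rewrite FS e1.
by apply: le_trans h3 _; rewrite -mulrA ler_pM2l.
Qed.

Variables (k : R) (M : nat).
Hypothesis k0 : 0 < k.
Hypothesis far : forall n, (M <= n)%N -> 2 * k <= nm (y n.+1 - a n) /\ nm (c n) <= k ^+ 2.

(** From the index [M] on, each map doubles the error at most, and the factor [2 ^ j]
keeps the error small enough at all earlier steps. *)
Lemma pull_back_from : exists K d : R, [/\ 0 < K, 0 < d & forall j (w : C),
  2 ^+ j * nm (w - y (M + j)%N) <= d ->
  exists2 w', F (M + j)%N (Some w) = Some w' &
    nm (w' - y 0%N) <= K * (2 ^+ j * nm (w - y (M + j)%N))].
Proof.
have [K [d [K0 d0 HM]]] := pull_back_at M.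
exists K, (Num.min d k); split=> //; first by rewrite lt_min d0.
elim=> [|j IH] w; rewrite le_min => /andP[wd wk].
  by move: wd; rewrite addn0 expr0 mul1r => /HM.
have p0 : 0 < 2 ^+ j :> R by rewrite exprn_gt0.
have [hk hc] := far (leq_addr j M); rewrite addnS in wd wk *.
have n0 := nm_ge0 (w - y (M + j).+1).
have wk1 : nm (w - y (M + j).+1) <= k.
  by apply: le_trans wk; rewrite ler_peMl// exprn_ege1// ler1n.
have [w1 e1 h1] := landen_map_lip k0 hk wk1.
have h2 : nm (w1 - y (M + j)%N) <= 2 * nm (w - y (M + j).+1).
  apply: le_trans h1 _; apply: ler_wpM2r => //.
  have : nm (c (M + j)%N) / k ^+ 2 <= 1 by rewrite ler_pdivrMr ?mul1r// exprn_gt0.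
  lra.
have h3 : 2 ^+ j * nm (w1 - y (M + j)%N) <= 2 ^+ j.+1 * nm (w - y (M + j).+1).
  by rewrite exprS -mulrA mulrCA ler_pM2l.
have [|w2 e2 h4] := IH w1; first by rewrite (le_trans h3)// le_min wd wk.
exists w2; first by rewrite FS e1.
by apply: le_trans h4 _; rewrite ler_pM2l.
Qed.

Lemma pull_back (x : nat -> C) : qsmall (fun n => nm (x n - y n)) ->
  exists b q : R, [/\ 0 < b, 0 < q & exists N, forall n, (N <= n)%N ->
    exists2 w, F n (Some (x n)) = Some w & nm (w - y 0%N) <= b * expR (- (q * 2 ^+ n))].
Proof.
move=> hx; have hx2 := qsmall_pow2 hx (fun n => nm_ge0 _).
have [K [d [K0 d0 H]]] := pull_back_from.
have [N1 h1] := qsmall_lt hx2 d0.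
have [b [q [b0 q0 [N2 h2]]]] := hx2.
exists (K * b), q; split=> //; first exact: mulr_gt0.
exists (maxn M (maxn N1 N2)) => n; rewrite !geq_max => /and3P[Mn /h1 h1n /h2 h2n].
have nE : n = (M + (n - M))%N by rewrite subnKC.
have le : 2 ^+ (n - M) * nm (x n - y n) <= 2 ^+ n * nm (x n - y n).
  by apply: ler_wpM2r; [exact: nm_ge0|rewrite ler_eXn2l ?leq_subr// ltr1n].
have := H (n - M)%N (x n); rewrite -nE => -[|w e hw].
  by apply: le_trans le _; exact: ltW.
exists w => //; apply: le_trans hw _; rewrite -mulrA ler_pM2l//.
exact: le_trans le h2n.
Qed.

End PullBack.

(** * The starting value *)

Section Start.
Variable R : realType.
Local Notation C := R[i].
Implicit Types (g v w z : C).

Lemma csinN w : csin (- w) = - csin w.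
Proof. by rewrite /csin mulrN opprK -[RHS]mulNr opprB. Qed.

(** As [csin ^+ 2] is even, it depends on the square of its argument only, and
one of the two square roots of a number near [w ^+ 2] is near [w]. *)
Lemma csin_sqr_lip w : w != 0 -> exists2 K : R, 0 <= K & forall v,
  nm (v ^+ 2 - w ^+ 2) <= nm w ->
  nm (csin v ^+ 2 - csin w ^+ 2) <= K * nm (v ^+ 2 - w ^+ 2).
Proof.
move=> w0; have n0 : 0 < nm w by rewrite nm_gt0.
have [K K0 HK] := csin_lip w; pose S := nm (csin w).
have S0 : 0 <= S := nm_ge0 _.
exists (K * (K + 2 * S) / nm w); first by rewrite divr_ge0 ?(ltW n0)// mulr_ge0// addr_ge0// mulr_ge0.
move=> v hv.
suff near u : u ^+ 2 = v ^+ 2 -> csin u ^+ 2 = csin v ^+ 2 -> nm w <= nm (u + w) ->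
    nm (csin v ^+ 2 - csin w ^+ 2) <= K * (K + 2 * S) / nm w * nm (v ^+ 2 - w ^+ 2).
  have [|h] := leP (nm w) (nm (v + w)); first exact: near.
  apply: (near (- v)); rewrite ?sqrrN// ?csinN ?sqrrN//.
  have := nm_sub (2 * w) (v + w); rewrite [nm (2 * w)]nmM nm_nat.
  have -> : 2 * w - (v + w) = - v + w by ring.
  lra.
move=> eu es hu; have e : v ^+ 2 - w ^+ 2 = (u - w) * (u + w) by rewrite -eu; ring.
have hd : nm (u - w) <= nm (v ^+ 2 - w ^+ 2) / nm w.
  by rewrite ler_pdivlMr// e [leRHS]nmM ler_wpM2l// nm_ge0.
have hd1 : nm (u - w) <= 1.
  by apply: le_trans hd _; rewrite ler_pdivrMr// mul1r.
have := HK _ hd1; rewrite [w + _]addrC subrK => h1.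
have h2 : nm (csin u + csin w) <= K + 2 * S.
  rewrite (_ : csin u + csin w = (csin u - csin w) + 2 * csin w); last by ring.
  apply: le_trans (nmD _ _) _; rewrite [nm (2 * _)]nmM nm_nat lerD2r.
  by apply: le_trans h1 _; rewrite ler_piMr.
rewrite -es subr_sqr nmM; apply: le_trans (ler_pM (nm_ge0 _) (nm_ge0 _) h1 h2) _.
have -> : K * (K + 2 * S) / nm w * nm (v ^+ 2 - w ^+ 2) =
    K * (nm (v ^+ 2 - w ^+ 2) / nm w) * (K + 2 * S) by field; rewrite gt_eqF.
by apply: ler_wpM2r; [rewrite addr_ge0// mulr_ge0|apply: ler_wpM2l].
Qed.

(** The argument of the sine enters through its square [- 3 (e n).1 z ^ 2] only, which
converges to [(pi z / g) ^ 2]. *)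
Lemma start_limit g z (e : nat -> C * unordered C 2) : g != 0 -> ~ multiples g z ->
  qcvg (fun n => (e n).1) (- (pi%:C / g) ^+ 2 / 3) ->
  exists x : nat -> C, qcvg x (wps (multiples g) z) /\
    exists N, forall n, (N <= n)%N -> start z e n = Some (x n).
Proof.
move=> g0 hz he; have [s0 ->] := wps_multiples g0 hz.
have n3 : (3 : C) != 0 by rewrite pnatr_eq0.
have z0 : z != 0 by apply/eqP => e0; apply: hz; rewrite e0; exact: multiples0.
have p0 := @pi_neq0 R; have i0 := @i_neq0 R; have [P PE] : exists P : C, P = pi%:C by exists pi%:C.
rewrite -PE in p0 s0 he *.
set w := P * z / g in s0 *.
have w0 : w != 0 by rewrite /w !mulf_neq0 ?invr_eq0.
have cancel (x I T : C) : I != 0 -> P * x * (T / (I * P)) = x * T / I.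
  by move=> I0; field; rewrite I0 p0.
pose W n := P * z / ('i%C * P / sqrtC (3 * (e n).1)).
have W2 n : W n ^+ 2 - w ^+ 2 = - 3 * z ^+ 2 * ((e n).1 - - (P / g) ^+ 2 / 3).
  have Wn : W n = z * sqrtC (3 * (e n).1) / 'i%C.
    by rewrite /W invf_div cancel.
  rewrite Wn !exprMn sqrtCK exprVn ['i%C ^+ 2]expr2 sqr_iC invrN1 /w.
  by field; rewrite g0.
have [K K0 HK] := csin_sqr_lip w0.
have hs : qcvg (fun n => csin (W n) ^+ 2) (csin w ^+ 2).
  apply: (@qsmall_dom _ _ _ (K * nm (- 3 * z ^+ 2)) he).
    have d0 : 0 < nm w / (nm (- 3 * z ^+ 2) + 1).
      by rewrite divr_gt0 ?nm_gt0// ltr_wpDl// nm_ge0.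
    have [N HN] := qcvg_near he d0; exists N => n /HN.
    rewrite ltr_pdivlMr; last by rewrite ltr_wpDl// nm_ge0.
    move=> h; rewrite -mulrA -nmM -W2; apply: HK; rewrite W2 nmM mulrC.
    by apply: le_trans (ltW h); rewrite ler_wpM2l ?nm_ge0// lerDl.
  by rewrite mulr_ge0// nm_ge0.
have s20 : csin w ^+ 2 != 0 by rewrite sqrf_eq0.
pose x n := -3 * (e n).1 * (1 * (csin (W n) ^+ 2)^-1 + - (1 / 3)).
exists x; split.
  have := qcvgM (qcvgM (qcvg_cst (-3)) he) (qcvgD (qcvgM (qcvg_cst 1) (qcvgV s20 hs)) (qcvg_cst (- (1 / 3)))).
  have -> : -3 * (- (P / g) ^+ 2 / 3) = (P / g) ^+ 2 by field; rewrite ?n3 ?g0.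
  by [].
have n0 : 0 < nm (csin w ^+ 2) by rewrite nm_gt0.
have [N HN] := qcvg_near hs n0; exists N => n /HN h.
have sn : csin (W n) != 0.
  by apply: contraTneq h => ->; rewrite expr2 mul0r sub0r nmN ltxx.
rewrite /start /omega -PE -/(W n) (negbTE sn); congr (Some _); rewrite /x.
congr (_ * _).
rewrite -expr_div_n invf_div -[X in X * _]mulr1 cancel// mul1r expr_div_n sqrtCK.
by rewrite ['i%C ^+ 2]expr2 sqr_iC invrN1 mulrN1 mulNr.
Qed.
End Start.

(** * Quadratic convergence *)

Section Assembly.
Variable R : realType.
Local Notation C := R[i].
Implicit Types (A B z g eps : C).

Lemma wp_wps (A B z : C) : cross A B != 0 -> ~ hlat A B z -> wp (hlat A B) z = hwp A B z.
Proof.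
move=> h hz; rewrite /wp /hwp /wps; congr (_ + _); apply: lattice_sumE.
by apply: wpt_sum; [exact: sparse_lat (cross_hlat h)|exact: hlat0|move=> []].
Qed.

(** The increments are [(value2 - value3) ^ 2 / 16] over denominators that tend to a
nonzero number. *)
Lemma chain_wp_qcvg A B z eps : cross A B != 0 ->
  (forall n, value2 A B n != value3 A B n) -> qcvg (value2 A B) eps ->
  qsmall (fun n => nm (value2 A B n - value3 A B n)) ->
  ~ hlat A B z -> wps (chain_inf A B) z != eps ->
  qcvg (fun n => chain_wp A B n z) (wps (chain_inf A B) z) /\
  exists2 k : R, 0 < k & exists M, forall n, (M <= n)%N ->
    2 * k <= nm (chain_wp A B n.+1 z - value2 A B n.+1) /\
    nm ((value2 A B n - value3 A B n) ^+ 2 / 16) <= k ^+ 2.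
Proof.
move=> h hne q2 qd hz; set Y := wps _ z => Ye.
have hzn n : ~ chain_lat A B n z by move=> /(chain_lat_le h (leq0n n)).
have ty : tends (fun n => chain_wp A B n z) Y.
  by apply: chain_wp_tends => // /(_ 0%N).
pose k := nm (Y - eps) / 4.
have k0 : 0 < k by rewrite divr_gt0// nm_gt0 subr_eq0.
have [N1 h1] := ty k k0; have [N2 h2] := qcvg_near q2 k0.
have far n : (maxn N1 N2 <= n)%N -> 2 * k <= nm (chain_wp A B n.+1 z - value2 A B n.+1).
  rewrite geq_max => /andP[/leqW/h1 a1 /leqW/h2 a2].
  have := nm_tri (chain_wp A B n.+1 z) Y eps.
  have := nm_tri (value2 A B n.+1) (chain_wp A B n.+1 z) eps.
  rewrite (nmC Y (chain_wp A B n.+1 z)).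
  have : nm (Y - eps) = 4 * k by rewrite /k; field.
  lra.
have [N3 h3] := qsmall_lt qd ltr01.
have [N4 h4] := qsmall_lt qd k0.
have sq n : nm ((value2 A B n - value3 A B n) ^+ 2 / 16) = nm (value2 A B n - value3 A B n) ^+ 2 / 16.
  by rewrite nmM nmX nmV nm_nat.
split; last first.
  exists k => //; exists (maxn (maxn N1 N2) N4) => n; rewrite geq_max => /andP[/far f /h4 s].
  split=> //; rewrite sq.
  have : nm (value2 A B n - value3 A B n) ^+ 2 <= k ^+ 2.
    by apply: lerXn2r; rewrite ?nnegrE ?nm_ge0 ?(ltW k0)// ltW.
  by have := sqr_ge0 (nm (value2 A B n - value3 A B n)); lra.
apply: (qsmall_tail _ ty); apply: (@qsmall_dom _ _ _ (1 / (32 * k)) qd).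
  exists (maxn (maxn N1 N2) N3) => n; rewrite geq_max => /andP[/far f /h3 s].
  have [y0 ->] := chain_phi h (hzn n) (hne n).
  set c := (_ - _) ^+ 2 / 16; set d := chain_wp A B n.+1 z - _ in f *.
  have -> : chain_wp A B n.+1 z - (chain_wp A B n.+1 z + c / d) = - (c / d) by ring.
  rewrite nmN nmM nmV ler_pdivrMr; last by lra.
  rewrite /c sq; move: (nm_ge0 (value2 A B n - value3 A B n)) s f.
  move: (nm (value2 A B n - value3 A B n)) (nm d) => x u x0 x1 hu.
  have -> : 1 / (32 * k) * x * u = x / 16 * (u / (2 * k)) by field; rewrite gt_eqF.
  have : 1 <= u / (2 * k) by rewrite ler_pdivlMr ?mul1r// mulr_gt0.
  have : x ^+ 2 <= x by rewrite expr2 ler_piMr// ltW.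
  move: (u / _) => v hx hv.
  have : x / 16 * 1 <= x / 16 * v by rewrite ler_wpM2l// divr_ge0.
  lra.
by rewrite divr_ge0// mulr_ge0// ltW.
Qed.

End Assembly.

Theorem proposition5p2 (R : realType) (G : set R[i]) (hG : is_lattice G)
    (e1 e2 e3 : R[i])
    (he_distinct : uniq [:: e1; e2; e3])
    (he_root : all (root (weierstrass_cubic G)) [:: e1; e2; e3])
    (he_order : properly_ordered e1 e2 e3)
    (e : nat -> R[i] * unordered R[i] 2)
    (he_init : e 1%N = landen (e1, upair e2 e3))
    (he_step : forall n, (2 <= n)%N ->
      e n = landen_tilde (forget_mark (e n.-1)))
    (z : R[i]) (hz : ~ G z) :
  cvg_quadratically (fun N => Phi e N (start z e N)) (wp G z).
Proof.
have [A [B [h GE E1 E23]]] := lattice_half_periods hG he_distinct he_root.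
rewrite GE in hz *; rewrite wp_wps//.
have V1 : e1 = value1 A B 0 by [].
have V23 : upair e2 e3 = upair (value2 A B 0) (value3 A B 0) by [].
have [hne hord] : value2 A B 0 != value3 A B 0 /\
    (nm (value2 A B 0 - value3 A B 0) <= nm (value1 A B 0 - value2 A B 0) /\
     nm (value2 A B 0 - value3 A B 0) <= nm (value1 A B 0 - value3 A B 0)).
  move: he_distinct he_order; rewrite /= !inE negb_or /properly_ordered !lec_nm.
  move=> /and3P[_ n23 _] /andP[d1 d2]; rewrite -V1.
  have [[<- <-]|[<- <-]] := upair_inj V23.
    by split=> //; split=> //; exact: le_trans d1 d2.
  by rewrite eq_sym (nmC e3 e2); split=> //; split=> //; exact: le_trans d1 d2.
have [eps [eps0 q1 q2 q3 [qd m1 m2]]] := chain_limits h hne hord.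
have [g gE] := chain_inf_multiples h.
have [g0 epsE] := limit_value h eps0 (qcvg_tends q1) (qcvg_tends q2) (qcvg_tends q3) gE.
rewrite V1 V23 in he_init.
have eE := landen_sequence h m1 m2 he_init he_step.
have hzg : ~ multiples g z by rewrite -gE => /(_ 0%N).
have ne n := chain_ne h hne n.
have qe : qcvg (fun n => (e n).1) (- (pi%:C / g) ^+ 2 / 3).
  rewrite -epsE; apply: qsmall_pred; apply: qsmall_le (qsmallS q2) _.
  by exists 0%N => n _; rewrite eE.
have [x [qx [N0 hx]]] := start_limit g0 hzg qe.
have [qy [k k0 [M hM]]] : qcvg (fun n => chain_wp A B n z) (wps (chain_inf A B) z) /\
  exists2 k : R, 0 < k & exists M, forall n, (M <= n)%N ->
    2 * k <= nm (chain_wp A B n.+1 z - value2 A B n.+1) /\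
    nm ((value2 A B n - value3 A B n) ^+ 2 / 16) <= k ^+ 2.
  apply: chain_wp_qcvg q2 qd hz _ => //.
  rewrite gE; have [s0 ->] := wps_multiples g0 hzg.
  rewrite epsE -subr_eq0.
  have -> : (pi%:C / g) ^+ 2 * (1 / csin (pi%:C * z / g) ^+ 2 - 1 / 3) - - (pi%:C / g) ^+ 2 / 3
      = (pi%:C / g / csin (pi%:C * z / g)) ^+ 2.
    by rewrite !expr_div_n; ring.
  by rewrite sqrf_eq0 !mulf_neq0 ?invr_eq0// pi_neq0.
have hzn n : ~ chain_lat A B n z by move=> /(chain_lat_le h (leq0n n)).
have qxy : qsmall (fun n => nm (x n - chain_wp A B n z)).
  rewrite -gE in qx; apply: qsmall_le (qsmallD qx qy) _; exists 0%N => n _.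
  by rewrite (nmC (chain_wp A B n z)); exact: nm_tri.
have FS n (w : option R[i]) : Phi e n.+1 w = Phi e n
    (landen_map (value2 A B n.+1) ((value2 A B n - value3 A B n) ^+ 2 / 16) w).
  rewrite PhiS eE phi_upair; congr (Phi e n (landen_map _ _ w)).
  by rewrite -chain_prod// [16 * _ / _]mulrAC divff ?mul1r// pnatr_eq0.
have F0 (w : option R[i]) : Phi e 0 w = w by rewrite /Phi big_geq.
have [b [q [b0 q0 [N hN]]]] := pull_back F0 FS (fun n => (chain_phi h (hzn n) (ne n)).1)
  (fun n => (chain_phi h (hzn n) (ne n)).2) k0 hM qxy.
exists b, q; split=> //; exists (maxn N0 N) => // n /=.
rewrite geq_max => /andP[/hx -> /hN [w ew hw]]; exists w => //.
by rewrite normE lecR.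
Qed.
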